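(* Let $\mathbb{K}$ be the field of generalized real Puiseux series and $\mathrm{val}$ its valuation, applied coordinatewise. For every $n\ge 1$ and every convex semialgebraic set $\mathbf{S}\subset\mathbb{K}^n$, there exist an integer $n'\ge 0$ and a spectrahedron $\mathbf{S}'\subset\mathbb{K}^{n+n'}$ such that $\mathrm{val}(\mathbf{S})=\mathrm{val}(\boldsymbol{\pi}(\mathbf{S}'))$, where $\boldsymbol{\pi}:\mathbb{K}^{n+n'}\to\mathbb{K}^n$ is the projection onto the first $n$ coordinates.
   Context: A generalized real Puiseux series is a formal series $\mathbf{x}=\sum_{i\ge1}c_{\lambda_i}t^{\lambda_i}$ where $t$ is a formal parameter, $(\lambda_i)$ is a strictly decreasing sequence of real numbers that is either finite or unbounded, and all $c_{\lambda_i}\in\mathbb{R}\setminus\{0\}$; the empty series is $0$. These series form a real closed field $\mathbb{K}$, ordered by $\mathbf{x}\ge\mathbf{y}$ iff the leading coefficient $c_{\lambda_1}$ of $\mathbf{x}-\mathbf{y}$ is $\ge 0$ (leading coefficient of $0$ is $0$). The valuation is $\mathrm{val}(\mathbf{x})=\lambda_1$ (leading exponent), $\mathrm{val}(0)=-\infty$; it takes values in $\mathbb{R}\cup\{-\infty\}$ and is applied coordinatewise to vectors. A set $\mathbf{S}\subset\mathbb{K}^n$ is basic semialgebraic if it is of the form $\{\mathbf{x}: \mathbf{P}_i(\mathbf{x})>0,\ i=1..p;\ \mathbf{P}_i(\mathbf{x})=0,\ i=p+1..q\}$ with polynomials $\mathbf{P}_i\in\mathbb{K}[X_1,\dots,X_n]$,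 and semialgebraic if it is a finite union of basic semialgebraic sets. Convexity over $\mathbb{K}$ is the usual notion (closed under $\boldsymbol\lambda\mathbf{x}+(1-\boldsymbol\lambda)\mathbf{y}$, $0\le\boldsymbol\lambda\le1$). A spectrahedron in $\mathbb{K}^N$ is a set $\{\mathbf{x}\in\mathbb{K}^N: \mathbf{Q}^{(0)}+\mathbf{x}_1\mathbf{Q}^{(1)}+\dots+\mathbf{x}_N\mathbf{Q}^{(N)}\succeq 0\}$ for symmetric matrices $\mathbf{Q}^{(k)}\in\mathbb{K}^{m\times m}$, where $\succeq0$ means positive semidefinite (equivalently, all principal minors are nonnegative). *)

(* Defs.v *)
From Stdlib Require Import Reals List ClassicalEpsilon.
From Stdlib Require Vectors.Fin.
Open Scope R_scope.

(** * The field K of generalized real Puiseux series.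
    A series  sum_i c_i t^{lambda_i}  (lambda_i strictly decreasing, finite or
    unbounded, c_i <> 0) is represented by its coefficient function
    f : R -> R  (f lambda = coefficient of t^lambda).  The condition
    "decreasing sequence which is finite or unbounded" is exactly: for every
    bound M, only finitely many exponents >= M carry a nonzero coefficient. *)

Definition coeffs := R -> R.

Definition fin_above (f : coeffs) (M : R) (l : list R) : Prop :=
  forall x, M <= x -> f x <> 0 -> In x l.

Definition is_series (f : coeffs) : Prop := forall M, exists l, fin_above f M l.

(** exact, duplicate-free list of the support of f above M (chosen by epsilon;
    well defined for series). *)
Definition supp_list (f : coeffs) (M : R) : list R :=
  epsilon (inhabits nil)
    (fun l => NoDup l /\ forall x, In x l <-> (M <= x /\ f x <> 0)).

Definition supp_ub (f : coeffs) : R := fold_right Rmax 0 (supp_list f 0).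

Definition kzero : coeffs := fun _ => 0.
Definition kone : coeffs := fun t => if Req_EM_T t 0 then 1 else 0.
Definition kadd (f g : coeffs) : coeffs := fun t => f t + g t.
Definition kopp (f : coeffs) : coeffs := fun t => - f t.
Definition ksub (f g : coeffs) : coeffs := kadd f (kopp g).
(** Cauchy product: (fg)_t = sum_{a + b = t} f_a g_b  (a finite sum) *)
Definition kmul (f g : coeffs) : coeffs := fun t =>
  fold_right Rplus 0
    (map (fun a => f a * g (t - a)) (supp_list f (t - supp_ub g))).

Definition kpos (f : coeffs) : Prop :=
  exists l, 0 < f l /\ forall mu, l < mu -> f mu = 0.
Definition kiszero (f : coeffs) : Prop := forall t, f t = 0.
Definition knonneg (f : coeffs) : Prop := kiszero f \/ kpos f.
Definition kle (f g : coeffs) : Prop := knonneg (ksub g f).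

(** valuation: val x = leading exponent, val 0 = -infinity (encoded as None);
    [has_val x v] means val x = v. *)
Definition has_val (f : coeffs) (v : option R) : Prop :=
  match v with
  | None => kiszero f
  | Some l => f l <> 0 /\ forall mu, l < mu -> f mu = 0
  end.

Definition kvec (n : nat) := Fin.t n -> coeffs.
Definition is_kvec {n : nat} (x : kvec n) : Prop := forall i, is_series (x i).

Fixpoint fsum (N : nat) : (Fin.t N -> coeffs) -> coeffs :=
  match N with
  | O => fun _ => kzero
  | S N' => fun f => kadd (f Fin.F1) (fsum N' (fun i => f (Fin.FS i)))
  end.

Inductive kpoly (n : nat) : Type :=
| PVar : Fin.t n -> kpoly n
| PConst : coeffs -> kpoly n
| PAdd : kpoly n -> kpoly n -> kpoly n
| PMul : kpoly n -> kpoly n -> kpoly n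
| POpp : kpoly n -> kpoly n.
Arguments PVar {n}. Arguments PConst {n}. Arguments PAdd {n}.
Arguments PMul {n}. Arguments POpp {n}.

Fixpoint kpoly_ok {n} (p : kpoly n) : Prop :=
  match p with
  | PVar _ => True
  | PConst c => is_series c
  | PAdd p q | PMul p q => kpoly_ok p /\ kpoly_ok q
  | POpp p => kpoly_ok p
  end.

Fixpoint peval {n} (p : kpoly n) (x : kvec n) : coeffs :=
  match p with
  | PVar i => x i
  | PConst c => c
  | PAdd p q => kadd (peval p x) (peval q x)
  | PMul p q => kmul (peval p x) (peval q x)
  | POpp p => kopp (peval p x)
  end.

Definition basic_semialg {n} (S : kvec n -> Prop) : Prop :=
  exists (ps qs : list (kpoly n)),
    Forall kpoly_ok ps /\ Forall kpoly_ok qs /\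
    forall x, S x <-> (is_kvec x /\ Forall (fun p => kpos (peval p x)) ps
                                 /\ Forall (fun q => kiszero (peval q x)) qs).

Definition semialgebraic {n} (S : kvec n -> Prop) : Prop :=
  exists (L : list (kvec n -> Prop)),
    Forall basic_semialg L /\
    forall x, S x <-> exists B, In B L /\ B x.

Definition kconvex {n} (S : kvec n -> Prop) : Prop :=
  forall x y, S x -> S y -> forall lam, is_series lam ->
    kle kzero lam -> kle lam kone ->
    S (fun i => kadd (kmul lam (x i)) (kmul (ksub kone lam) (y i))).

Definition kmat (m : nat) := Fin.t m -> Fin.t m -> coeffs.
Definition is_kmat {m} (A : kmat m) : Prop := forall i j, is_series (A i j).
Definition ksym {m} (A : kmat m) : Prop := forall i j, A i j = A j i.
Definition kpsd {m} (A : kmat m) : Prop :=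
  forall v : kvec m, is_kvec v ->
    knonneg (fsum m (fun i => fsum m (fun j => kmul (v i) (kmul (A i j) (v j))))).

Definition spectrahedron {N} (S : kvec N -> Prop) : Prop :=
  exists (m : nat) (Q0 : kmat m) (Q : Fin.t N -> kmat m),
    is_kmat Q0 /\ (forall k, is_kmat (Q k)) /\ ksym Q0 /\ (forall k, ksym (Q k)) /\
    forall x, S x <-> (is_kvec x /\
      kpsd (fun i j => kadd (Q0 i j) (fsum N (fun k => kmul (x k) (Q k i j))))).

Definition proj_first (n n' : nat) (S : kvec (n + n') -> Prop) : kvec n -> Prop :=
  fun x => exists y, S y /\ forall i, x i = y (Fin.L n' i).

Definition val_image {n} (S : kvec n -> Prop) : (Fin.t n -> option R) -> Prop :=
  fun v => exists x, S x /\ forall i, has_val (x i) (v i).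

(* Main.v *)
(** Let [K] be the field of series, which is real closed by Hensel's lemma. Quantifier elimination over
    [K] applies to the statement that some [x] in [S] satisfies [y^2 <= c x^2] and [x^2 <= c y^2]
    coordinatewise. For a large real [c], the signs of the resulting polynomials at suitable points [y]
    of valuation [l] are those of their dominant terms, so they only depend on the comparisons between
    finitely many affine functions of [l]. Hence, on each coordinate stratum, [val S] is a finite union
    of closed polyhedra with integer normals. It is also tropically convex, as [S] is convex.

    After homogenisation, [x] belongs to the tropical cone spanned by a polyhedral cone [P] iff for every
    coordinate [k] there is [p] in [P] with [p <= x] and [p_k = x_k]. Eliminating [p] leaves inequalities
    [w x_k <= c + sum_i z_i x_i] with natural [z_i] of sum [w]. They lift to
    [X_k^w <= t^c prod_i X_i^(z_i)] over the nonnegative elements of [K], that is, to convex conditions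
    that are representable by 2x2 positive semidefinite blocks. The Minkowski sum of the cones obtained
    for all the polyhedra, cut by the normalisation of the homogenising coordinate, has valuation
    [val S], since sums of nonnegative elements do not cancel. *)

Require Import Defs.
From Stdlib Require Import Reals List.
From Stdlib Require Vectors.Fin.

(* Inside a module, so that the notations of MathComp do not change the reading of the theorem. *)
Module TropicalHeltonNie.
From HB Require Import structures.
From mathcomp Require Import all_boot all_order all_algebra.
From mathcomp Require Import boolp Rstruct polyrcf ordered_qelim mpoly.
From mathcomp Require qe_rcf.
From mathcomp Require Import lra ring zify.
Set Implicit Arguments. Unset Strict Implicit. Unset Printing Implicit Defensive.
Import Order.TTheory GRing.Theory Num.Theory.
Local Open Scope ring_scope.
Bind Scope ring_scope with R.

(** * The field of series *)

(** The valuation is not definable in the language of ordered fields, so quantifier elimination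
    cannot be applied to the points of a given valuation. The relation [near] is a definable
    substitute: comparison of squares up to a real constant [c] forces equal valuations. Its sign
    conditions must survive when strict comparisons between dominant terms degenerate to ties, so
    the test points carry tie-breaking factors. This is why the cells are closed, and weak
    inequalities are what the lifted power inequalities can express. Convexity of [S] enters only
    through the scalars [1 - u t^a] and [u t^a], with a real [u] chosen to avoid cancellation. On
    the lifted side there are two dangers. A point of a cone with zero homogenising coordinate would
    contribute a recession direction that nothing controls; the slack condition of [inW] forces such
    a point to be zero. Moreover the lift of a cell has more valuations than the cell itself, but
    all of them are tropical combinations of points of the cell, hence already in [val S]. *)

Lemma InP (T : eqType) (x : T) (s : seq T) : reflect (In x s) (x \in s).
Proof.
elim: s => [|y s IH] /=; first by constructor.
rewrite in_cons; apply: (iffP orP).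
- by case=> [/eqP->|/IH]; [left|right].
- by case=> [->|/IH ->]; [left|right].
Qed.

Lemma NoDupP (T : eqType) (s : seq T) : reflect (NoDup s) (uniq s).
Proof.
elim: s => [|y s IH] /=; first by constructor; constructor.
apply: (iffP andP).
- by case=> /InP ny /IH us; constructor.
- by move=> H; inversion H; subst; split; [apply/InP|apply/IH].
Qed.

Definition ser (f : R -> R) := forall M : R, exists s : seq R, forall x, M <= x -> f x != 0 -> x \in s.

Lemma serP f : is_series f <-> ser f.
Proof.
split=> H M; have [s Hs] := H M; exists s => x.
- by move=> /RleP Mx fx; apply/InP/Hs => //; apply/eqP.
- by move=> /RleP Mx fx; apply/InP/Hs => //; apply/eqP.
Qed.

Lemma supp_listP f M : ser f ->
  uniq (supp_list f M) /\ forall x, (x \in supp_list f M) = (M <= x) && (f x != 0).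
Proof.
move=> sf.
have : exists l, NoDup l /\ forall x, In x l <-> (Rle M x /\ f x <> 0).
  have [s Hs] := sf M.
  exists (undup [seq x <- s | (M <= x) && (f x != 0)]); split.
    by apply/NoDupP/undup_uniq.
  move=> x; split.
  - by move/InP; rewrite mem_undup mem_filter => /andP[/andP[/RleP ? /eqP ?]].
  - move=> [/RleP Mx /eqP fx]; apply/InP; rewrite mem_undup mem_filter Mx fx /=.
    exact: Hs.
move/(ClassicalEpsilon.epsilon_spec (inhabits nil)).
rewrite -/(supp_list f M) => -[/NoDupP u H]; split=> // x.
apply/idP/idP; first by move/InP/H => -[/RleP -> /eqP ->].
by move=> /andP[/RleP ? /eqP ?]; apply/InP/H.
Qed.

Lemma supp_ubP f x : ser f -> f x != 0 -> x <= supp_ub f.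
Proof.
move=> sf fx; have [_ H] := supp_listP 0 sf.
rewrite /supp_ub; move: (H x); case: (leP 0 x) => x0.
- rewrite fx /= => {H}; elim: (supp_list f 0) => //= a l IH; rewrite in_cons RmaxE le_max.
  by case/orP => [/eqP ->|/IH ->]; rewrite ?lexx ?orbT.
- move=> _; apply: (le_trans (ltW x0)) => {H x0}.
  by elim: (supp_list f 0) => //= a l IH; rewrite RmaxE le_max IH orbT.
Qed.

(** [kmul] sums over a list chosen by epsilon. This lemma replaces that list by any other one that
    catches the nonzero terms, for instance one shared by several products. *)
Lemma sum_supp (V : nmodType) (T : eqType) (s1 s2 : seq T) (F : T -> V) :
  uniq s1 -> uniq s2 -> (forall x, F x != 0 -> (x \in s1) = (x \in s2)) ->
  \sum_(x <- s1) F x = \sum_(x <- s2) F x.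
Proof.
have E s : \sum_(x <- s) F x = \sum_(x <- [seq x <- s | F x != 0]) F x.
  by rewrite big_filter [in RHS]big_mkcond; apply: eq_bigr => x _; case: eqP.
move=> u1 u2 H; rewrite E [RHS]E; apply: perm_big.
apply: uniq_perm; rewrite ?filter_uniq // => x; rewrite !mem_filter.
by case: eqP => //= /eqP; apply: H.
Qed.

Lemma kmulE f g (t : R) (s : seq R) : ser f -> ser g -> uniq s ->
  (forall a, f a * g (t - a) != 0 -> a \in s) ->
  kmul f g t = \sum_(a <- s) f a * g (t - a).
Proof.
move=> sf sg us Hs.
have [ul Hl] := supp_listP (t - supp_ub g) sf.
transitivity (\sum_(a <- supp_list f (t - supp_ub g)) f a * g (t - a)).
  rewrite /kmul RminusE; elim: (supp_list _ _) => [|a l IH] /=; first by rewrite big_nil.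
  by rewrite big_cons IH.
apply: sum_supp => // a na; rewrite Hs // Hl.
move: na; rewrite mulf_eq0 negb_or => /andP[-> ga]; rewrite andbT.
by rewrite lerBlDl -lerBlDr supp_ubP.
Qed.

(** The double sum treats both factors alike, so that commutativity becomes an exchange of sums. The
    lists only have to contain exponents that occur in a pair of sum [t]; these are finitely many
    because supports are bounded above. *)
Lemma kmul_pair f g (t : R) (la lb : seq R) : ser f -> ser g -> uniq la -> uniq lb ->
  (forall a b, a + b = t -> f a != 0 -> g b != 0 -> (a \in la) && (b \in lb)) ->
  kmul f g t = \sum_(a <- la) \sum_(b <- lb) (if a + b == t then f a * g b else 0).
Proof.
move=> sf sg ua ub H; rewrite (@kmulE _ _ _ la) //; last first.
  move=> a; rewrite mulf_eq0 negb_or => /andP[fa ga].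
  by have /andP[] := H a (t - a) (subrKC _ _) fa ga.
apply: eq_bigr => a _; rewrite (@sum_supp _ _ lb [:: t - a]) //.
  by rewrite big_seq1 subrKC eqxx.
move=> b; case: (eqVneq (a + b) t) => [abt|]; last by rewrite eqxx.
rewrite mulf_eq0 negb_or => /andP[fa gb]; have /andP[_ ->] := H a b abt fa gb.
rewrite -abt.
by rewrite inE addrC addKr eqxx.
Qed.

Lemma ser_list f M : ser f -> exists s : seq R, uniq s /\ forall x, M <= x -> f x != 0 -> x \in s.
Proof.
by move=> sf; have [s Hs] := sf M; exists (undup s); rewrite undup_uniq; split=> // x; rewrite mem_undup; apply: Hs.
Qed.

Lemma ser_ub f : ser f -> exists U, 0 <= U /\ forall x, f x != 0 -> x <= U.
Proof.
move=> sf; exists (Num.max 0 (supp_ub f)); rewrite le_max lexx; split=> // x fx.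
by rewrite le_max supp_ubP ?orbT.
Qed.

Lemma ser0 : ser kzero. Proof. by move=> M; exists nil => x _; rewrite /kzero eqxx. Qed.
Lemma serD f g : ser f -> ser g -> ser (kadd f g).
Proof.
move=> sf sg M; have [s Hs] := sf M; have [s' Hs'] := sg M; exists (s ++ s') => x Mx.
rewrite mem_cat /kadd RplusE; case: (eqVneq (f x) 0) => [->|fx _]; last by rewrite Hs.
by rewrite add0r => gx; rewrite Hs' ?orbT.
Qed.
Lemma serN f : ser f -> ser (kopp f).
Proof.
by move=> sf M; have [s Hs] := sf M; exists s => x Mx; rewrite /kopp RoppE oppr_eq0; apply: Hs.
Qed.

Definition kmono (c l : R) : coeffs := fun t => if t == l then c else 0.
Lemma kone_mono : kone = kmono 1 0.
Proof. by apply/funext => t; rewrite /kone /kmono; case: RIneq.Req_EM_T => /eqP; [move->|move/negPf->]. Qed.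

Lemma ser_mono c l : ser (kmono c l).
Proof.
move=> M; exists [:: l] => x _; rewrite /kmono inE; case: (x == l) => //; by rewrite eqxx.
Qed.

Lemma serM f g : ser f -> ser g -> ser (kmul f g).
Proof.
move=> sf sg M.
have [U [U0 HU]] := ser_ub sf; have [V [V0 HV]] := ser_ub sg.
have [la [ua Ha]] := ser_list (M - V) sf; have [lb [ub Hb]] := ser_list (M - U) sg.
(* A nonzero coefficient at [x >= M] needs exponents [a + b = x] with [a <= U] and [b <= V], hence
   [a >= M - V] and [b >= M - U]. *)
exists [seq a + b | a <- la, b <- lb] => x Mx nx.
apply: contraNT nx => xn.
rewrite (@kmul_pair _ _ _ la lb) //; last first.
  move=> a b abx fa gb; rewrite Ha ?Hb //; first by have := HU _ fa; lra.
  by have := HV _ gb; lra.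
apply/eqP; rewrite big_seq big1 // => a ia; rewrite big_seq big1 // => b ib.
case: eqP => // abx; case/negP: xn; rewrite -abx; exact: allpairs_f.
Qed.

Lemma kmulC f g : ser f -> ser g -> kmul f g = kmul g f.
Proof.
move=> sf sg; apply/funext => t.
have [U [U0 HU]] := ser_ub sf; have [V [V0 HV]] := ser_ub sg.
have [la [ua Ha]] := ser_list (t - V) sf; have [lb [ub Hb]] := ser_list (t - U) sg.
have H a b : a + b = t -> f a != 0 -> g b != 0 -> (a \in la) && (b \in lb).
  move=> abx fa gb; rewrite Ha ?Hb //; first by have := HU _ fa; lra.
  by have := HV _ gb; lra.
rewrite (kmul_pair sf sg ua ub) // (kmul_pair sg sf ub ua); last first.
  by move=> b a ab gb fa; rewrite andbC; apply: H => //; rewrite addrC.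
rewrite exchange_big; apply: eq_bigr => b _; apply: eq_bigr => a _.
by rewrite addrC mulrC.
Qed.

(** Both bracketings of a triple product reduce to this symmetric sum. Exponents below [t - U - U]
    cannot occur, since the two others are at most [U]. *)
Lemma kmul_triple f g h (la lb lc : seq R) (t U : R) : ser f -> ser g -> ser h ->
  (forall x, f x != 0 -> x <= U) -> (forall x, g x != 0 -> x <= U) -> (forall x, h x != 0 -> x <= U) ->
  uniq la -> uniq lb -> uniq lc ->
  (forall x, t - U - U <= x -> f x != 0 -> x \in la) ->
  (forall x, t - U - U <= x -> g x != 0 -> x \in lb) ->
  (forall x, t - U - U <= x -> h x != 0 -> x \in lc) ->
  kmul f (kmul g h) t =
  \sum_(a <- la) \sum_(b <- lb) \sum_(c <- lc) (if a + b + c == t then f a * g b * h c else 0).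
Proof.
move=> sf sg sh Uf Ug Uh ua ub uc Ha Hb Hc.
have sgh := serM sg sh.
have Ugh x : kmul g h x != 0 -> x <= U + U.
  apply: contraNT; rewrite -ltNge => Ux; rewrite (@kmulE _ _ _ nil) ?big_nil // => a.
  by rewrite mulf_eq0 negb_or => /andP[/Ug ? /Uh ?]; lra.
rewrite (kmulE sf sgh ua); last first.
  by move=> a; rewrite mulf_eq0 negb_or => /andP[fa /Ugh ?]; apply: Ha => //; lra.
apply: eq_bigr => a _; case: (eqVneq (f a) 0) => [->|fa].
  rewrite mul0r big1 // => b _; rewrite big1 // => c _; by rewrite !mul0r if_same.
rewrite (kmul_pair sg sh ub uc); last first.
  move=> b c bc gb hc; have := Uf _ fa; have := Ug _ gb; have := Uh _ hc => ? ? ?.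
  by rewrite Hb ?Hc //; lra.
rewrite mulr_sumr; apply: eq_bigr => b _; rewrite mulr_sumr; apply: eq_bigr => c _.
have -> : (b + c == t - a) = (a + b + c == t) by rewrite -(inj_eq (addrI a)) addrA subrKC.
by case: eqP => // _; rewrite ?mulr0 // mulrA.
Qed.

Lemma kmulA f g h : ser f -> ser g -> ser h -> kmul f (kmul g h) = kmul (kmul f g) h.
Proof.
move=> sf sg sh; apply/funext => t; rewrite [RHS](congr1 (@^~ t) (kmulC (serM sf sg) sh)).
have [U1 [_ H1]] := ser_ub sf; have [U2 [_ H2]] := ser_ub sg; have [U3 [_ H3]] := ser_ub sh.
pose U := Num.max U1 (Num.max U2 U3).
have [la [ua Ha]] := ser_list (t - U - U) sf.
have [lb [ub Hb]] := ser_list (t - U - U) sg.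
have [lc [uc Hc]] := ser_list (t - U - U) sh.
have G1 x : f x != 0 -> x <= U by move=> /H1; rewrite !le_max => ->.
have G2 x : g x != 0 -> x <= U by move=> /H2; rewrite !le_max => ->; rewrite orbT.
have G3 x : h x != 0 -> x <= U by move=> /H3; rewrite !le_max => ->; rewrite !orbT.
rewrite (@kmul_triple f g h la lb lc t U) // (@kmul_triple h f g lc la lb t U) //.
symmetry; rewrite exchange_big /=; apply: eq_bigr => a _.
rewrite exchange_big /=; apply: eq_bigr => b _; apply: eq_bigr => c _.
rewrite (_ : c + a + b = a + b + c); last by ring.
by rewrite (_ : h c * f a * g b = f a * g b * h c); last by ring.
Qed.

Lemma kmul_mono c l f t : ser f -> kmul (kmono c l) f t = c * f (t - l).
Proof.
move=> sf; rewrite (@kmulE _ _ _ [:: l]) //.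
- by rewrite big_seq1 /kmono eqxx.
- exact: ser_mono.
- by move=> a; rewrite /kmono inE; case: (a == l) => //; rewrite mul0r eqxx.
Qed.

Lemma kmulDl f g h : ser f -> ser g -> ser h -> kmul (kadd f g) h = kadd (kmul f h) (kmul g h).
Proof.
move=> sf sg sh; apply/funext => t; rewrite /kadd RplusE.
have [U [_ HU]] := ser_ub sh.
have [la [ua Ha]] := ser_list (t - U) sf; have [lb [ub Hb]] := ser_list (t - U) sg.
pose s := undup (la ++ lb).
have us : uniq s by rewrite undup_uniq.
have H a : f a != 0 \/ g a != 0 -> h (t - a) != 0 -> a \in s.
  by rewrite mem_undup mem_cat => -[] fa /HU ?; [rewrite Ha|rewrite Hb ?orbT] => //; lra.
rewrite (kmulE (serD sf sg) sh us); last first.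
  move=> a; rewrite mulf_eq0 negb_or => /andP[fa ha]; apply: H => //; move: fa.
  by rewrite /kadd RplusE; case: (eqVneq (f a) 0) => [->|]; [rewrite add0r; right|left].
rewrite (kmulE sf sh us); last by move=> a; rewrite mulf_eq0 negb_or => /andP[? ?]; apply: H => //; left.
rewrite (kmulE sg sh us); last by move=> a; rewrite mulf_eq0 negb_or => /andP[? ?]; apply: H => //; right.
by rewrite -big_split; apply: eq_bigr => a _; rewrite /= /kadd RplusE mulrDl.
Qed.

Record K := MkK { kf :> R -> R; kfP : is_series kf }.

Lemma K_ext (x y : K) : (forall t, x t = y t) -> x = y.
Proof.
case: x y => [f Hf] [g Hg] /= /funext E; case: _ / E Hg => Hg.
by congr MkK; apply: Prop_irrelevance.
Qed.

Lemma kser (x : K) : ser x. Proof. by apply/serP/kfP. Qed.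

HB.instance Definition _ := gen_eqMixin K.
HB.instance Definition _ := gen_choiceMixin K.

Definition mkK f (H : ser f) : K := MkK (proj2 (serP f) H).
Definition K0 := mkK ser0.
Definition KD (x y : K) := mkK (serD (kser x) (kser y)).
Definition KN (x : K) := mkK (serN (kser x)).
Definition KM (x y : K) := mkK (serM (kser x) (kser y)).
Definition mono c l := mkK (ser_mono c l).

Fact KDA : associative KD.
Proof. by move=> x y z; apply: K_ext => t; rewrite /= /kadd !RplusE addrA. Qed.
Fact KDC : commutative KD.
Proof. by move=> x y; apply: K_ext => t; rewrite /= /kadd !RplusE addrC. Qed.
Fact KD0 : left_id K0 KD.
Proof. by move=> x; apply: K_ext => t; rewrite /= /kadd !RplusE add0r. Qed.
Fact KDN : left_inverse K0 KN KD.
Proof. by move=> x; apply: K_ext => t; rewrite /= /kadd /kopp !RplusE addNr. Qed.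
HB.instance Definition _ := GRing.isZmodule.Build K KDA KDC KD0 KDN.

Fact KMA : associative KM.
Proof. by move=> x y z; apply: K_ext => t; rewrite /= kmulA //; apply: kser. Qed.
Fact KMC : commutative KM.
Proof. by move=> x y; apply: K_ext => t; rewrite /= kmulC //; apply: kser. Qed.
Fact KM1 : left_id (mono 1 0) KM.
Proof. by move=> x; apply: K_ext => t; rewrite /= kmul_mono ?mul1r ?subr0 //; apply: kser. Qed.
Fact KMDl : left_distributive KM KD.
Proof. by move=> x y z; apply: K_ext => t; rewrite /= kmulDl //; apply: kser. Qed.
Fact K1n0 : mono 1 0 != K0.
Proof.
apply/eqP => /(congr1 (fun x : K => x 0)) /=; rewrite /kmono /kzero eqxx => /eqP.
by rewrite oner_eq0.
Qed.
HB.instance Definition _ := GRing.Zmodule_isComNzRing.Build K KMA KMC KM1 KMDl K1n0.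

(** * Coefficients, valuations and leading terms *)

Lemma kD (x y : K) t : (x + y) t = x t + y t. Proof. by []. Qed.
Lemma kN (x : K) t : (- x) t = - x t. Proof. by []. Qed.
Lemma kB (x y : K) t : (x - y) t = x t - y t. Proof. by []. Qed.
Lemma k0 t : (0 : K) t = 0. Proof. by []. Qed.
Lemma kmE (x y : K) : kf (x * y) = kmul x y. Proof. by []. Qed.
Lemma monoE c l t : mono c l t = if t == l then c else 0. Proof. by []. Qed.
Lemma mono_mul c l (x : K) t : (mono c l * x) t = c * x (t - l).
Proof. by rewrite kmE kmul_mono //; apply: kser. Qed.
Lemma mono1 : mono 1 0 = 1. Proof. by []. Qed.
Lemma monoM c l c' l' : mono c l * mono c' l' = mono (c * c') (l + l').
Proof.
apply: K_ext => t; rewrite mono_mul !monoE subr_eq addrC.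
by case: eqP; rewrite ?mulr0.
Qed.
Lemma monoX c l n : mono c l ^+ n = mono (c ^+ n) (l *+ n).
Proof. by elim: n => [|n IH]; rewrite ?expr0 ?mulr0n ?mono1 // exprS IH monoM [in RHS]exprS mulrS. Qed.

(** An upper bound for the valuation rather than the valuation itself: it covers zero, it is stable
    under sums and products, and the coefficient at the bound is multiplicative even when it
    vanishes ([lcM]). *)
Definition vle (x : K) (a : R) := forall t, a < t -> x t = 0.

Lemma vle0 a : vle 0 a. Proof. by []. Qed.
Lemma vleD x y a : vle x a -> vle y a -> vle (x + y) a.
Proof. by move=> hx hy t at_; rewrite kD hx // hy // addr0. Qed.
Lemma vleN x a : vle x a -> vle (- x) a.
Proof. by move=> hx t at_; rewrite kN hx // oppr0. Qed.
Lemma vleB x y a : vle x a -> vle y a -> vle (x - y) a.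
Proof. by move=> hx hy; apply: vleD => //; apply: vleN. Qed.
Lemma vle_sum (I : Type) (s : seq I) (P : pred I) (F : I -> K) a :
  (forall i, P i -> vle (F i) a) -> vle (\sum_(i <- s | P i) F i) a.
Proof.
by move=> H; apply: (big_ind (fun x => vle x a)) ; [exact: vle0|move=> x y; exact: vleD|exact: H].
Qed.
Lemma vle_le x a b : a <= b -> vle x a -> vle x b.
Proof. by move=> ab hx t bt; apply: hx; apply: le_lt_trans bt. Qed.
Lemma vleM x y a b : vle x a -> vle y b -> vle (x * y) (a + b).
Proof.
move=> hx hy t abt; rewrite kmE (@kmulE _ _ _ nil) ?big_nil //; try exact: kser.
move=> c; case: (ltP a c) => [/hx ->|ca]; first by rewrite mul0r eqxx.
by rewrite (hy (t - c)) ?mulr0 ?eqxx //; lra.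
Qed.
Lemma lcM x y a b : vle x a -> vle y b -> (x * y) (a + b) = x a * y b.
Proof.
move=> hx hy; rewrite kmE (@kmulE _ _ _ [:: a]) //; try exact: kser.
  by rewrite big_seq1; congr (_ * y _); ring.
move=> c; rewrite inE; case: (ltgtP a c) => [/hx ->|ca|->] //; first by rewrite mul0r eqxx.
by rewrite (hy (a + b - c)) ?mulr0 ?eqxx //; lra.
Qed.
Lemma vle_mono c l : vle (mono c l) l.
Proof. by move=> t lt_; rewrite monoE gt_eqF. Qed.
Lemma k_sum (I : Type) (s : seq I) (P : pred I) (F : I -> K) t :
  (\sum_(i <- s | P i) F i) t = \sum_(i <- s | P i) F i t.
Proof. by elim/big_ind2: _ => // x ? y ? <- <-. Qed.

Lemma vleX x a n : vle x a -> vle (x ^+ n) (a *+ n).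
Proof. by move=> h; elim: n => [|n IH]; [exact: vle_mono|rewrite exprS mulrS; apply: vleM]. Qed.
Lemma lcX x a n : vle x a -> (x ^+ n) (a *+ n) = x a ^+ n.
Proof.
move=> h; elim: n => [|n IH]; first by rewrite mulr0n !expr0 -mono1 monoE eqxx.
by rewrite exprS mulrS lcM ?IH -?exprS //; apply: vleX.
Qed.
Lemma vle_prod (I : Type) (s : seq I) (F : I -> K) a :
  (forall i, vle (F i) (a i)) -> vle (\prod_(i <- s) F i) (\sum_(i <- s) a i)
   /\ (\prod_(i <- s) F i) (\sum_(i <- s) a i) = \prod_(i <- s) F i (a i).
Proof.
move=> H; elim: s => [|i s [IH1 IH2]].
  by rewrite !big_nil; split; [exact: vle_mono|rewrite -mono1 monoE eqxx].
by rewrite !big_cons; split; [apply: vleM|rewrite lcM ?IH2].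
Qed.

Lemma seq_max (s : seq R) (t : R) : t \in s -> exists l, l \in s /\ forall u, u \in s -> u <= l.
Proof.
elim: s t => // a s IH t _; case: s IH => [|b s] IH.
  by exists a; split=> [|u]; rewrite ?mem_head // inE => /eqP ->.
have [l [ls Hl]] := IH b (mem_head _ _).
exists (Num.max a l); split.
  by case: leP => _; rewrite ?mem_head // in_cons ls orbT.
by move=> u; rewrite in_cons le_max => /orP[/eqP -> |/Hl ->]; rewrite ?lexx ?orbT.
Qed.

Lemma lead (x : K) : x != 0 -> exists l, x l != 0 /\ vle x l.
Proof.
move=> x0; have [t xt] : exists t, x t != 0.
  apply: contrapT => H; case/eqP: x0; apply: K_ext => t; apply: contrapT => /eqP xt.
  by apply: H; exists t.
have [s [us Hs]] := ser_list t (kser x).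
have : t \in [seq u <- s | (t <= u) && (x u != 0)] by rewrite mem_filter lexx xt Hs.
move/seq_max => [l []].
rewrite mem_filter => /andP[/andP[tl xl] _] H; exists l; split=> // u lu.
apply: contrapT => /eqP xu.
have : u <= l by apply: H; rewrite mem_filter xu (ltW (le_lt_trans tl lu)) Hs // (ltW (le_lt_trans tl lu)).
by rewrite leNgt lu.
Qed.

Lemma lead_neq0 (x : K) l : x l != 0 -> x != 0.
Proof. by apply: contraNneq => ->. Qed.


(** * Completeness and fixed points *)

Lemma K_complete (u : nat -> K) :
  (forall M, exists N, forall n t, (N <= n)%N -> M <= t -> u n t = u N t) ->
  exists x : K, forall M, exists N, forall n t, (N <= n)%N -> M <= t -> u n t = x t.
Proof.
(* The limit takes at [t] the value from a stage where the coefficients above [t] have settled.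
   Above any [M] it coincides with a single term of the sequence, so it is again a series. *)
move=> H; pose f (t : R) := u (sval (cid (H t))) t.
have fE M : exists N, forall n t, (N <= n)%N -> M <= t -> u n t = f t.
  have [N HN] := H M; exists N => n t Nn Mt; rewrite /f; case: (cid _) => m /= Hm.
  by rewrite HN // -(HN (maxn N m)) ?leq_maxl // Hm ?leq_maxr.
have sf : ser f.
  move=> M; have [N HN] := fE M; have [s Hs] := kser (u N) M; exists s => x Mx.
  by rewrite -(HN N) //; apply: Hs.
by exists (mkK sf).
Qed.

(** Banach's fixed point theorem for the ultrametric of the valuation. The gain [e] is the same at
    every step, so the error bound [r - e n] tends to minus infinity. Families indexed by [I] cover
    one unknown (inverses) and a sequence of coefficients (Hensel's lemma). *)
Lemma contraction (I : Type) (Phi : (I -> K) -> I -> K) (e r : R) : 0 < e ->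
  (forall d, (forall i, vle (d i) r) -> forall i, vle (Phi d i) r) ->
  (forall d d', (forall i, vle (d i) r) -> (forall i, vle (d' i) r) ->
     forall b, (forall i, vle (d i - d' i) b) -> forall i, vle (Phi d i - Phi d' i) (b - e)) ->
  exists d, (forall i, vle (d i) r) /\ forall i, Phi d i = d i.
Proof.
move=> e0 Hr Hc; pose u n := iter n Phi (fun _ => 0).
have ur n i : vle (u n i) r by elim: n i => [|n IH] i //; apply: Hr.
have ud n i : vle (u n.+1 i - u n i) (r - e *+ n).
  elim: n i => [|n IH] i; first by rewrite (_ : r - _ = r) ?mulr0n ?subr0 //; apply: vleB; apply: ur.
  rewrite mulrSr opprD addrA; apply: (Hc (u n.+1) (u n)); [exact: ur|exact: ur|exact: IH].
have udd n m i : (n <= m)%N -> vle (u m i - u n i) (r - e *+ n).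
  elim: m => [|m IH]; first by rewrite leqn0 => /eqP ->; rewrite subrr; apply: vle0.
  rewrite leq_eqVlt => /orP[/eqP->|]; first by rewrite subrr; apply: vle0.
  rewrite ltnS => nm; rewrite -(subrKA (u m i)); apply: vleD; last exact: IH.
  by apply: vle_le (ud m i); rewrite lerD2l lerN2 ler_wpMn2l // ltW.
have arch M : exists n, r - e *+ n < M.
  have [rM|rM] := ltP r M; first by exists 0%N; rewrite mulr0n subr0.
  have q0 : 0 <= (r - M) / e by rewrite divr_ge0 ?subr_ge0 // ltW.
  exists (Num.bound ((r - M) / e)); have := archi_boundP q0.
  by rewrite ltr_pdivrMr // mulr_natl; lra.
have lim i : exists x : K, forall M, exists N, forall n t, (N <= n)%N -> M <= t -> u n i t = x t.
  apply: K_complete => M; have [N HN] := arch M; exists N => n t Nn Mt.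
  by have := udd N n i Nn t (lt_le_trans HN Mt); rewrite kB => /eqP; rewrite subr_eq0 => /eqP.
have {lim} /choice[d Hd] := lim.
have du n i : vle (d i - u n i) (r - e *+ n).
  move=> t lt_t; rewrite kB; have [N HN] := Hd i t.
  rewrite -(HN (maxn N n) t) ?leq_maxl // -kB; exact: udd (leq_maxr _ _) _ lt_t.
have dr i : vle (d i) r.
  by have := du 0%N i; rewrite mulr0n !subr0 /=.
exists d; split=> // i; apply: K_ext => t; apply/eqP; rewrite -subr_eq0 -kB; apply/eqP.
have [n Hn] := arch t.
(* [Phi d] and [d] both agree with the iterate of rank [n + 1] at the exponent [t]. *)
rewrite -(subrKA (u n.+1 i)) kD.
rewrite (Hc d (u n) dr (ur n) (r - e *+ n) (du n) i); last by lra.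
rewrite add0r -opprB kN (du n.+1 i) ?oppr0 // mulrSr; lra.
Qed.

(** Turns a negative valuation into a definite gap [e], which serves as the rate in
    [contraction]. *)
Lemma vlt0 (x : K) : vle x 0 -> x 0 = 0 -> exists e, 0 < e /\ vle x (- e).
Proof.
move=> h0 x00; case: (eqVneq x 0) => [->|/lead[l [xl hl]]]; first by exists 1.
exists (- l); rewrite opprK; split=> //; rewrite oppr_gt0 lt_neqAle.
apply/andP; split; first by apply: contra_neq xl => ->.
by rewrite leNgt; apply: contra_neqN xl => /h0.
Qed.

Lemma K_inv (x : K) : x != 0 -> exists y, y * x = 1.
Proof.
move=> /lead[l [xl hl]].
pose m := mono (x l)^-1 (- l).
have h0 : vle (m * x) 0 by rewrite -(addNr l); apply: vleM => //; apply: vle_mono.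
have h1 : (m * x) 0 = 1 by rewrite mono_mul opprK add0r mulVf.
pose z := 1 - m * x.
have [e [e0 he]] : exists e, 0 < e /\ vle z (- e).
  apply: vlt0; first by apply: vleB => //; rewrite -mono1; apply: vle_mono.
  by rewrite kB h1 -mono1 monoE eqxx subrr.
(* The fixed point of [w = 1 + z w] is the geometric series of [z], that is, the inverse of the
   normalised series [m x = 1 - z]. *)
have [|d d' _ _ b hb i|w [_ hw]] := @contraction unit (fun w i => 1 + z * w i) e 0 e0.
- move=> d hd i; apply: vleD; first by rewrite -mono1; apply: vle_mono.
  by apply: (@vle_le _ (- e + 0)); [rewrite addr0 oppr_le0; exact: ltW|exact: vleM].
- by rewrite opprD addrACA subrr add0r -mulrBr (addrC b); exact: vleM.
exists (w tt * m); have := hw tt; rewrite /z mulrBl mul1r => /eqP.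
by rewrite addrCA -[X in _ == X]addr0 (inj_eq (addrI _)) subr_eq0 -mulrA mulrC => /eqP <-.
Qed.

Definition Kinv (x : K) : K := if pselect (x != 0) is left H then sval (cid (K_inv H)) else 0.
Fact KmulVf (x : K) : x != 0 -> Kinv x * x = 1.
Proof. by rewrite /Kinv; case: pselect => // H _; case: cid. Qed.
Fact Kinv0 : Kinv 0 = 0.
Proof. by rewrite /Kinv; case: pselect => // H; exfalso; move: (H); rewrite eqxx. Qed.
HB.instance Definition _ := GRing.ComNzRing_isField.Build K KmulVf Kinv0.

(** * The order on series *)

Definition kge0 (x : K) : bool := `[< knonneg x >].
Definition kler (x y : K) : bool := kge0 (y - x).

Lemma kposP (x : K) : kpos x <-> exists l, 0 < x l /\ vle x l.
Proof.
by split=> -[l [/RltP xl H]]; exists l; split=> // mu /RltP; apply: H.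
Qed.
Lemma kiszeroP (x : K) : kiszero x <-> x = 0.
Proof. by split=> [H|->] //; apply: K_ext. Qed.
Lemma kge0P (x : K) : reflect (x = 0 \/ exists l, 0 < x l /\ vle x l) (kge0 x).
Proof.
apply: (iffP (asboolP _)) => -[].
- by move/kiszeroP; left.
- by move/kposP; right.
- by move/kiszeroP; left.
- by move/kposP; right.
Qed.

Lemma kge0D x y : kge0 x -> kge0 y -> kge0 (x + y).
Proof.
move=> /kge0P[->|[l [xl hx]]]; first by rewrite add0r.
move=> /kge0P[->|[m [ym hy]]]; first by rewrite addr0; apply/kge0P; right; exists l.
apply/kge0P; right; case: (ltgtP l m) => [lm|ml|E].
- exists m; rewrite kD (hx m lm) add0r; split=> //; apply: vleD => //; apply: vle_le hx; exact: ltW.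
- exists l; rewrite kD (hy l ml) addr0; split=> //; apply: vleD => //; apply: vle_le hy; exact: ltW.
- by subst m; exists l; rewrite kD addr_gt0 //; split=> //; apply: vleD.
Qed.
Lemma kge0M x y : kge0 x -> kge0 y -> kge0 (x * y).
Proof.
move=> /kge0P[->|[l [xl hx]]]; first by rewrite mul0r => _; apply/kge0P; left.
move=> /kge0P[->|[m [ym hy]]]; first by rewrite mulr0; apply/kge0P; left.
by apply/kge0P; right; exists (l + m); rewrite lcM // mulr_gt0 //; split=> //; apply: vleM.
Qed.
Lemma kge0_total x : kge0 x || kge0 (- x).
Proof.
case: (eqVneq x 0) => [->|/lead[l [xl hl]]]; first by apply/orP; left; apply/kge0P; left.
case: (ltgtP (x l) 0) xl => // xl _; apply/orP; [right|left]; apply/kge0P; right; exists l.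
  by rewrite kN oppr_gt0; split=> //; apply: vleN.
by [].
Qed.
Lemma kge0_anti x : kge0 x -> kge0 (- x) -> x = 0.
Proof.
move=> /kge0P[//|[l [xl hx]]] /kge0P[/eqP|[m [ym hy]]]; first by rewrite oppr_eq0 => /eqP.
case: (ltgtP l m) => [lm|ml|E].
- by move: ym; rewrite kN (hx m lm) oppr0 ltxx.
- by move: (hy l ml); rewrite kN => /eqP; rewrite oppr_eq0 => /eqP E; rewrite E ltxx in xl.
- by subst m; move: ym; rewrite kN oppr_gt0 ltNge (ltW xl).
Qed.

Definition klt (x y : K) := (y != x) && kler x y.
Definition knorm (x : K) := if kge0 x then x else - x.
Fact K_le0_add x y : kler 0 x -> kler 0 y -> kler 0 (x + y).
Proof. by rewrite /kler !subr0; apply: kge0D. Qed.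
Fact K_le0_mul x y : kler 0 x -> kler 0 y -> kler 0 (x * y).
Proof. by rewrite /kler !subr0; apply: kge0M. Qed.
Fact K_le0_anti x : kler 0 x -> kler x 0 -> x = 0.
Proof. by rewrite /kler !subr0 sub0r; apply: kge0_anti. Qed.
Fact K_sub_ge0 x y : kler 0 (y - x) = kler x y.
Proof. by rewrite /kler !subr0. Qed.
Fact K_le0_total x : kler 0 x || kler x 0.
Proof. by rewrite /kler !subr0 sub0r; apply: kge0_total. Qed.
Fact K_normN x : knorm (- x) = knorm x.
Proof.
rewrite /knorm; case: (boolP (kge0 (- x))) => h; case: (boolP (kge0 x)) => h'; rewrite ?opprK //.
  by rewrite (kge0_anti h' h) oppr0.
by have := kge0_total x; rewrite (negPf h) (negPf h').
Qed.
Fact K_ge0_norm x : kler 0 x -> knorm x = x.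
Proof. by rewrite /kler subr0 /knorm => ->. Qed.
Fact K_lt_def x y : klt x y = (y != x) && kler x y. Proof. by []. Qed.
HB.instance Definition _ := Num.IntegralDomain_isLeReal.Build K
  K_le0_add K_le0_mul K_le0_anti K_sub_ge0 K_le0_total K_normN K_ge0_norm K_lt_def.

Lemma kgt0P (x : K) : reflect (exists l, 0 < x l /\ vle x l) (0 < x).
Proof.
rewrite lt_def; change (0 <= x) with (kge0 (x - 0)); rewrite subr0.
apply: (iffP andP) => [[x0 /kge0P[x0'|//]]|[l [xl hl]]]; first by rewrite x0' eqxx in x0.
split; first by apply: (@lead_neq0 _ l); rewrite gt_eqF.
by apply/kge0P; right; exists l.
Qed.

Lemma kgt0_lc (x : K) l : vle x l -> x l != 0 -> (0 < x) = (0 < x l).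
Proof.
move=> hx xl; apply/kgt0P/idP => [[m [xm hm]]|x0]; last by exists l.
case: (ltgtP l m) => [lm|ml|->//]; first by rewrite (hx _ lm) ltxx in xm.
by rewrite (hm _ ml) eqxx in xl.
Qed.
Lemma klt0_lc (x : K) l : vle x l -> x l != 0 -> (x < 0) = (x l < 0).
Proof.
move=> hx xl; rewrite -oppr_gt0 (@kgt0_lc _ l) ?kN ?oppr_eq0 ?oppr_gt0 //; exact: vleN.
Qed.

Lemma knonnegP (x : K) : knonneg x <-> 0 <= x.
Proof.
change (0 <= x) with (kge0 (x - 0)); rewrite subr0 /kge0.
by split=> [?|/asboolP//]; apply/asboolP.
Qed.
Lemma kpos_gt0 (x : K) : kpos x <-> 0 < x.
Proof. by rewrite kposP; split=> /kgt0P. Qed.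

(** * Hensel's lemma *)

Definition emb (c : R) : K := mono c 0.
Fact emb_additive : zmod_morphism emb.
Proof. by move=> x y; apply: K_ext => t; rewrite kB !monoE; case: eqP; rewrite ?subrr. Qed.
Fact emb_monoid : monoid_morphism emb.
Proof. by split=> // x y; rewrite /emb monoM addr0. Qed.
HB.instance Definition _ := GRing.isZmodMorphism.Build R K emb emb_additive.
HB.instance Definition _ := GRing.isMonoidMorphism.Build R K emb emb_monoid.

Lemma vle_emb c : vle (emb c) 0. Proof. exact: vle_mono. Qed.
Lemma emb0 c : emb c 0 = c. Proof. by rewrite monoE eqxx. Qed.

Definition pvle (p : {poly K}) (b : R) := forall i, vle p`_i b.
Lemma pvleD p q b : pvle p b -> pvle q b -> pvle (p + q) b.
Proof. by move=> hp hq i; rewrite coefD; apply: vleD. Qed.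
Lemma pvleB p q b : pvle p b -> pvle q b -> pvle (p - q) b.
Proof. by move=> hp hq i; rewrite coefB; apply: vleB. Qed.
Lemma pvleM p q a b : pvle p a -> pvle q b -> pvle (p * q) (a + b).
Proof. by move=> hp hq i; rewrite coefM; apply: vle_sum => j _; apply: vleM. Qed.
Lemma pvle_emb (p : {poly R}) : pvle (map_poly emb p) 0.
Proof. by move=> i; rewrite coef_map; apply: vle_emb. Qed.
Lemma pvle_le p a b : a <= b -> pvle p a -> pvle p b.
Proof. by move=> ab hp i; apply: vle_le (hp i). Qed.

Definition lincomb (A : nat -> {poly R}) d (E : nat -> K) : {poly K} :=
  \sum_(i < d) E i *: map_poly emb (A i).
Lemma pvle_lincomb A d E b : (forall i, vle (E i) b) -> pvle (lincomb A d E) b.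
Proof.
move=> hE j; rewrite coef_sum; apply: vle_sum => i _; rewrite coefZ -[b]addr0.
by apply: vleM => //; apply: pvle_emb.
Qed.
Lemma lincombB A d E E' : lincomb A d E - lincomb A d E' = lincomb A d (fun i => E i - E' i).
Proof. by rewrite -sumrB; apply: eq_bigr => i _; rewrite scalerBl. Qed.
Lemma size_lincomb (A : nat -> {poly R}) d E n : (forall i, (i < d)%N -> (size (A i) <= n)%N) -> (size (lincomb A d E) <= n)%N.
Proof.
move=> H; apply: leq_trans (size_sum _ _ _) _; apply/bigmax_leqP => i _.
by apply: leq_trans (size_scale_leq _ _) _; rewrite size_map_poly; apply: H.
Qed.

(** The residue map, meaningful where [vle x 0]. It is a bare function because it is multiplicative
    only on the valuation ring. *)
Definition res (x : K) : R := x 0.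
Lemma coef_res (p : {poly K}) i : (map_poly res p)`_i = p`_i 0.
Proof. by rewrite coef_map_id0. Qed.

Lemma vle_lower (s : seq K) : (forall x, x \in s -> vle x 0 /\ x 0 = 0) ->
  exists e, 0 < e /\ forall x, x \in s -> vle x (- e).
Proof.
elim: s => [|x s IH] H; first by exists 1.
have [|e [e0 he]] := IH; first by move=> y ys; apply: H; rewrite in_cons ys orbT.
have [h1 h2] := H x (mem_head _ _); have [e' [e'0 he']] := vlt0 h1 h2.
exists (Num.min e e'); split; first by rewrite lt_min e0.
move=> y; rewrite in_cons => /orP[/eqP->|/he hy].
  by apply: vle_le he'; rewrite lerN2 ge_min lexx orbT.
by apply: vle_le hy; rewrite lerN2 ge_min lexx.
Qed.

(** With [g' = g + A] and [h' = h + B], the equation [g' h' = p] reads [g B + h A = (p - g h) - A B].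
    By Bezout, [A] and [B] are linear functions of the polynomial [E] on the right-hand side, so this
    is a fixed point problem for [E], whose right-hand side is a contraction. *)
Lemma hensel (p : {poly K}) (g h : {poly R}) : p \is monic -> pvle p 0 ->
  g \is monic -> h \is monic -> coprimep g h -> map_poly res p = g * h ->
  exists G H, [/\ p = G * H, G \is monic, H \is monic, size G = size g & size H = size h].
Proof.
move=> pm pv gm hm cop rp.
have [[u v] /= uv] := Bezout_eq1_coprimepP _ _ cop.
have g0 := monic_neq0 gm; have h0 := monic_neq0 hm.
have gE : map_poly emb g \is monic by rewrite map_monic.
have hE : map_poly emb h \is monic by rewrite map_monic.
set ge := map_poly emb g in gE *; set he := map_poly emb h in hE *.
have sge : size ge = size g by rewrite size_map_poly.
have she : size he = size h by rewrite size_map_poly.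
have sr : size (map_poly res p) = size p.
  by rewrite size_map_poly_id0 // (monicP pm) /res -mono1 monoE eqxx oner_eq0.
have [m sgE] : exists m, size g = m.+1 by exists (size g).-1; rewrite prednK // size_poly_gt0.
have [k shE] : exists k, size h = k.+1 by exists (size h).-1; rewrite prednK // size_poly_gt0.
pose d := (m + k)%N.
have spd : size p = d.+1 by rewrite -sr rp size_mul // sgE shE addSn addnS.
pose E0 := p - ge * he.
have sE0 : (size E0 <= d)%N.
  have sgh : size (ge * he) = d.+1 by rewrite size_monicM ?monic_neq0 // sge she sgE shE addSn addnS.
  apply/leq_sizeP => j; rewrite leq_eqVlt coefB => /orP[/eqP<-|dj].
    have := monicP pm; rewrite lead_coefE spd /= => ->.
    have /monicP : ge * he \is monic by rewrite monicMl.
    rewrite lead_coefE sgh /= => ->.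
    by rewrite subrr.
  by rewrite !nth_default ?subrr // ?spd ?sgh.
(* Since [p] has residue [g h], every coefficient of [E0] has negative valuation. The common bound
   [- e] is the radius of the ball, and [e] is also the contraction rate. *)
have [e [e0 hE0]] : exists e, 0 < e /\ forall i, vle E0`_i (- e).
  have [|e [e0 He]] := @vle_lower E0.
    move=> x /(nthP 0)[i iE <-]; rewrite coefB; split.
      apply: vleB => //; rewrite -rmorphM /=; apply: pvle_emb.
    by rewrite kB -coef_res rp -rmorphM coef_map emb0 subrr.
  exists e; split=> // i; have [iE|iE] := ltnP i (size E0); first by apply: He; apply: mem_nth.
  by rewrite nth_default.
(* Bezout gives the multiplier [v X^i] of [h]. Its remainder modulo [g] keeps [A i] below the degree
   of [g], and the quotient is moved into [B i]. *)
pose A i := (v * 'X^i) %% g.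
pose B i := u * 'X^i + h * ((v * 'X^i) %/ g).
have AB i : g * B i + h * A i = 'X^i.
  have D : v * 'X^i = (v * 'X^i) %/ g * g + (v * 'X^i) %% g.
    exact: divp_eq.
  rewrite /A /B -[RHS]mul1r -uv; move: D; set q := _ %/ g; set r := _ %% g => D.
  rewrite mulrDl [v * h * _]mulrAC D; ring.
have sA i : (size (A i) <= m)%N by rewrite -ltnS -sgE ltn_modp.
have sB i : (i < d)%N -> (size (B i) <= k)%N.
  (* The degree of [B i] is not visible in its definition; it is read off from [g B = X^i - h A]. *)
  move=> id; case: (eqVneq (B i) 0) => [->|B0]; first by rewrite size_poly0.
  have : (size (g * B i)%R <= d)%N.
    have -> : g * B i = 'X^i - h * A i by rewrite -(AB i) addrK.
    apply: leq_trans (size_polyD _ _) _; rewrite geq_max size_polyXn id size_polyN /=.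
    apply: leq_trans (size_polyMleq _ _) _; rewrite shE addSn addnC /d leq_add2r; exact: sA.
  by rewrite size_mul // sgE addSn /d leq_add2l.
pose LG E := lincomb A d E; pose LH E := lincomb B d E.
have sLG E : (size (LG E) <= m)%N by apply: size_lincomb => i _.
have sLH E : (size (LH E) <= k)%N by apply: size_lincomb.
pose Phi (E : nat -> K) i := (E0 - LG E * LH E)`_i.
have [||E [vE hEq]] := @contraction nat Phi e (- e) e0.
- move=> E hEe; apply: pvleB => //; apply: (@pvle_le _ (- e + - e)); first by lra.
  by apply: pvleM; apply: pvle_lincomb.
- move=> E E' hEe hEe' b hb i; rewrite /Phi -coefB.
  have -> : E0 - LG E * LH E - (E0 - LG E' * LH E') =
     - (LG (fun i => E i - E' i) * LH E + LG E' * LH (fun i => E i - E' i)).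
    by rewrite /LG /LH -!lincombB; ring.
  rewrite coefN; apply: vleN; apply: pvleD; first by apply: pvleM; apply: pvle_lincomb.
  by rewrite addrC; apply: pvleM; apply: pvle_lincomb.
have Esum : ge * LH E + he * LG E = E0 - LG E * LH E.
  transitivity (\sum_(i < d) E i *: 'X^i : {poly K}).
    rewrite /LG /LH /lincomb !mulr_sumr -big_split /=.
    apply: eq_bigr => i _; rewrite -!scalerAr -scalerDr -!rmorphM -rmorphD /= AB.
    by rewrite map_polyXn.
  apply/polyP => i; rewrite -[RHS]/(Phi E i) hEq coef_sum.
  under eq_bigr do rewrite coefZ coefXn.
  have [id|di] := ltnP i d.
    rewrite (bigD1 (Ordinal id)) //= eqxx mulr1 big1 ?addr0 // => j /eqP ji.
    by case: eqP => [ij|]; rewrite ?mulr0 //; case: ji; apply: val_inj.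
  rewrite big1 => [|j _]; last by rewrite gtn_eqF ?mulr0 // (leq_trans _ di).
  rewrite -hEq /Phi nth_default //; apply: leq_trans (size_polyD _ _) _.
  rewrite geq_max size_polyN; apply/andP; split; first exact: leq_trans di.
  apply: leq_trans (size_polyMleq _ _) _; apply: leq_trans (leq_pred _) _.
  exact: leq_trans (leq_add (sLG E) (sLH E)) di.
exists (ge + LG E), (he + LH E).
have slt1 : (size (LG E) < size ge)%N by rewrite sge sgE ltnS.
have slt2 : (size (LH E) < size he)%N by rewrite she shE ltnS.
split.
- have -> : (ge + LG E) * (he + LH E) = ge * he + (ge * LH E + he * LG E) + LG E * LH E by ring.
  by rewrite Esum /E0; ring.
- by rewrite monicE lead_coefDl // (monicP gE).
- by rewrite monicE lead_coefDl // (monicP hE).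
- by rewrite size_polyDl.
- by rewrite size_polyDl.
Qed.

(** * The field of series is real closed *)

(** By the intermediate value theorem the sign at plus infinity persists everywhere, and an odd
    degree would give a negative value far to the left. *)
Lemma rootless_monic (R : rcfType) (r : {poly R}) : r \is monic -> (forall x, ~~ root r x) ->
  (forall x, 0 < r.[x]) /\ ~~ odd (size r).-1.
Proof.
move=> rm nr.
have pos x : 0 < r.[x].
  have [|n Hn] := @poly_pinfty_gt_lc _ r; first by rewrite (monicP rm).
  rewrite ltNge; apply/negP => rx.
  have [||y _] := @poly_ivt _ r x (Num.max n x); first by rewrite le_max lexx orbT.
    by rewrite rx (le_trans _ (Hn _ _)) ?le_max ?lexx // (monicP rm).
  by rewrite (negPf (nr y)).
split=> //; apply/negP => od.
have [|n Hn] := @poly_pinfty_gt_lc _ (- (r \Po (- 'X))).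
  rewrite lead_coefN lead_coef_comp ?size_polyN ?size_polyX // (monicP rm) mul1r.
  by rewrite lead_coefN lead_coefX -signr_odd od expr1 opprK.
have := Hn n (lexx _); rewrite lead_coefN lead_coef_comp ?size_polyN ?size_polyX // (monicP rm) mul1r.
rewrite lead_coefN lead_coefX -signr_odd od expr1 opprK hornerN horner_comp => H.
by have := pos (- 'X).[n]; rewrite ltNge -oppr_ge0 (le_trans ler01 H).
Qed.

Lemma horner_res (p : {poly K}) (x : K) : pvle p 0 -> vle x 0 ->
  vle p.[x] 0 /\ p.[x] 0 = (map_poly res p).[x 0].
Proof.
move=> hp hx; rewrite horner_coef (@horner_coef_wide _ (size p)) ?size_poly // k_sum.
have hX i : vle (x ^+ i) 0 by rewrite -(mul0rn _ i); apply: vleX.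
split.
  by apply: vle_sum => i _; apply: (@vle_le _ (0 + 0)); [rewrite addr0|apply: vleM].
apply: eq_bigr => i _; rewrite coef_res.
transitivity ((p`_i * x ^+ i) (0 + 0)); first by rewrite addr0.
by rewrite lcM //; congr (_ * _); have := lcX i hx; rewrite mul0rn.
Qed.

(** Meant for the degenerate case [p = (X - c)^d], where the sign condition puts [c] between the
    endpoints. *)
Lemma exp_sign_between (R : realDomainType) (a b : R) n : (0 < n)%N -> a <= b -> a ^+ n * b ^+ n <= 0 -> a <= 0 <= b.
Proof.
move=> n0 ab; rewrite -exprMn => H.
have : a * b <= 0 by rewrite leNgt; apply: contraL H => H; rewrite -ltNge exprn_gt0.
move=> ab0; apply/andP; split; rewrite leNgt; apply/negP => h; have : 0 < a * b.
- by rewrite mulr_gt0 // (lt_le_trans h).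
- by lra.
- by rewrite nmulr_lgt0 // (le_lt_trans ab).
- by lra.
Qed.

(** [p(c + t^mu y)], normalised to be monic in [y]; [m] stands for [t^mu]. *)
Definition rescale (p : {poly K}) (c m : K) : {poly K} :=
  \poly_(i < size p) (p^`N(i).[c] * m ^+ i / m ^+ (size p).-1).

Lemma horner_rescale p c m y : m != 0 -> (rescale p c m).[y] = p.[c + m * y] / m ^+ (size p).-1.
Proof.
move=> m0; rewrite horner_poly nderiv_taylor; last exact: mulrC.
rewrite mulr_suml; apply: eq_bigr => i _; rewrite exprMn; ring.
Qed.

Lemma coef_rescale_top p c m : m != 0 -> p \is monic -> (rescale p c m)`_(size p).-1 = 1.
Proof.
move=> m0 pm; have sp : (0 < size p)%N by rewrite size_poly_gt0 monic_neq0.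
rewrite coef_poly ltn_predL sp; have -> : p^`N((size p).-1).[c] = 1.
  have -> : p^`N((size p).-1) = 1.
    apply/polyP => i; rewrite coef_nderivn coef1; case: i => [|i].
      by rewrite addn0 binn mulr1n -lead_coefE (monicP pm).
    by rewrite nth_default ?mul0rn // addnS -addSn prednK // leq_addr.
  by rewrite hornerC.
by rewrite mul1r divff // expf_neq0.
Qed.

Lemma rescale_monic p c m : m != 0 -> p \is monic -> rescale p c m \is monic /\ size (rescale p c m) = size p.
Proof.
move=> m0 pm; have sp : (0 < size p)%N by rewrite size_poly_gt0 monic_neq0.
have E := coef_rescale_top c m0 pm.
have S : size (rescale p c m) = size p.
  apply/eqP; rewrite eqn_leq size_poly /= -(prednK sp) ltnNge; apply/negP => H.
  by move: E; rewrite nth_default // => /esym/eqP; rewrite oner_eq0.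
by split=> //; rewrite monicE lead_coefE S E.
Qed.

(** The shift by [c] kills the coefficient of degree [d - 1], and the scaling by [t^mu] makes all
    coefficients integral and one of the lower ones a unit. Hence the residue polynomial is not a
    [d]-th power of a linear factor: if it has a root, it splits into coprime factors of smaller
    degree that lift by Hensel's lemma, and if it has none, then [p] is positive everywhere. *)
Lemma ivt_monic n (p : {poly K}) (a b : K) : (size p <= n)%N -> p \is monic -> a <= b ->
  p.[a] * p.[b] <= 0 -> exists2 x, a <= x <= b & root p x.
Proof.
elim: n p a b => [|n IH] p a b.
  by rewrite leqn0 size_poly_eq0 => /eqP -> /monic_neq0; rewrite eqxx.
move=> spn pm ab pab.
have sp0 : (0 < size p)%N by rewrite size_poly_gt0 monic_neq0.
case: (posnP (size p).-1) => [d0|d0].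
  have p1 : p = 1.
    apply/polyP => i; rewrite coef1; case: i => [|i].
      by rewrite -(monicP pm) lead_coefE d0.
    by rewrite nth_default // -(prednK sp0) d0.
  by move: pab; rewrite p1 !hornerC mul1r ler10.
set d := (size p).-1 in d0.
have spd : size p = d.+1 by rewrite prednK.
pose c := - p`_d.-1 / d%:R.
have dn0 : d%:R != 0 :> K by rewrite pnatr_eq0 -lt0n.
pose a_ i := p^`N(i).[c].
have a_d1 : a_ d.-1 = 0.
  have E : p^`N(d.-1) = (p`_d.-1)%:P + d%:R *: 'X.
    apply/polyP => i; rewrite coef_nderivn coefD coefC coefZ coefX.
    case: i => [|[|i]].
    - by rewrite addn0 binn mulr1n mulr0 addr0.
    - rewrite addn1 add0r mulr1 binSn prednK //.
      by have := monicP pm; rewrite lead_coefE spd /= => ->.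
    - by rewrite nth_default ?mul0rn ?add0r ?mulr0 // spd addnS -addSn prednK // addnS ltnS leq_addr.
  by rewrite /a_ E hornerD hornerC hornerZ hornerX /c mulrCA divff // mulr1 addrN.
have Hresc m : m != 0 -> forall y, root (rescale p c m) y -> root p (c + m * y).
  by move=> m0 y; rewrite !rootE horner_rescale // mulf_eq0 invr_eq0 expf_eq0 (negPf m0) andbF orbF.
have Hsign m : 0 < m -> (rescale p c m).[(a - c) / m] * (rescale p c m).[(b - c) / m] <= 0.
  move=> m0; have m1 : m != 0 by rewrite gt_eqF.
  rewrite !horner_rescale // ![m * (_ / m)]mulrC !divfK // ![c + _]addrC !subrK.
  by rewrite mulrACA pmulr_lle0 // mulr_gt0 // invr_gt0 exprn_gt0.
have [all0|[i0 [i0d ai0]]] : (forall i, (i < d)%N -> a_ i = 0) \/ exists i, (i < d)%N /\ a_ i != 0.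
  case: (pselect (exists i, (i < d)%N /\ a_ i != 0)) => H; [by right|left=> i id].
  by apply: contrapT => /eqP ai; apply: H; exists i.
  have ptop : a_ d = 1.
    have := coef_rescale_top c (oner_neq0 _) pm.
    by rewrite coef_poly ltn_predL sp0 !expr1n mulr1 divr1.
  have pE y : p.[y] = (y - c) ^+ d.
    rewrite -{1}(subrKC c y) nderiv_taylor; last exact: mulrC.
    rewrite spd big_ord_recr /= big1 ?add0r; last by move=> i _; rewrite -/(a_ i) all0 ?mul0r.
    by rewrite -/(a_ d) ptop mul1r.
  exists c; last by rewrite rootE pE subrr expr0n gtn_eqF.
  rewrite -(subr_le0 c a) -(subr_ge0 c b); apply: (@exp_sign_between _ _ _ d) => //.
    by rewrite lerD2r.
  by rewrite -!pE.
have /choice[L HL] : forall i, exists l, a_ i != 0 -> (a_ i) l != 0 /\ vle (a_ i) l.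
  by move=> i; case: (eqVneq (a_ i) 0) => [->|/lead[l H]]; [exists 0|exists l].
(* The extremal slope of the Newton polygon: the rescaled coefficient of index [i] has valuation
   [L i - mu (d - i)], and the maximum is the least [mu] that makes all of these at most [0]; one of
   them is then [0]. *)
pose s := [seq L i / (d - i)%:R | i <- iota 0 d & a_ i != 0].
have /seq_max[mu [mus Hmu]] : L i0 / (d - i0)%:R \in s.
  by apply/mapP; exists i0 => //; rewrite mem_filter ai0 mem_iota.
have dgt i : (i < d)%N -> 0 < (d - i)%:R :> R by move=> id; rewrite ltr0n subn_gt0.
have vlea i : (i < d)%N -> vle (a_ i) (mu * (d - i)%:R).
  move=> id; case: (eqVneq (a_ i) 0) => [->|ai]; first exact: vle0.
  apply: (vle_le _ (HL i ai).2); rewrite -ler_pdivrMr ?dgt //; apply: Hmu.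
  by apply/mapP; exists i => //; rewrite mem_filter ai mem_iota.
have [i1 [i1d ai1]] : exists i, (i < d)%N /\ (a_ i) (mu * (d - i)%:R) != 0.
  move: mus => /mapP[i]; rewrite mem_filter mem_iota add0n => /andP[ai /= id] E; exists i; split=> //.
  by rewrite E divfK ?(HL i ai).1 // gt_eqF // dgt.
pose m := mono 1 mu.
have mV : m ^+ d * mono 1 (- (mu *+ d)) = 1 by rewrite monoX monoM expr1n mulr1 addrN.
have mgt0 : 0 < m by apply/kgt0P; exists mu; rewrite monoE eqxx ltr01; split=> //; apply: vle_mono.
have m0 : m != 0 by rewrite gt_eqF.
have mVE : (m ^+ d)^-1 = mono 1 (- (mu *+ d)) by rewrite -[RHS]mul1r -(mulVf (expf_neq0 d m0)) -mulrA mV mulr1.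
set q := rescale p c m in Hresc Hsign *.
have [qm sq] := rescale_monic c m0 pm.
have qtop : q`_d = 1 by apply: coef_rescale_top.
have qE i : (i <= d)%N -> q`_i = mono 1 (- (mu * (d - i)%:R)) * a_ i.
  move=> id; rewrite coef_poly spd ltnS id -/d mVE monoX expr1n -/(a_ i) -mulrA monoM mulr1 mulrC.
  by congr (mono _ _ * _); rewrite natrB // mulrBr !mulr_natr opprB.
have vq : pvle q 0.
  move=> i; have [id|] := ltnP i d.
    rewrite qE; last exact: ltnW.
    by rewrite -(addNr (mu * (d - i)%:R)); apply: vleM; [apply: vle_mono|apply: vlea].
  rewrite leq_eqVlt => /orP[/eqP<-|di].
    by rewrite qtop -mono1; apply: vle_mono.
  by rewrite nth_default ?sq ?spd //; apply: vle0.
set r := map_poly res q.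
have rE i : (i < d)%N -> r`_i = (a_ i) (mu * (d - i)%:R).
  by move=> id; rewrite coef_res qE 1?ltnW // mono_mul mul1r opprK add0r.
have rtop : r`_d = 1 by rewrite coef_res qtop -mono1 monoE eqxx.
have sr : size r = d.+1.
  by rewrite size_map_poly_id0 ?sq ?spd // (monicP qm) /res -mono1 monoE eqxx oner_eq0.
have rm : r \is monic by rewrite monicE lead_coefE sr rtop.
pose a' := (a - c) / m; pose b' := (b - c) / m.
have ab' : a' <= b' by rewrite ler_pM2r ?invr_gt0 // lerD2r.
have fin x : a' <= x <= b' -> root q x -> exists2 x, a <= x <= b & root p x.
  move=> /andP[ax xb] qx; exists (c + m * x); last exact: Hresc.
  move: ax xb; rewrite /a' /b' ler_pdivrMr // ler_pdivlMr // => ax xb.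
  by apply/andP; split; move: ax xb; rewrite [x * m]mulrC; lra.
have [[y ry]|nr] := pselect (exists y, root r y); last first.
  have [rpos rev] : (forall x, 0 < r.[x]) /\ ~~ odd (size r).-1.
    by apply: rootless_monic => // x; apply/negP => rx; apply: nr; exists x.
  rewrite sr /= in rev.
  (* If [y] has valuation at most [0], the sign is that of the residue value. Otherwise the top term
     [y^d] dominates the other terms, whose coefficients are integral, and [d] is even. *)
  have qpos y : 0 < q.[y].
    have low : vle y 0 -> 0 < q.[y].
      by move=> vy; have [v1 v2] := horner_res vq vy; apply/kgt0P; exists 0; rewrite v2.
    case: (eqVneq y 0) => [E|/lead[l [yl vl]]]; first by apply: low; rewrite E; apply: vle0.
    case: (leP l 0) => l0; first by apply: low; apply: vle_le vl.
    have vt (i : nat) : vle (q`_i * y ^+ i) (l *+ i).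
      by rewrite -[l *+ i]add0r; apply: vleM => //; apply: vleX.
    apply/kgt0P; exists (l *+ d); rewrite horner_coef sq spd; split; last first.
      apply: vle_sum => i _; apply: vle_le (vt i); apply: ler_wpMn2l; first exact: ltW.
      by rewrite -ltnS.
    rewrite k_sum big_ord_recr /= big1 ?add0r; last first.
      by move=> i _; apply: vt; rewrite ltr_pMn2l.
    rewrite qtop -[kmul _ _]/(kf (1 * y ^+ d)) mul1r lcX // exprn_even_gt0 // yl orbT //.
  by have := Hsign _ mgt0; rewrite leNgt mulr_gt0.
have [k [q0]] := multiplicity_XsubC r y.
rewrite (monic_neq0 rm) /= => q0y rq.
have kgt : (0 < k)%N.
  by rewrite lt0n; apply: contraNneq q0y => kE; rewrite kE expr0 mulr1 in rq; rewrite -rq.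
have xm : ('X - y%:P) ^+ k \is monic by rewrite monic_exp // monicXsubC.
have q0m : q0 \is monic by rewrite -(monicMr _ xm) -rq.
have q0s : (size q0 + k = d.+1)%N.
  have := sr; rewrite rq size_monicM ?monic_neq0 // size_exp_XsubC addnS /= => ->; done.
(* If [k = d], then [r = (X - y)^d]. Its coefficient of degree [d - 1] is [- d y] and vanishes by
   the shift, so [y = 0] and [r = X^d], against the nonzero coefficient of index [i1]. *)
have kd : (k < d)%N.
  rewrite ltnNge; apply/negP => dk.
  have q01 : q0 = 1.
    have s1 : (size q0 <= 1)%N by rewrite -(leq_add2r k) q0s add1n ltnS.
    have E := size1_polyC s1; have := monicP q0m; rewrite lead_coefE E size_polyC.
    by case: (_ != 0); rewrite coefC /= => ->.
  have kdE : k = d by move: q0s; rewrite q01 size_poly1 add1n => -[].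
  have rprod : r = \prod_(z <- nseq d y) ('X - z%:P) by rewrite rq q01 mul1r kdE big_nseq -Monoid.iteropE.
  have := @coefPn_prod_XsubC _ (nseq d y); rewrite size_nseq -rprod -lt0n => /(_ d0).
  rewrite rE ?ltn_predL // (_ : (d - d.-1)%N = 1%N); last by rewrite -{1}(prednK d0) subSnn.
  rewrite a_d1 k0 big_nseq iter_addr_0 => /esym/eqP; rewrite oppr_eq0 mulrn_eq0 -leqn0 leqNgt d0 /= => /eqP y0.
  move: ai1; rewrite -rE // rq q01 mul1r y0 subr0 kdE coefXn ltn_eqF // eqxx //.
have cop : coprimep (('X - y%:P) ^+ k) q0 by rewrite coprimep_expl // coprimep_sym coprimep_XsubC.
have [|G [H [qGH Gm Hm sG sH]]] := hensel qm vq xm q0m cop; first by rewrite -/r rq mulrC.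
rewrite size_exp_XsubC in sG; rewrite -/q in qGH.
have sd := spn; rewrite spd ltnS in sd.
have Gn : (size G <= n)%N by rewrite sG (leq_trans kd).
have Hn : (size H <= n)%N.
  rewrite sH; apply: leq_trans sd; rewrite -ltnS -q0s -[X in (X < _)%N]addn0 ltn_add2l //.
(* The product of the endpoint values of [q] is the product of those of [G] and of [H], so for one
   of the two factors it is at most [0], and induction applies to that factor. *)
have := Hsign _ mgt0; rewrite -/q -/a' -/b' qGH !hornerM mulrACA.
case: (leP (G.[a'] * G.[b']) 0) => [HG _|HG].
  have [x xab rx] := IH G a' b' Gn Gm ab' HG.
  by apply: (fin x) => //; rewrite qGH rootM rx.
rewrite pmulr_rle0 // => HH.
have [x xab rx] := IH H a' b' Hn Hm ab' HH.
by apply: (fin x) => //; rewrite qGH rootM rx orbT.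
Qed.

Lemma K_real_closed : Num.real_closed_axiom K.
Proof.
move=> p a b ab /andP[pa pb].
case: (eqVneq p 0) => [->|p0]; first by exists a; rewrite ?lexx // root0.
have l0 : lead_coef p != 0 by rewrite lead_coef_eq0.
have [||||x xab rx] := @ivt_monic (size p) ((lead_coef p)^-1 *: p) a b.
- exact: size_scale_leq.
- by rewrite monicE lead_coefZ mulVf.
- by [].
- rewrite !hornerZ mulrACA -expr2 pmulr_rle0 ?mulr_le0_ge0 //.
  by rewrite exprn_even_gt0 //= invr_eq0.
by exists x => //; move: rx; rewrite rootZ // invr_eq0.
Qed.
HB.instance Definition _ := Num.RealField_isClosed.Build K K_real_closed.

(** * Quantifier elimination *)

Definition env (F : Type) N (v : 'I_N -> F) : seq F := [seq v i | i <- enum 'I_N].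

Lemma nth_env (F : Type) (z : F) N (v : 'I_N -> F) (i : 'I_N) : nth z (env v) i = v i.
Proof. by rewrite (nth_map i) ?size_enum_ord // nth_ord_enum. Qed.

Lemma env_default (F : Type) (z : F) N (v : 'I_N -> F) i : (N <= i)%N -> nth z (env v) i = z.
Proof. by move=> h; rewrite nth_default // size_map size_enum_ord. Qed.

Lemma term_mpoly (F : rcfType) N (t : GRing.term F) : GRing.rterm t ->
  exists P : {mpoly F[N]}, forall v, GRing.eval (env v) t = P.@[v].
Proof.
elim: t => /=.
- move=> i _; have [iN|Ni] := ltnP i N.
    by exists 'X_(Ordinal iN) => v; rewrite mevalXU -(nth_env 0).
  by exists 0 => v; rewrite meval0 env_default.
- by move=> x _; exists x%:MP => v; rewrite mevalC.
- by move=> n _; exists n%:R => v; rewrite -[n%:R in RHS](mpolyC_nat) mevalC.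
- move=> t1 IH1 t2 IH2 /andP[/IH1[P hP] /IH2[Q hQ]]; exists (P + Q) => v.
  by rewrite mevalD hP hQ.
- by move=> t IH /IH[P hP]; exists (- P) => v; rewrite mevalN hP.
- by move=> t IH n /IH[P hP]; exists (P *+ n) => v; rewrite mevalMn hP.
- move=> t1 IH1 t2 IH2 /andP[/IH1[P hP] /IH2[Q hQ]]; exists (P * Q) => v.
  by rewrite mevalM hP hQ.
- by [].
- by move=> t IH n /IH[P hP]; exists (P ^+ n) => v; rewrite rmorphXn /= hP.
Qed.

Lemma sgr_sub_eq (F : realDomainType) (a b a' b' : F) : Num.sg (a - b) = Num.sg (a' - b') ->
  [/\ (a == b) = (a' == b'), (a < b) = (a' < b') & (a <= b) = (a' <= b')].
Proof.
move=> h; rewrite -(subr_eq0 a) -(subr_eq0 a') -(subr_lt0 b) -(subr_lt0 b') -(subr_le0 b) -(subr_le0 b').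
by rewrite -sgr_eq0 -[in (_ < 0)]sgr_lt0 -[in (a - b <= 0)]sgr_le0 h sgr_eq0 sgr_lt0 sgr_le0.
Qed.

Lemma qf_signs (F : rcfType) N (f : ord.formula F) : ord.qf_form f -> ord.rformula f ->
  exists Ps : seq {mpoly F[N]}, forall v v', (forall P, P \in Ps -> Num.sg P.@[v] = Num.sg P.@[v']) ->
   ord.qf_eval (env v) f = ord.qf_eval (env v') f.
Proof.
have atom (t1 t2 : GRing.term F) : GRing.rterm t1 && GRing.rterm t2 ->
   exists Ps : seq {mpoly F[N]}, forall v v', (forall P, P \in Ps -> Num.sg P.@[v] = Num.sg P.@[v']) ->
   Num.sg (GRing.eval (env v) t1 - GRing.eval (env v) t2) = Num.sg (GRing.eval (env v') t1 - GRing.eval (env v') t2).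
  move=> /andP[/(@term_mpoly _ N)[P hP] /(@term_mpoly _ N)[Q hQ]]; exists [:: P - Q] => v v' H.
  by rewrite !hP !hQ -!mevalB; apply: H; rewrite mem_head.
elim: f => //=.
- by move=> b; exists [::].
- by move=> t1 t2 _ /atom[Ps H]; exists Ps => v v' /H /sgr_sub_eq[].
- by move=> t1 t2 _ /atom[Ps H]; exists Ps => v v' /H /sgr_sub_eq[].
- by move=> t1 t2 _ /atom[Ps H]; exists Ps => v v' /H /sgr_sub_eq[].
- move=> f IHf g IHg /andP[qf qg] /andP[rf rg]; have [Ps H] := IHf qf rf; have [Qs H'] := IHg qg rg.
  exists (Ps ++ Qs) => v v' h; rewrite (H v v') ?(H' v v') // => P iP; apply: h; rewrite mem_cat iP ?orbT //.
- move=> f IHf g IHg /andP[qf qg] /andP[rf rg]; have [Ps H] := IHf qf rf; have [Qs H'] := IHg qg rg.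
  exists (Ps ++ Qs) => v v' h; rewrite (H v v') ?(H' v v') // => P iP; apply: h; rewrite mem_cat iP ?orbT //.
- move=> f IHf g IHg /andP[qf qg] /andP[rf rg]; have [Ps H] := IHf qf rf; have [Qs H'] := IHg qg rg.
  exists (Ps ++ Qs) => v v' h; rewrite (H v v') ?(H' v v') // => P iP; apply: h; rewrite mem_cat iP ?orbT //.
- by move=> f IHf qf rf; have [Ps H] := IHf qf rf; exists Ps => v v' /H ->.
Qed.

(** All that is kept of quantifier elimination: truth only depends on the signs of finitely many
    polynomials. The quantifier-free formula itself is forgotten. *)
Lemma formula_signs (F : rcfType) N (f : ord.formula F) :
  exists Ps : seq {mpoly F[N]}, forall v v', (forall P, P \in Ps -> Num.sg P.@[v] = Num.sg P.@[v']) ->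
   ord.holds (env v) f -> ord.holds (env v') f.
Proof.
have rf := ord.to_rform_rformula f.
have /andP[qfq rfq] := ord.quantifier_elim_wf (@qe_rcf.wf_QE_wproj F) rf.
have [Ps H] := qf_signs N qfq rfq; exists Ps => v v' /H E.
move/ord.to_rformP/(ord.quantifier_elim_rformP (@qe_rcf.wf_QE_wproj F) (@qe_rcf.valid_QE_wproj F) (env v) rf).
by rewrite E => /(ord.quantifier_elim_rformP (@qe_rcf.wf_QE_wproj F) (@qe_rcf.valid_QE_wproj F) (env v') rf)/ord.to_rformP.
Qed.

Lemma holds_exists (F : realDomainType) (f : ord.formula F) k n e :
  ord.holds e (foldr (fun i g => ord.Exists i g) f (iota k n)) <->
  exists e', ord.holds e' f /\ forall i, (i < k)%N || (k + n <= i)%N -> nth 0 e' i = nth 0 e i.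
Proof.
elim: n k e => [|n IH] k e /=.
  split=> [h|[e' [h E]]]; first by exists e.
  by apply: ord.eq_holds h => i; apply: E; rewrite addn0; case: ltnP.
split=> [[x /IH[e' [h E]]]|[e' [h E]]].
  exists e'; split=> // i ik; rewrite E; last by move: ik; lia.
  rewrite nth_set_nth /=; case: eqP => // ik'; move: ik; lia.
exists (nth 0 e' k); apply/IH; exists e'; split=> // i ik.
rewrite nth_set_nth /=; case: eqP => [->//|ik']; apply: E; move: ik ik'; lia.
Qed.

(** * Dominant terms *)

Lemma exp_gt0 (x : R) : 0 < exp x.
Proof. by apply/RltP/exp_pos. Qed.

Lemma expD (x y : R) : exp x * exp y = exp (x + y).
Proof. exact: expRD. Qed.

Lemma exp_small (c d eps : R) : d < 0 -> 0 < eps ->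
  exists s0, forall s, s0 <= s -> `|c * exp (s * d)| < eps.
Proof.
move=> d0 e0; case: (eqVneq c 0) => [->|c0].
  by exists 0 => s _; rewrite mul0r normr0.
exists (`|c| / (eps * - d)) => s hs.
rewrite normrM (ger0_norm (ltW (exp_gt0 _))) -ltr_pdivlMl ?normr_gt0 //.
have H : 1 + s * - d <= exp (s * - d) by apply/RleP/exp_ineq1_le.
have E : exp (s * d) * exp (s * - d) = 1.
  by rewrite expD -[RHS]expR0; congr exp; rewrite -mulrDr addrN mulr0.
have nc : 0 < `|c| by rewrite normr_gt0.
have nd : 0 < - d by lra.
have hs' : `|c| / eps <= s * - d.
  by move: hs; rewrite invfM mulrA ler_pdivrMr.
have : exp (s * d) * (`|c| / eps) < 1.
  by rewrite -E ltr_pM2l ?exp_gt0 //; lra.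
rewrite mulrA ltr_pdivrMr // mul1r => h.
by rewrite ltr_pdivlMl // mulrC.
Qed.

Lemma exp_sum_small (I : Type) (s : seq I) (P : pred I) (a e : I -> R) (eps : R) :
  (forall i, P i -> e i < 0) -> 0 < eps ->
  exists s0, forall t, s0 <= t -> `|\sum_(i <- s | P i) a i * exp (t * e i)| < eps.
Proof.
move=> He; elim: s eps => [|i s IH] eps e0.
  by exists 0 => t _; rewrite big_nil normr0.
have [s1 H1] := IH (eps / 2) ltac:(lra).
case Pi: (P i); last by exists s1 => t /H1; rewrite big_cons Pi; lra.
have [s2 H2] := @exp_small (a i) (e i) (eps / 2) (He i Pi) ltac:(lra).
exists (Num.max s1 s2) => t; rewrite ge_max => /andP[/H1 h1 /H2 h2].
rewrite big_cons Pi; apply: le_lt_trans (ler_normD _ _) _; lra.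
Qed.

Lemma sgr_perturb (F : realDomainType) (c d : F) : `|d| < `|c| -> Num.sg (c + d) = Num.sg c.
Proof.
case: (ltrgt0P c) => // c0; rewrite ?normr_lt0 // ltr_norml => /andP[h1 h2].
- by rewrite !gtr0_sg //; lra.
- by rewrite !ltr0_sg //; lra.
Qed.

Lemma exp_sum_sign (I : Type) (s : seq I) (P : pred I) (a e : I -> R) (E : R) :
  (forall i, P i -> e i <= E) -> \sum_(i <- s | P i && (e i == E)) a i != 0 ->
  exists s0, forall t, s0 <= t ->
    Num.sg (\sum_(i <- s | P i) a i * exp (t * e i)) = Num.sg (\sum_(i <- s | P i && (e i == E)) a i).
Proof.
move=> He C0.
have [||s0 H] := @exp_sum_small I s (fun i => P i && (e i != E)) a (fun i => e i - E) `|\sum_(i <- s | P i && (e i == E)) a i|.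
- by move=> i /andP[/He h1 h2]; rewrite subr_lt0 lt_neqAle h2.
- by rewrite normr_gt0.
exists s0 => t /H h.
rewrite -(sgr_perturb h) -[RHS]mul1r -(gtr0_sg (exp_gt0 (t * E))) -sgrM; congr Num.sg.
rewrite mulrDr !mulr_sumr (bigID (fun i => e i == E)) /=; congr (_ + _).
  by apply: eq_bigr => i /andP[_ /eqP ->]; rewrite mulrC.
apply: eq_bigr => i _; rewrite [RHS]mulrCA expD; congr (_ * exp _); ring.
Qed.

Definition lin N (m : 'X_{1..N}) (b : 'I_N -> R) : R := \sum_i (m i)%:R * b i.

(** Two monomials have the same weight only if [X] is a root of their difference polynomial, so any
    [X] beyond the Cauchy bounds of all differences separates them. The bound [3] later keeps the
    weight [X^n] of the constant [c] above twice the weight of each coordinate. *)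
Lemma generic_weights N (L : seq 'X_{1..N}) : exists X : R, 3 <= X /\
  {in L &, forall m m', lin m (fun i => X ^+ i) = lin m' (fun i => X ^+ i) -> m = m'}.
Proof.
pose q (p : 'X_{1..N} * 'X_{1..N}) : {poly R} := \sum_(i < N) ((p.1 i)%:R - (p.2 i)%:R) *: 'X^i.
have [X HX] : exists X : R, 3 <= X /\ forall p, p \in allpairs pair L L -> cauchy_bound (q p) <= X.
  elim: (allpairs pair L L) => [|p l [X [X3 HX]]]; first by exists 3.
  exists (Num.max X (cauchy_bound (q p))); split; first by rewrite le_max X3.
  by move=> p'; rewrite in_cons le_max => /orP[/eqP->|/HX ->]; rewrite ?lexx ?orbT.
exists X; split; first by case: HX.
move=> m m' mL m'L E.
have r0 : (q (m, m')).[X] = 0.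
  rewrite horner_sum; transitivity (lin m (fun i => X ^+ i) - lin m' (fun i => X ^+ i)); last by rewrite E subrr.
  by rewrite -sumrB; apply: eq_bigr => i _; rewrite hornerZ hornerXn mulrBl.
have X0 : 0 < X by apply: lt_le_trans HX.1.
have q0 : q (m, m') = 0.
  apply/eqP/negP => /negP q0; have := cauchy_boundP q0 r0; rewrite ltNge gtr0_norm //.
  by rewrite HX.2 //; apply: allpairs_f.
apply/mnmP => i; have := congr1 (fun p : {poly R} => p`_i) q0.
rewrite coef_sum coef0 (bigD1 i) //= big1 ?addr0.
  by rewrite coefZ coefXn eqxx mulr1 => /eqP; rewrite subr_eq0 eqr_nat => /eqP.
by move=> j ji; rewrite coefZ coefXn; case: eqP => [E'|]; rewrite ?mulr0 //; case/eqP: ji; apply: val_inj.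
Qed.

Definition hasval (x : K) (l : R) := x l != 0 /\ vle x l.

Definition kval (x : K) : R := if pselect (x != 0) is left H then sval (cid (lead H)) else 0.
Lemma kvalP x : x != 0 -> hasval x (kval x).
Proof. by rewrite /kval; case: pselect => // H _; case: cid. Qed.

Lemma sgr_lc (x : K) l : vle x l -> x l != 0 -> Num.sg x = if 0 < x l then 1 else -1.
Proof.
move=> vx xl; case: ifP => h; first by apply: gtr0_sg; rewrite (kgt0_lc vx xl).
by apply: ltr0_sg; rewrite (klt0_lc vx xl) lt_neqAle xl leNgt h.
Qed.

Lemma mono_prod (I : Type) (s : seq I) (c l : I -> R) :
  \prod_(i <- s) mono (c i) (l i) = mono (\prod_(i <- s) c i) (\sum_(i <- s) l i).
Proof.
by elim: s => [|i s IH]; rewrite ?big_nil ?mono1 // !big_cons IH monoM.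
Qed.

Lemma exp_sum (I : Type) (s : seq I) (x : I -> R) : \prod_(i <- s) exp (x i) = exp (\sum_(i <- s) x i).
Proof. by elim: s => [|i s IH]; rewrite ?big_nil ?expR0 // !big_cons IH expD. Qed.

Section Domination.
Variables (N : nat) (J : {pred 'I_N}) (b : 'I_N -> R).

(** The point with coordinates [exp (t b_i) exp (s (l0_i - l_i)) t^(l_i)]. For large [t] and then
    large [s], the terms of [P] of maximal valuation at [l] are ordered by the second factor according
    to their valuation at [l0], and the remaining ties are broken by the first factor. Hence the sign
    of [P] does not depend on [l], as long as [l] preserves the comparisons that hold at [l0]. *)
Definition vpt (t s : R) (l0 l : 'I_N -> R) (i : 'I_N) : K :=
  if i \in J then mono (exp (t * b i + s * (l0 i - l i))) (l i) else 0.

(** The monomials that survive when the coordinates outside [J] are zero. *)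
Definition jsupp (P : {mpoly K[N]}) : seq 'X_{1..N} :=
  [seq m : 'X_{1..N} <- msupp P | [forall i, (i \notin J) ==> (m i == 0%N)]].

(** The valuation of the term of exponent [m] at a point of valuation [l]: an affine function of [l]
    with natural slopes. *)
Definition ell (P : {mpoly K[N]}) (m : 'X_{1..N}) (l : 'I_N -> R) : R := kval P@_m + lin m l.

Lemma meval_vpt P t s l0 l :
  P.@[vpt t s l0 l] = \sum_(m <- jsupp P)
     P@_m * mono (exp (t * lin m b) * exp (s * (lin m l0 - lin m l))) (lin m l).
Proof.
rewrite mevalE /jsupp big_filter [RHS]big_mkcond; apply: eq_bigr => m _.
case: ifP => [/forallP H|/negbT]; last first.
  rewrite negb_forall => /existsP[i]; rewrite negb_imply => /andP[iJ mi].
  rewrite (bigD1 i) //= {1}/vpt (negPf iJ) expr0n (negPf mi) mul0r mulr0 //.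
congr (_ * _); transitivity (\prod_i mono (exp (t * b i + s * (l0 i - l i)) ^+ m i) (l i *+ m i)).
  apply: eq_bigr => i _; rewrite /vpt; case: ifP => [_|/negbT iJ]; first by rewrite monoX.
  by have := H i; rewrite iJ /= => /eqP ->; rewrite !expr0 mulr0n mono1.
rewrite mono_prod; congr mono; last by apply: eq_bigr => i _; rewrite mulr_natl.
rewrite expD mulrBr /lin !mulr_sumr -sumrB -big_split /= -exp_sum; apply: eq_bigr => i _.
rewrite expRX; congr exp; rewrite -mulr_natl; ring.
Qed.

(** The order of the quantifiers is the point: [t0] and the sign [z] come from [l0] alone, and only
    [s0] depends on [l]. The same [z] is therefore the sign at [l0] and at [l]. *)
Lemma sign_dominant P (l0 : 'I_N -> R) : {in msupp P &, forall m m', lin m b = lin m' b -> m = m'} ->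
  exists t0 z, forall t, t0 <= t -> forall l,
   {in jsupp P &, forall m m', ell P m l0 <= ell P m' l0 -> ell P m l <= ell P m' l} ->
   exists s0, forall s, s0 <= s -> Num.sg P.@[vpt t s l0 l] = z.
Proof.
move=> inj.
have [E|[m1 m1s]] : jsupp P = [::] \/ exists m, m \in jsupp P.
- by case: (jsupp P) => [|m L]; [left|right; exists m; rewrite mem_head].
- by exists 0, 0 => t _ l _; exists 0 => s _; rewrite meval_vpt E big_nil sgr0.
have sub m : m \in jsupp P -> m \in msupp P by rewrite mem_filter => /andP[].
have /seq_max[M0 [/mapP[m2 m2s M0E] HM0]] : ell P m1 l0 \in [seq ell P m l0 | m <- jsupp P] by apply: map_f.
have HM m : m \in jsupp P -> ell P m l0 <= M0 by move=> ms; apply: HM0; apply: map_f.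
(* [ms] has the largest weight among the monomials that are maximal at [l0]; the sign [z] is that of
   its leading coefficient. *)
have /seq_max[B0 [/mapP[ms]]] : lin m2 b \in [seq lin m b | m <- jsupp P & ell P m l0 == M0].
  by apply: map_f; rewrite mem_filter m2s M0E eqxx.
rewrite mem_filter => /andP[/eqP msM mss] B0E HB.
pose lc m : R := P@_m (kval P@_m).
have lcn m : m \in jsupp P -> lc m != 0.
  by move=> /sub; rewrite mcoeff_msupp => /kvalP[].
pose C t := \sum_(m <- jsupp P | (m \in jsupp P) && (ell P m l0 == M0)) lc m * exp (t * lin m b).
have us : uniq (jsupp P) by rewrite filter_uniq // msupp_uniq.
have [t0 Ht0] : exists t0, forall t, t0 <= t -> Num.sg (C t) = Num.sg (lc ms).
  have top : \sum_(m <- jsupp P | (m \in jsupp P) && (ell P m l0 == M0) && (lin m b == B0)) lc m = lc ms.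
    rewrite -big_filter (_ : [seq m <- _ | _] = [:: ms]) ?big_seq1 //.
    rewrite -(@filter_pred1_uniq _ (jsupp P) ms) //; apply: eq_in_filter => m mj /=.
    apply/idP/eqP => [/andP[_ /eqP mB]|->]; last by rewrite mss msM B0E !eqxx.
    by apply: inj; rewrite ?sub // mB.
  have [||t0 Ht0] := @exp_sum_sign _ (jsupp P) (fun m => (m \in jsupp P) && (ell P m l0 == M0)) lc (fun m => lin m b) B0.
  - by move=> m /andP[mj mM]; apply: HB; apply: map_f; rewrite mem_filter mM.
  - by rewrite top lcn.
  by exists t0 => t /Ht0; rewrite top.
have Cn t : t0 <= t -> C t != 0 by move=> /Ht0 E; rewrite -sgr_eq0 E sgr_eq0 lcn.
exists t0, (if 0 < lc ms then 1 else -1) => t tt0 l Hl.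
pose M := ell P ms l.
have HMl m : m \in jsupp P -> ell P m l <= M.
  by move=> mj; apply: Hl => //; rewrite msM HM.
have HA m : m \in jsupp P -> ell P m l0 = M0 -> ell P m l = M.
  by move=> mj mM; apply/le_anti; rewrite HMl //= Hl // msM mM.
pose w s m : R := exp (t * lin m b) * exp (s * (lin m l0 - lin m l)).
have coefM s : P.@[vpt t s l0 l] M =
   \sum_(m <- jsupp P | (m \in jsupp P) && (ell P m l == M)) (lc m * exp (t * lin m b)) * exp (s * (ell P m l0 - M)).
  rewrite meval_vpt k_sum big_seq [RHS]big_mkcondr; apply: eq_bigr => m mj.
  rewrite [P@_m * _]mulrC mono_mul; case: eqP => E.
    rewrite -E /ell addrK -/(lc m) mulrC -!mulrA; congr (_ * (_ * exp (_ * _))); ring.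
  have [_ v] := kvalP (lead_neq0 (lcn m mj)).
  have lt : ell P m l < M by rewrite lt_neqAle HMl // andbT; apply/eqP.
  rewrite v ?mulr0 //; move: lt; rewrite /ell; lra.
have vM s : vle P.@[vpt t s l0 l] M.
  rewrite meval_vpt big_seq; apply: vle_sum => m mj; apply: (vle_le (HMl m mj)).
  by apply: vleM; [exact: (kvalP (lead_neq0 (lcn m mj))).2|exact: vle_mono].
(* A monomial that is maximal at [l0] stays maximal at [l]. So the part that dominates for large [s]
   is [C t], which does not involve [l]. *)
have CE : \sum_(m <- jsupp P | (m \in jsupp P) && (ell P m l == M) && (ell P m l0 - M == M0 - M)) lc m * exp (t * lin m b) = C t.
  rewrite /C; apply: eq_bigl => m; rewrite (inj_eq (addIr _)); case mj: (m \in jsupp P) => //=.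
  by case: (eqVneq (ell P m l0) M0) => [/HA->//|]; rewrite ?eqxx ?andbF.
have [||s0 Hs0] := @exp_sum_sign _ (jsupp P) (fun m => (m \in jsupp P) && (ell P m l == M))
   (fun m => lc m * exp (t * lin m b)) (fun m => ell P m l0 - M) (M0 - M).
- by move=> m /andP[mj _]; rewrite lerD2r HM.
- by rewrite CE Cn.
exists s0 => s /Hs0; rewrite CE -coefM Ht0 // => E.
have nM : P.@[vpt t s l0 l] M != 0 by rewrite -sgr_eq0 E sgr_eq0 lcn.
by rewrite (sgr_lc (@vM s) nM) -sgr_gt0 E sgr_gt0.
Qed.
End Domination.

(** * The valuation of a semialgebraic set *)

Definition ford n (i : Fin.t n) : 'I_n := Ordinal (introT ssrnat.ltP (proj2_sig (Fin.to_nat i))).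
Definition fint n (i : 'I_n) : Fin.t n := Fin.of_nat_lt (elimT ssrnat.ltP (ltn_ord i)).
Lemma fordK n : cancel (@ford n) (@fint n).
Proof.
move=> i; rewrite -[RHS](Fin.of_nat_to_nat_inv i) /fint.
by apply: Fin.of_nat_ext.
Qed.
Lemma fintK n : cancel (@fint n) (@ford n).
Proof. by move=> i; apply: val_inj; rewrite /= /fint Fin.to_nat_of_nat. Qed.

Definition toK n (x : 'I_n -> K) : kvec n := fun i => x (ford i).
Lemma toK_kvec n (x : 'I_n -> K) : is_kvec (toK x).
Proof. by move=> i; apply: kfP. Qed.
Lemma kvec_toK n (x : kvec n) : is_kvec x -> exists x' : 'I_n -> K, x = toK x'.
Proof.
move=> h; exists (fun i => MkK (h (fint i))); apply: functional_extensionality_dep => i.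
by rewrite /toK /= fordK.
Qed.

(** The offset [k] leaves room for other variables in front. The value [0] for a constant that is
    not a series is a filler, excluded by [kpoly_ok]. *)
Fixpoint kterm n (k : nat) (p : kpoly n) : GRing.term K :=
  match p with
  | PVar i => GRing.Var _ (k + ford i)
  | PConst c => GRing.Const (if pselect (is_series c) is left H then MkK H else 0)
  | PAdd p q => GRing.Add (kterm k p) (kterm k q)
  | PMul p q => GRing.Mul (kterm k p) (kterm k q)
  | POpp p => GRing.Opp (kterm k p)
  end.

Lemma kterm_eval n k (p : kpoly n) e (x : 'I_n -> K) : kpoly_ok p -> (forall i : 'I_n, nth 0 e (k + i) = x i) ->
  kf (GRing.eval e (kterm k p)) = peval p (toK x).
Proof.
move=> okp E; elim: p okp => //=.
- by move=> i _; rewrite (E (ford i)).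
- by move=> c Hc; case: pselect.
- by move=> p IHp q IHq [/IHp<- /IHq<-].
- by move=> p IHp q IHq [/IHp<- /IHq<-].
- by move=> p IHp /IHp<-.
Qed.

Lemma ForallP (T : Type) (P : T -> Prop) x s : Forall P (x :: s) <-> P x /\ Forall P s.
Proof. by split=> [H|[? ?]]; [inversion H|constructor]. Qed.

Lemma basic_formula n (B : kvec n -> Prop) : basic_semialg B -> exists F : nat -> ord.formula K,
  forall k e (x : 'I_n -> K), (forall i : 'I_n, nth 0 e (k + i) = x i) -> (ord.holds e (F k) <-> B (toK x)).
Proof.
move=> [ps [qs [okp [okq HB]]]].
exists (fun k => foldr (fun p g => ord.And (ord.Lt (GRing.Const 0) (kterm k p)) g)
   (foldr (fun q g => ord.And (ord.Equal (kterm k q) (GRing.Const 0)) g) (ord.Bool true) qs) ps).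
move=> k e x E; rewrite HB.
have Hq : ord.holds e (foldr (fun q g => ord.And (ord.Equal (kterm k q) (GRing.Const 0)) g) (ord.Bool true) qs)
   <-> Forall (fun q => kiszero (peval q (toK x))) qs.
  elim: qs okq {HB} => [|q qs IH] /=; first by split.
  move=> /ForallP[okq /IH{}IH]; rewrite ForallP IH -(kterm_eval okq E).
  split=> -[h ?]; split=> //; first by rewrite h.
  by apply/kiszeroP.
have Hp : ord.holds e (foldr (fun p g => ord.And (ord.Lt (GRing.Const 0) (kterm k p)) g)
   (foldr (fun q g => ord.And (ord.Equal (kterm k q) (GRing.Const 0)) g) (ord.Bool true) qs) ps)
   <-> Forall (fun p => kpos (peval p (toK x))) ps /\ Forall (fun q => kiszero (peval q (toK x))) qs.
  elim: ps okp {HB} => [|p ps IH] /=; first by rewrite Hq; split=> [h|[]].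
  move=> /ForallP[okp1 /IH{}IH]; rewrite ForallP IH -(kterm_eval okp1 E).
  split=> [[h []]|[[h ?] ?]]; first by split=> //; split=> //; apply/kpos_gt0.
  by split=> //; apply/kpos_gt0.
by rewrite Hp; split=> [h|[_ //]]; split=> //; apply: toK_kvec.
Qed.

Lemma semialg_formula n (S : kvec n -> Prop) : semialgebraic S -> exists F : nat -> ord.formula K,
  forall k e (x : 'I_n -> K), (forall i : 'I_n, nth 0 e (k + i) = x i) -> (ord.holds e (F k) <-> S (toK x)).
Proof.
move=> [L [HL HS]].
have [F HF] : exists F : nat -> ord.formula K,
  forall k e (x : 'I_n -> K), (forall i : 'I_n, nth 0 e (k + i) = x i) ->
   (ord.holds e (F k) <-> exists B, In B L /\ B (toK x)).
  elim: L HL {HS} => [|B L IH].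
    by exists (fun _ => ord.Bool false) => k e x _ /=; split=> // -[B []].
  move=> /ForallP[/basic_formula[F HF] /IH[G HG]]; exists (fun k => ord.Or (F k) (G k)) => k e x E /=.
  rewrite HF // HG //; split=> [[h|[B' [h1 h2]]]|[B' [[<-|h1] h2]]].
  - by exists B; split=> //; left.
  - by exists B'; split=> //; right.
  - by left.
  - by right; exists B'.
by exists F => k e x E; rewrite HF // HS.
Qed.

(** The point [x] of [S] has the valuation of [y] up to the factor [c], which will be a large real constant. *)
Definition near n (S : kvec n -> Prop) (y : 'I_n -> K) (c : K) : Prop :=
  exists x : 'I_n -> K, S (toK x) /\ forall i, y i ^+ 2 <= c * x i ^+ 2 /\ x i ^+ 2 <= c * y i ^+ 2.

Lemma holds_all (F : realDomainType) (T : eqType) (f : T -> ord.formula F) (s : seq T) e :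
  ord.holds e (foldr (fun i g => ord.And (f i) g) (ord.Bool true) s) <-> forall i, i \in s -> ord.holds e (f i).
Proof.
elim: s => [|i s IH] /=; first by split.
rewrite IH; split=> [[h1 h2] j|h].
  by rewrite in_cons => /orP[/eqP->|/h2].
by split=> [|j js]; apply: h; rewrite in_cons ?eqxx ?js ?orbT.
Qed.

Lemma near_formula n (S : kvec n -> Prop) : semialgebraic S -> exists f : ord.formula K,
  forall v : 'I_n.+1 -> K, ord.holds (env v) f <-> near S (fun i => v (widen_ord (leqnSn n) i)) (v ord_max).
Proof.
move=> /semialg_formula[F HF].
(* Variables [0] to [n - 1] hold [y], variable [n] holds [c], and the next [n] variables are the
   quantified [x]. *)
pose Y i : GRing.term K := GRing.Exp (GRing.Var _ i) 2.
pose X i : GRing.term K := GRing.Exp (GRing.Var _ (n.+1 + i)) 2.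
pose C : GRing.term K := GRing.Var _ n.
pose at_ (i : 'I_n) := ord.And (ord.Le (Y i) (GRing.Mul C (X i))) (ord.Le (X i) (GRing.Mul C (Y i))).
exists (foldr (fun i g => ord.Exists i g) (ord.And (F n.+1) (foldr (fun i g => ord.And (at_ i) g) (ord.Bool true) (enum 'I_n))) (iota n.+1 n)).
move=> v; rewrite holds_exists.
have vE (i : 'I_n) : nth 0 (env v) i = v (widen_ord (leqnSn n) i) by rewrite -(nth_env 0 v).
have vC : nth 0 (env v) n = v ord_max by rewrite -(nth_env 0 v).
split=> [[e [/= [hF /holds_all hA] E]]|[x [Sx Hx]]].
  exists (fun i : 'I_n => nth 0 e (n.+1 + i)); split; first by apply/(HF n.+1 e).
  move=> i; have := hA i; rewrite mem_enum => /(_ isT) /= [].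
  by rewrite (E n) ?ltnSn // (E i) ?(ltn_trans (ltn_ord i)) ?ltnSn // vE vC.
pose e := env v ++ [seq x i | i <- enum 'I_n].
have sv : size (env v) = n.+1 by rewrite size_map size_enum_ord.
have ex (i : 'I_n) : nth 0 e (n.+1 + i) = x i.
  by rewrite nth_cat sv ltnNge leq_addr /= addKn (nth_map i) ?size_enum_ord // nth_ord_enum.
have ev i : (i < n.+1)%N -> nth 0 e i = nth 0 (env v) i by move=> h; rewrite nth_cat sv h.
exists e; split; last first.
  move=> i /orP[/ev//|h].
  have se : size e = (n.+1 + n)%N by rewrite size_cat sv size_map size_enum_ord.
  by rewrite nth_default ?se // nth_default // sv (leq_trans (leq_addr _ _) h).
split; first by apply/HF; first exact: ex.
apply/holds_all => i _ /=; rewrite ex ev ?(ltn_trans (ltn_ord i)) ?ltnSn // (ev n) ?ltnSn // vE vC.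
exact: Hx.
Qed.

Lemma ev_all (T : eqType) (s : seq T) (P : T -> R -> Prop) :
  (forall x, x \in s -> exists t0, forall t, t0 <= t -> P x t) ->
  exists t0, forall t, t0 <= t -> forall x, x \in s -> P x t.
Proof.
elim: s => [|x s IH] H; first by exists 0.
have [|t1 H1] := IH; first by move=> y ys; apply: H; rewrite in_cons ys orbT.
have [t2 H2] := H x (mem_head _ _); exists (Num.max t1 t2) => t; rewrite ge_max => /andP[h1 h2] y.
by rewrite in_cons => /orP[/eqP->|/(H1 _ h1)]; first exact: H2.
Qed.

Lemma lcX2 (x : K) l : vle x l -> vle (x ^+ 2) (l + l) /\ (x ^+ 2) (l + l) = x l ^+ 2.
Proof. by move=> v; rewrite !expr2; split; [exact: vleM|exact: lcM]. Qed.

(** Squares stand in for absolute values. As [c] is a positive real, a difference of valuations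
    would make one of the two inequalities fail at the larger leading exponent. *)
Lemma near_valE (x : K) (w c l : R) : 0 < w -> 0 < c ->
  (mono w l) ^+ 2 <= mono c 0 * x ^+ 2 -> x ^+ 2 <= mono c 0 * (mono w l) ^+ 2 -> hasval x l.
Proof.
move=> w0 c0 h1 h2.
have [vw lw] := lcX2 (@vle_mono w l); rewrite monoE eqxx in lw.
have w2 : 0 < w ^+ 2 by rewrite exprn_gt0.
have y0 : 0 < mono w l ^+ 2 by apply/kgt0P; exists (l + l); rewrite lw.
have x0 : x != 0.
  by apply: contraTneq h1 => ->; rewrite expr0n mulr0 -ltNge.
have [k [xk vk]] := lead x0.
have [vx lx] := lcX2 vk.
have x2 : 0 < x k ^+ 2 by rewrite exprn_even_gt0 //= xk.
case: (ltgtP k l) => [kl|lk|<-] //; exfalso.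
- have : 0 < mono w l ^+ 2 - mono c 0 * x ^+ 2.
    apply/kgt0P; exists (l + l); rewrite kB lw mono_mul vx ?mulr0 ?subr0; last by lra.
    split=> //; apply: vleB => //; apply: (@vle_le _ (0 + (k + k))); first by lra.
    by apply: vleM => //; apply: vle_mono.
  by rewrite subr_gt0 ltNge h1.
- have : 0 < x ^+ 2 - mono c 0 * mono w l ^+ 2.
    apply/kgt0P; exists (k + k); rewrite kB lx mono_mul vw ?mulr0 ?subr0; last by lra.
    split=> //; apply: vleB => //; apply: (@vle_le _ (0 + (l + l))); first by lra.
    by apply: vleM => //; apply: vle_mono.
  by rewrite subr_gt0 ltNge h2.
Qed.

Lemma near_valI (x : K) (w c l : R) : 0 < w -> 0 < c -> hasval x l ->
  w ^+ 2 < c * x l ^+ 2 -> x l ^+ 2 < c * w ^+ 2 ->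
  (mono w l) ^+ 2 <= mono c 0 * x ^+ 2 /\ x ^+ 2 <= mono c 0 * (mono w l) ^+ 2.
Proof.
move=> w0 c0 [xl vl] h1 h2.
have [vw lw] := lcX2 (@vle_mono w l); rewrite monoE eqxx in lw.
have [vx lx] := lcX2 vl.
have aux (y : K) : vle y (l + l) -> vle (mono c 0 * y) (l + l).
  by move=> vy; rewrite -[l + l]add0r; apply: vleM => //; apply: vle_mono.
split; rewrite -subr_ge0 ltW //; apply/kgt0P; exists (l + l); rewrite kB mono_mul subr0 lx lw subr_gt0.
  by split=> //; apply: vleB => //; apply: aux.
by split=> //; apply: vleB => //; apply: aux.
Qed.

Definition valJ n (S : kvec n -> Prop) (J : {set 'I_n}) (l : 'I_n -> R) : Prop :=
  exists x : 'I_n -> K, S (toK x) /\ forall i, if i \in J then hasval (x i) (l i) else x i = 0.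

Definition aff n (p : {ffun 'I_n -> nat} * R) (l : 'I_n -> R) : R := \sum_i (p.1 i)%:R * l i + p.2.

Section Pattern.
Variables (n : nat) (S : kvec n -> Prop) (J : {set 'I_n}).
Let wid (i : 'I_n) : 'I_n.+1 := widen_ord (leqnSn n) i.
(** Index [n] is the variable [c] of [near]. It is a nonzero real constant, so its exponent is [0]
    and it belongs to [J'] whatever [J] is. *)
Let ext (l : 'I_n -> R) (i : 'I_n.+1) : R := oapp l 0 (insub (val i) : option 'I_n).
Let J' : {pred 'I_n.+1} := fun i => oapp (fun j => j \in J) true (insub (val i) : option 'I_n).

Let insub_wid i : (insub (val (wid i)) : option 'I_n) = Some i.
Proof. by rewrite insubT ?ltn_ord //= => h; congr Some; apply: val_inj. Qed.
Let insub_max : (insub (val (@ord_max n)) : option 'I_n) = None.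
Proof. by rewrite insubN //= ltnn. Qed.

Let lin_ext m l : lin m (ext l) = \sum_i (m (wid i))%:R * l i.
Proof.
rewrite /lin big_ord_recr /= /ext insub_max /= mulr0 addr0.
by apply: eq_bigr => i _; rewrite insub_wid.
Qed.

(** [l0] belongs to the valuation of [S] as soon as [near] holds at one point of valuation [l0],
    and [near] is equivalent to a sign condition on finitely many polynomials. *)
Lemma val_pattern : semialgebraic S -> exists M : seq ({ffun 'I_n -> nat} * R),
  (forall p, p \in M -> forall i, i \notin J -> p.1 i = 0%N) /\
  forall l0 l, valJ S J l0 ->
    {in M &, forall p q, aff p l0 <= aff q l0 -> aff p l <= aff q l} -> valJ S J l.
Proof.
move=> /near_formula[f Hf].
have [Ps HPs] := formula_signs n.+1 f.
pose enc (P : {mpoly K[n.+1]}) (m : 'X_{1..n.+1}) : {ffun 'I_n -> nat} * R := ([ffun i => m (wid i)], kval P@_m).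
exists (flatten [seq [seq enc P m | m <- jsupp J' P] | P <- Ps]); split.
  move=> p /flattenP[s /mapP[P _ ->] /mapP[m]]; rewrite mem_filter => /andP[/forallP H _] -> i iJ.
  by rewrite ffunE; have := H (wid i); rewrite /J' -topredE /= insub_wid /= iJ /= => /eqP.
have ellE P m l : ell P m (ext l) = aff (enc P m) l.
  by rewrite /ell /aff lin_ext addrC /=; congr (_ + _); apply: eq_bigr => i _; rewrite ffunE.
move=> l0 l [x [Sx Hx]] HM.
have [X [X3 Xinj]] := generic_weights (flatten [seq (msupp P : seq 'X_{1..n.+1}) | P <- Ps]).
pose b (i : 'I_n.+1) := X ^+ i.
have [t0 Ht0] : exists t0, forall t, t0 <= t -> forall P, P \in Ps ->
    exists z, forall l, {in jsupp J' P &, forall m m', ell P m (ext l0) <= ell P m' (ext l0) -> ell P m l <= ell P m' l} ->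
   exists s0, forall s, s0 <= s -> Num.sg P.@[vpt J' b t s (ext l0) l] = z.
  apply: ev_all => P iP; have [|t0 [z Hz]] := @sign_dominant _ J' b P (ext l0).
    by move=> m m' im im'; apply: Xinj; apply/flattenP; exists (msupp P) => //; apply: map_f.
  by exists t0 => t tt0; exists z; apply: Hz.
have X0 : 0 < X by lra.
(* At [l = l0] the test point has leading coefficients [exp (t X^i)], and [c] is [exp (t X^n)].
   Since [X^n > 2 X^i], the leading coefficients of [x] are within the tolerance for large [t]. *)
have [t1 Ht1] : exists t1, forall t, t1 <= t -> forall i, i \in enum 'I_n -> i \in J ->
   exp (t * X ^+ i) ^+ 2 < exp (t * X ^+ n) * x i (l0 i) ^+ 2 /\
   x i (l0 i) ^+ 2 < exp (t * X ^+ n) * exp (t * X ^+ i) ^+ 2.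
  apply: ev_all => i _; case iJ: (i \in J); last by exists 0.
  have [xi vi] : hasval (x i) (l0 i) by have := Hx i; rewrite iJ.
  have x2 : 0 < x i (l0 i) ^+ 2 by rewrite exprn_even_gt0 //= xi.
  have Xi : 0 < X ^+ i by rewrite exprn_gt0.
  have Xn : X ^+ i * 3 <= X ^+ n.
    rewrite (_ : X ^+ n = X ^+ i * (X * X ^+ (n - i.+1))); last by rewrite mulrA -exprSr -exprD subnKC.
    rewrite ler_pM2l //.
    by rewrite -[3]mulr1 ler_pM // exprn_ege1 //; lra.
  have [||s1 H1] := @exp_small ((x i (l0 i) ^+ 2)^-1) (2 * X ^+ i - X ^+ n) 1; [by lra|by []|].
  have [||s2 H2] := @exp_small (x i (l0 i) ^+ 2) (- (2 * X ^+ i + X ^+ n)) 1; [by lra|by []|].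
  exists (Num.max s1 s2) => t; rewrite ge_max => /andP[/H1 h1 /H2 h2] _.
  have E2 (a : R) : exp a ^+ 2 = exp (2 * a) by rewrite expRX; congr exp; ring.
  rewrite E2 expD; split.
    move: h1; rewrite ger0_norm; last by rewrite ltW // mulr_gt0 ?invr_gt0 ?exp_gt0.
    rewrite ltr_pdivrMl // mulr1 => h1.
    rewrite (_ : 2 * _ = t * X ^+ n + t * (2 * X ^+ i - X ^+ n)); last by ring.
    by rewrite -expD ltr_pM2l ?exp_gt0.
  move: h2; rewrite ger0_norm; last by rewrite ltW // mulr_gt0 ?exp_gt0.
  rewrite mulrN -[exp _]invrK.
  have -> : (exp (- (t * (2 * X ^+ i + X ^+ n))))^-1 = exp (t * (2 * X ^+ i + X ^+ n)).
    by apply: (mulfI (lt0r_neq0 (exp_gt0 (- (t * (2 * X ^+ i + X ^+ n)))))); rewrite divff ?gt_eqF ?exp_gt0 // expD addNr expR0.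
  by rewrite ltr_pdivrMr ?exp_gt0 // mul1r => h; congr (_ < exp _): h; ring.
pose t := Num.max t0 t1.
have tt0 : t0 <= t by rewrite le_max lexx.
have tt1 : t1 <= t by rewrite le_max lexx orbT.
have ord_pres P : P \in Ps ->
   {in jsupp J' P &, forall m m', ell P m (ext l0) <= ell P m' (ext l0) -> ell P m (ext l) <= ell P m' (ext l)}.
  move=> iP m m' im im'; rewrite !ellE; apply: HM.
    by apply/flattenP; exists [seq enc P m | m <- jsupp J' P]; apply: map_f.
  by apply/flattenP; exists [seq enc P m | m <- jsupp J' P]; apply: map_f.
have [s Hs] : exists s, forall P, P \in Ps ->
   Num.sg P.@[vpt J' b t s (ext l0) (ext l0)] = Num.sg P.@[vpt J' b t s (ext l0) (ext l)].
  have [|s0 H] := @ev_all _ Ps (fun P s => Num.sg P.@[vpt J' b t s (ext l0) (ext l0)] = Num.sg P.@[vpt J' b t s (ext l0) (ext l)]).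
    move=> P iP; have [z Hz] := Ht0 t tt0 P iP.
    have [s1 H1] := Hz (ext l0) (fun _ _ _ _ h => h).
    have [s2 H2] := Hz (ext l) (ord_pres P iP).
    exists (Num.max s1 s2) => s; rewrite ge_max => /andP[h1 h2]; by rewrite H1 // H2.
  by exists s0; apply: H.
have vwid l' i : vpt J' b t s (ext l0) (ext l') (wid i) =
   if i \in J then mono (exp (t * X ^+ i + s * (l0 i - l' i))) (l' i) else 0.
  by rewrite /vpt /J' -topredE /= /ext insub_wid.
have vmax l' : vpt J' b t s (ext l0) (ext l') ord_max = mono (exp (t * X ^+ n)) 0.
  by rewrite /vpt /J' -topredE /= /ext insub_max /= subr0 mulr0 addr0.
(* The two test points give the same signs, so [near], witnessed by [x] at [l0], also holds at [l].
   The witness obtained there has valuation [l]. *)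
have := HPs _ _ Hs; rewrite !Hf /near => /(_ _)[].
  exists x; split=> // i; rewrite vmax -[widen_ord _ i]/(wid i) vwid.
  case iJ: (i \in J); last by have := Hx i; rewrite iJ => ->; rewrite expr0n /= !mulr0.
  have [h1 h2] := Ht1 t tt1 i (mem_enum _ _) iJ.
  have := Hx i; rewrite iJ => hx; rewrite subrr mulr0 addr0.
  by apply: near_valI; rewrite ?exp_gt0.
move=> x' [Sx' Hx']; exists x'; split=> // i.
have := Hx' i; rewrite vmax -[widen_ord _ i]/(wid i) vwid; case: (i \in J) => -[h1 h2].
  by apply: near_valE h1 h2; rewrite exp_gt0.
apply/eqP; rewrite -sqrf_eq0 eq_le sqr_ge0 andbT.
by move: h2; rewrite expr0n mulr0.
Qed.
End Pattern.

(** * Tropical convexity *)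

Definition inP n (th : seq (({ffun 'I_n -> nat} * R) * ({ffun 'I_n -> nat} * R))) (l : 'I_n -> R) : Prop :=
  forall pq, pq \in th -> aff pq.1 l <= aff pq.2 l.

(** A cell imposes a sublist of a finite list of comparisons, so there are finitely many; those
    contained in [val S] are kept. A point of [val S] lies in the cell of all the comparisons that
    it satisfies, and [val_pattern] says that this cell is kept. *)
Lemma pattern_cover n (S : kvec n -> Prop) : semialgebraic S ->
  exists T : seq ({set 'I_n} * seq (({ffun 'I_n -> nat} * R) * ({ffun 'I_n -> nat} * R))),
  (forall Jt, Jt \in T -> (forall pq, pq \in Jt.2 -> forall i, i \notin Jt.1 -> pq.1.1 i = 0%N /\ pq.2.1 i = 0%N) /\
     forall l, inP Jt.2 l -> valJ S Jt.1 l) /\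
  forall J l, valJ S J l -> exists th, (J, th) \in T /\ inP th l.
Proof.
move=> sS.
have /choice[M HM] : forall J : {set 'I_n}, exists M : seq ({ffun 'I_n -> nat} * R),
  (forall p, p \in M -> forall i, i \notin J -> p.1 i = 0%N) /\
  forall l0 l, valJ S J l0 ->
    {in M &, forall p q, aff p l0 <= aff q l0 -> aff p l <= aff q l} -> valJ S J l.
  by move=> J; apply: val_pattern.
pose MM J := allpairs pair (M J) (M J).
pose all_ := flatten [seq [seq (J, mask (tval m) (MM J)) | m <- enum {: (size (MM J)).-tuple bool}] | J <- enum {set 'I_n}].
exists [seq Jt <- all_ | `[< forall l, inP Jt.2 l -> valJ S Jt.1 l >] ]; split.
  move=> Jt; rewrite mem_filter => /andP[/asboolP H /flattenP[s /mapP[J _ ->] /mapP[m _ E]]]; split=> // pq.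
  rewrite E /= => /mem_mask /allpairsP[[p q] /= [pM qM ->]] i iJ /=.
  by have [h _] := HM J; rewrite !h.
move=> J l vl; pose th := [seq pq <- MM J | aff pq.1 l <= aff pq.2 l].
exists th; split; last by move=> pq; rewrite mem_filter => /andP[].
rewrite mem_filter; apply/andP; split.
  apply/asboolP => l' Hl' /=; apply: (HM J).2 vl _ => p q pM qM h.
  by apply: (Hl' (p, q)); rewrite mem_filter h; apply: allpairs_f.
apply/flattenP; exists [seq (J, mask (tval m) (MM J)) | m <- enum {: (size (MM J)).-tuple bool}].
  by apply: map_f; rewrite mem_enum.
apply/mapP; exists (map_tuple (fun pq => aff pq.1 l <= aff pq.2 l) (in_tuple (MM J))); first by rewrite mem_enum.
by rewrite /th filter_mask.
Qed.

Definition hasvalo (x : K) (v : option R) : Prop := if v is Some l then hasval x l else x = 0.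

Lemma has_valE (x : K) v : has_val x v <-> hasvalo x v.
Proof.
case: v => [l|] /=; last exact: kiszeroP.
split=> -[h1 h2]; split.
- by apply/eqP.
- by move=> t /RltP; apply: h2.
- by apply/eqP.
- by move=> t /RltP; apply: h2.
Qed.

Definition tadd (v : option R) (c : R) : option R := if v is Some l then Some (l + c) else None.
Definition tmax (v w : option R) : option R :=
  match v, w with Some l, Some m => Some (Num.max l m) | Some l, None => Some l | None, w => w end.
Definition tle (v w : option R) : bool :=
  match v, w with Some l, Some m => l <= m | None, _ => true | Some _, None => false end.

Lemma tle_refl v : tle v v. Proof. by case: v => /=. Qed.
Lemma tle_trans : transitive tle.
Proof. by move=> [b|] [a|] [c|] //=; apply: le_trans. Qed.
Lemma tle_anti v w : tle v w -> tle w v -> v = w.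
Proof. by case: v w => [a|] [b|] //= h1 h2; congr Some; apply/le_anti; rewrite h1. Qed.
Lemma tmax_l v w : tle v (tmax v w).
Proof. by case: v w => [a|] [b|] //=; rewrite ?le_max lexx. Qed.
Lemma tmax_r v w : tle w (tmax v w).
Proof. by case: v w => [a|] [b|] //=; rewrite ?le_max lexx ?orbT. Qed.
Lemma tmax_or v w : tmax v w = v \/ tmax v w = w.
Proof. by case: v w => [a|] [b|] //=; [case: leP; [right|left]|left|right|left]. Qed.

Lemma avoid (s : seq R) : exists u, 0 < u < 1 /\ u \notin s.
Proof.
have [u0 [u01 H]] : exists u0, 0 < u0 <= 1 /\ forall u, 0 < u -> u < u0 -> u \notin s.
  elim: s => [|x s [u0 [h H]]]; first by exists 1; rewrite ltr01 lexx.
  case: (leP x 0) => x0.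
    by exists u0; split=> // u ugt ult; rewrite in_cons negb_or H // andbT gt_eqF // (le_lt_trans x0).
  exists (Num.min x u0); split; first by rewrite lt_min ge_min x0; case/andP: h => -> ->; rewrite orbT.
  move=> u ugt; rewrite lt_min => /andP[ux uu]; by rewrite in_cons negb_or H // andbT lt_eqF.
by exists (u0 / 2); split; [lra|apply: H; lra].
Qed.

(** At most one real [u] makes the leading terms of the two summands cancel. *)
Lemma val_comb (x y : K) (v w : option R) (a : R) : hasvalo x v -> hasvalo y w -> a <= 0 ->
  exists bad, forall u, 0 < u < 1 -> u != bad ->
    hasvalo ((1 - mono u a) * x + mono u a * y) (tmax v (tadd w a)).
Proof.
move=> hx hy a0.
have vlam u : vle (1 - mono u a) 0.
  by apply: vleB; [exact: vle_mono|apply: vle_le (@vle_mono u a)].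
have lamE u : (1 - mono u a) 0 = if a == 0 then 1 - u else 1.
  by rewrite kB monoE -mono1 monoE eqxx eq_sym; case: eqP => // _; rewrite subr0.
have lam0 u : 0 < u < 1 -> (1 - mono u a) 0 != 0 by rewrite lamE; case: ifP => _; lra.
have vX u l : vle x l -> vle ((1 - mono u a) * x) l by move=> h; rewrite -[l]add0r; apply: vleM.
have vY u m : vle y m -> vle (mono u a * y) (m + a).
  by move=> h; rewrite addrC; apply: vleM => //; apply: vle_mono.
have lX u l : vle x l -> ((1 - mono u a) * x) l = (1 - mono u a) 0 * x l.
  by move=> h; rewrite -[l in LHS]add0r lcM.
case: v hx => [l [xl vl]|->]; case: w hy => [m [ym vm]|->] /=.
- exists (if a == 0 then x l / (x l - y m) else - x l / y m) => u u01 ubad.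
  split; last by apply: vleD; [apply: vle_le (vX u l vl)|apply: vle_le (vY u m vm)]; rewrite le_max lexx ?orbT.
  rewrite kD mono_mul; case: (ltgtP l (m + a)) => lm.
  + by rewrite (vX u l vl) // add0r addrK mulf_neq0 // gt_eqF //; case/andP: u01.
  + rewrite lX // vm; last by lra.
    by rewrite mulr0 addr0 mulf_neq0 ?lam0.
  + rewrite lX // {2}lm addrK lamE; apply: contra ubad => /eqP.
    case: ifP => _ E; last by apply/eqP; apply: (mulIf ym); rewrite mulfVK //; lra.
    have yx : x l - y m != 0.
      apply: contra_neq xl => yx; have E' : y m = x l by lra.
      by move: E; rewrite E'; lra.
    by apply/eqP; apply: (mulIf yx); rewrite mulfVK //; lra.
- exists 0 => u u01 _; rewrite mulr0 addr0; split; last exact: vX.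
  by rewrite lX // mulf_neq0 ?lam0.
- exists 0 => u u01 u0; rewrite mulr0 add0r; split; last exact: vY.
  by rewrite mono_mul addrK mulf_neq0.
- by exists 0 => u _ _; rewrite !mulr0 addr0.
Qed.

Definition vset n (S : kvec n -> Prop) (v : 'I_n -> option R) : Prop :=
  exists x : 'I_n -> K, S (toK x) /\ forall i, hasvalo (x i) (v i).

(** As [a <= 0] and [0 < u < 1], both scalars lie between [0] and [1], with valuations [0] and [a].
    Each coordinate excludes one [u], so a common good one exists. *)
Lemma vset_comb n (S : kvec n -> Prop) v w a : kconvex S -> vset S v -> vset S w -> a <= 0 ->
  vset S (fun i => tmax (v i) (tadd (w i) a)).
Proof.
move=> cS [x [Sx hx]] [y [Sy hy]] a0.
have /choice[bad Hbad] : forall i, exists bad, forall u, 0 < u < 1 -> u != bad ->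
    hasvalo ((1 - mono u a) * x i + mono u a * y i) (tmax (v i) (tadd (w i) a)).
  by move=> i; apply: val_comb.
have [u [u01 ubad]] := avoid [seq bad i | i <- enum 'I_n].
exists (fun i => (1 - mono u a) * x i + mono u a * y i); split; last first.
  move=> i; apply: Hbad => //; apply: contra ubad => /eqP->; apply: map_f; exact: mem_enum.
have m0 : 0 <= mono u a by apply/ltW/kgt0P; exists a; rewrite monoE eqxx; split; [lra|exact: vle_mono].
have m1 : 0 <= 1 - mono u a.
  apply/ltW/kgt0P; exists 0; rewrite kB -mono1 !monoE eqxx eq_sym.
  split; first by case: eqP => _; lra.
  by apply: vleB; [exact: vle_mono|apply: vle_le (@vle_mono u a)].
have h1 : kle kzero (1 - mono u a).
  by rewrite /kle -[ksub _ _]/(kf (1 - mono u a - 0)) knonnegP subr0.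
have h2 : kle (1 - mono u a) kone.
  by rewrite /kle kone_mono -[ksub _ _]/(kf (1 - (1 - mono u a))) knonnegP opprB addrC subrK.
have := cS _ _ Sx Sy (1 - mono u a) (kfP _) h1 h2; rewrite kone_mono.
congr S; apply: functional_extensionality_dep => i.
transitivity (kf ((1 - mono u a) * x (ford i) + (1 - (1 - mono u a)) * y (ford i))); first by [].
by congr (kf (_ + _ * _)); rewrite opprB addrC subrK.
Qed.

(** Iterates [vset_comb]. The tropical combination is described as an upper bound attained in each
    coordinate, which is the form in which hull points arise. *)
Lemma vset_sup n (S : kvec n -> Prop) (L : seq (('I_n -> option R) * R)) v0 : kconvex S -> vset S v0 ->
  (forall vc, In vc L -> vset S vc.1 /\ vc.2 <= 0) ->
  forall v, (forall i, tle (v0 i) (v i)) -> (forall vc, In vc L -> forall i, tle (tadd (vc.1 i) vc.2) (v i)) ->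
  (forall i, [\/ v i = None, v i = v0 i | exists vc, In vc L /\ v i = tadd (vc.1 i) vc.2]) ->
  vset S v.
Proof.
move=> cS V0 HL v h0 hL hv.
pose f (L' : seq (('I_n -> option R) * R)) i := foldr (fun vc w => tmax w (tadd (vc.1 i) vc.2)) (v0 i) L'.
have fV : vset S (f L).
  elim: L HL {hL hv} => [|vc L IH] HL //=.
  have [V1 c1] := HL vc (or_introl erefl).
  by apply: (vset_comb cS _ V1 c1); apply: IH => vc' ?; apply: HL; right.
suff -> : v = f L by [].
apply: funext => i; apply: tle_anti; last first.
  elim: L hL {HL fV hv} => [|vc L IH] hL //=.
  have [->|->] := tmax_or (f L i) (tadd (vc.1 i) vc.2).
    by apply: IH => vc' ?; apply: hL; right.
  by apply: hL; left.
have h0' : tle (v0 i) (f L i).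
  elim: L {HL fV hv hL} => [|vc L IH] /=; first exact: tle_refl.
  exact: tle_trans IH (tmax_l _ _).
case: (hv i) => [->//|->//|[vc [vcL ->]]].
elim: L vcL {HL fV hv hL h0'} => [|vc' L IH] //= [->|/IH h].
  exact: tmax_r.
exact: tle_trans h (tmax_l _ _).
Qed.

(** * Fourier-Motzkin elimination *)

Section FourierMotzkin.
Variable V : finType.
Notation row := ({ffun V -> int} * R)%type.
Implicit Types (r : row) (L : seq row) (x : V -> R) (v : V).

Definition sat r x : Prop := \sum_v (r.1 v)%:~R * x v <= r.2.
(** Natural multipliers keep the coefficients integral, so that in the end they can serve as
    exponents. *)
Definition combine (a b : nat) r r' : row :=
  ([ffun v => r.1 v *+ a + r'.1 v *+ b], r.2 *+ a + r'.2 *+ b).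
Definition upd x v t : V -> R := fun w => if w == v then t else x w.
(** Any such invariant passes from the input rows to the output rows of the elimination. It will
    carry the signs, the zero sum and the vanishing of coefficients. *)
Definition closed_combine (Q : row -> Prop) := forall a b r r', Q r -> Q r' -> Q (combine a b r r').

Let rest v r x := \sum_(w | w != v) (r.1 w)%:~R * x w.

Let sumE v r x : \sum_w (r.1 w)%:~R * x w = (r.1 v)%:~R * x v + rest v r x.
Proof. by rewrite (bigD1 v). Qed.

Let sat_upd r x v t : sat r (upd x v t) <-> (r.1 v)%:~R * t + rest v r x <= r.2.
Proof.
rewrite /sat (sumE v) /upd eqxx (_ : rest v r _ = rest v r x) //.
by apply: eq_bigr => w /negPf->.
Qed.

Lemma between (Ls Us : seq R) : (forall l u, l \in Ls -> u \in Us -> l <= u) ->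
  exists t, (forall l, l \in Ls -> l <= t) /\ (forall u, u \in Us -> t <= u).
Proof.
case: Ls => [_|l0 Ls H].
  case: Us => [|u0 Us]; first by exists 0.
  have /seq_max[m [_ Hm]] : - u0 \in [seq - u | u <- u0 :: Us] by apply: map_f; rewrite mem_head.
  by exists (- m); split=> // u hu; rewrite lerNl; apply: Hm; apply: map_f.
have /seq_max[m [hm Hm]] : l0 \in l0 :: Ls by rewrite mem_head.
by exists m; split=> // u hu; apply: H.
Qed.

Lemma eliminate1 L v : exists L',
  [/\ forall r, r \in L' -> r.1 v = 0,
      forall Q, closed_combine Q -> (forall r, r \in L -> Q r) -> forall r, r \in L' -> Q r &
      forall x, (forall r, r \in L' -> sat r x) <-> exists t, forall r, r \in L -> sat r (upd x v t)].
Proof.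
pose Z := [seq r : row <- L | r.1 v == 0].
pose Po := [seq r : row <- L | 0 < r.1 v].
pose Ne := [seq r : row <- L | r.1 v < 0].
pose cb r r' := combine `|r'.1 v|%N `|r.1 v|%N r r'.
exists (Z ++ [seq cb r r' | r <- Po, r' <- Ne]).
have absP r : 0 < r.1 v -> (`|r.1 v|%N : int) = r.1 v by move=> h; rewrite gtz0_abs.
have absN r : r.1 v < 0 -> (`|r.1 v|%N : int) = - r.1 v by move=> h; rewrite ltz0_abs.
have natI (k : nat) : k%:R = ((k : int)%:~R : R) by rewrite pmulrn.
split.
- move=> r; rewrite mem_cat => /orP[|/allpairsP[[p q] /= [pP qN ->]]].
    by rewrite mem_filter => /andP[/eqP].
  move: pP qN; rewrite !mem_filter => /andP[pP _] /andP[qN _]; rewrite ffunE.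
  rewrite -[_ *+ `|q.1 v|]mulr_natr -[_ *+ `|p.1 v|]mulr_natr !natz (absP p) // (absN q) //; ring.
- move=> Q cQ HQ r; rewrite mem_cat => /orP[|/allpairsP[[p q] /= [pP qN ->]]].
    by rewrite mem_filter => /andP[_]; apply: HQ.
  by move: pP qN; rewrite !mem_filter => /andP[_ pL] /andP[_ qL]; apply: cQ; apply: HQ.
move=> x.
have rest_cb p q : rest v (cb p q) x = rest v p x *+ `|q.1 v| + rest v q x *+ `|p.1 v|.
  rewrite /rest -!sumrMnl -big_split /=; apply: eq_bigr => w _.
  rewrite ffunE rmorphD /= !rmorphMn /= mulrDl -!mulrnAl //.
split=> [H|[t Ht] r].
- have [|t [Hl Hu]] := @between [seq (r.2 - rest v r x) / (r.1 v)%:~R | r <- Ne] [seq (r.2 - rest v r x) / (r.1 v)%:~R | r <- Po].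
    move=> l u /mapP[q qN ->] /mapP[p pP ->].
    have := H (cb p q); rewrite mem_cat allpairs_f ?orbT // => /(_ isT).
    move: pP qN; rewrite !mem_filter => /andP[pP _] /andP[qN _].
    rewrite /sat (sumE v) rest_cb ffunE.
    rewrite -[_ *+ `|q.1 v| in X in X + _]mulr_natr -[_ *+ `|p.1 v| in X in X + _]mulr_natr !natz (absP p) // (absN q) //.
    rewrite (_ : _ * - _ + _ = 0) ?mul0r ?add0r; last by ring.
    rewrite /= -[rest v p x *+ _]mulr_natr -[rest v q x *+ _]mulr_natr -[p.2 *+ _]mulr_natr -[q.2 *+ _]mulr_natr !natI (absP p) // (absN q) // rmorphN /=.
    have pR : 0 < (p.1 v)%:~R :> R by rewrite ltr0z.
    have qR : (q.1 v)%:~R < 0 :> R by rewrite ltrz0.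
    move=> h; rewrite ler_ndivrMr // mulrAC ler_pdivrMr //.
    by move: (rest v p x) (rest v q x) h => a b h; lra.
  exists t => r rL; apply/sat_upd; case: (ltgtP (r.1 v) 0) => rv.
  + have rR : (r.1 v)%:~R < 0 :> R by rewrite ltrz0.
    have rN : r \in Ne by rewrite mem_filter rv.
    have := Hl _ (map_f (fun r : row => (r.2 - rest v r x) / (r.1 v)%:~R) rN); rewrite ler_ndivrMr //; lra.
  + have rR : 0 < (r.1 v)%:~R :> R by rewrite ltr0z.
    have rP : r \in Po by rewrite mem_filter rv.
    have := Hu _ (map_f (fun r : row => (r.2 - rest v r x) / (r.1 v)%:~R) rP); rewrite ler_pdivlMr //; lra.
  + have := H r; rewrite mem_cat mem_filter rv eqxx rL /= => /(_ isT).
    by rewrite /sat (sumE v) rv !mul0r.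
- rewrite mem_cat => /orP[|/allpairsP[[p q] /= [pP qN ->]]].
    rewrite mem_filter => /andP[/eqP r0 rL]; have /sat_upd := Ht r rL.
    by rewrite /sat (sumE v) r0 !mul0r.
  move: pP qN; rewrite !mem_filter => /andP[pP pL] /andP[qN qL].
  rewrite /sat (sumE v) rest_cb ffunE.
  rewrite -[_ *+ `|q.1 v| in X in X + _]mulr_natr -[_ *+ `|p.1 v| in X in X + _]mulr_natr !natz (absP p) // (absN q) //.
  rewrite (_ : _ * - _ + _ = 0) ?mul0r ?add0r; last by ring.
  rewrite /= -[rest v p x *+ _]mulr_natr -[rest v q x *+ _]mulr_natr -[p.2 *+ _]mulr_natr -[q.2 *+ _]mulr_natr !natI (absP p) // (absN q) // rmorphN /=.
  have /sat_upd h1 := Ht p pL; have /sat_upd h2 := Ht q qL.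
  have pR : 0 < (p.1 v)%:~R :> R by rewrite ltr0z.
  have qR : (q.1 v)%:~R < 0 :> R by rewrite ltrz0.
  have nq : 0 <= - (q.1 v)%:~R :> R by lra.
  have := lerD (ler_wpM2r nq h1) (ler_wpM2r (ltW pR) h2).
  by rewrite !mulrDl; move: (rest v p x) (rest v q x) => a b; lra.
Qed.

Lemma eliminate L (vs : seq V) : exists L',
  [/\ forall r, r \in L' -> forall v, v \in vs -> r.1 v = 0,
      forall Q, closed_combine Q -> (forall r, r \in L -> Q r) -> forall r, r \in L' -> Q r &
      forall x, (forall r, r \in L' -> sat r x) <->
        exists y, (forall w, w \notin vs -> y w = x w) /\ forall r, r \in L -> sat r y].
Proof.
elim: vs => [|v vs [L1 [H1 H2 H3]]].
  exists L; split=> // x; split=> [h|[y [E h]] r rL]; first by exists x.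
  by have := h r rL; rewrite (_ : y = x) //; apply: funext => w; apply: E.
have [L2 [G1 G2 G3]] := eliminate1 L1 v; exists L2; split.
- move=> r rL w; rewrite in_cons => /orP[/eqP->|wvs]; first exact: G1.
  (* Vanishing at [w] is itself stable under [combine], so variables eliminated earlier do not come
     back. *)
  apply: (G2 (fun r => r.1 w = 0)) => // [a b r1 r2 E1 E2|r1 r1L].
    by rewrite ffunE E1 E2 !mul0rn.
  exact: H1.
- by move=> Q cQ HQ; apply: G2 => //; apply: H2.
move=> x; rewrite G3; split=> [[t /H3[y [E h]]]|[y [E h]]].
  exists y; split=> // w; rewrite in_cons negb_or => /andP[wv wvs].
  by rewrite E // /upd (negPf wv).
exists (y v); apply/H3.
case: (boolP (v \in vs)) => vvs.
  exists y; split=> // w wvs; rewrite /upd; case: eqP => [->//|/eqP wv].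
  by apply: E; rewrite in_cons negb_or wv.
exists y; split=> // w wvs; rewrite /upd; case: eqP => [->//|/eqP wv].
by apply: E; rewrite in_cons negb_or wv.
Qed.
End FourierMotzkin.

(** * Tropical hulls of polyhedra *)

Section Hull.
Variables (n : nat) (J : {set 'I_n}) (th : seq (({ffun 'I_n -> nat} * R) * ({ffun 'I_n -> nat} * R))).
Notation I := (option 'I_n).
Hypothesis thJ : forall pq, pq \in th -> forall i, i \notin J -> pq.1.1 i = 0%N /\ pq.2.1 i = 0%N.

(** The coordinate [None] homogenises: [p : I -> R] stands for the point [p (Some j) - p None]. *)
Definition act (i : I) : bool := if i is Some j then j \in J else true.
Definition dehom (p : I -> R) : 'I_n -> R := fun j => p (Some j) - p None.

(** [inl] indexes the outer point [x], [inr] the point [p] of the cell, which is to be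
    eliminated. *)
Let V : finType := (I + I)%type.
Let dlt (v w : V) : int := (v == w)%:R.
Let dcoef (pq : ({ffun 'I_n -> nat} * R) * ({ffun 'I_n -> nat} * R)) (j : 'I_n) : int := (pq.1.1 j)%:Z - (pq.2.1 j)%:Z.
(** Since [dehom] subtracts [p None] from every coordinate, the coefficient at [inr None] is minus
    the sum of the others, and the row has zero sum. *)
Let rowA pq : {ffun V -> int} * R :=
  ([ffun v => match v with inr (Some j) => dcoef pq j | inr None => - \sum_j dcoef pq j | inl _ => 0 end], pq.2.2 - pq.1.2).
Let rowD (v w : V) : {ffun V -> int} * R := ([ffun u => dlt u v - dlt u w], 0).

Let sum_dlt (x : V -> R) (v : V) : \sum_u (dlt u v)%:~R * x u = x v.
Proof.
rewrite (bigD1 v) //= big1 ?addr0; first by rewrite /dlt eqxx mul1r.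
by move=> u /negPf uv; rewrite /dlt uv mul0r.
Qed.
Let sum_dlt1 (v : V) : \sum_u dlt u v = 1.
Proof.
rewrite (bigD1 v) //= big1 ?addr0; first by rewrite /dlt eqxx.
by move=> u /negPf uv; rewrite /dlt uv.
Qed.
Let sat_rowD v w x : sat (rowD v w) x <-> x v <= x w.
Proof.
rewrite /sat /rowD /= -[x v <= _]subr_le0 -[x v]sum_dlt -[x w]sum_dlt -sumrB.
by under eq_bigr => u _ do rewrite ffunE rmorphB /= mulrBl.
Qed.
Let big_opt (W : zmodType) (F : I -> W) : \sum_i F i = F None + \sum_j F (Some j).
Proof.
rewrite (bigD1 None) //=; congr (_ + _).
rewrite (reindex_omap Some id) /=; last by case.
by apply: eq_bigl => j; rewrite eqxx.
Qed.
Let sat_rowA pq x : sat (rowA pq) x <-> aff pq.1 (dehom (x \o inr)) <= aff pq.2 (dehom (x \o inr)).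
Proof.
rewrite /sat big_sumType /= big1 ?add0r; last by move=> i _; rewrite ffunE mul0r.
rewrite big_opt /= ffunE /aff.
have -> : \sum_j ((rowA pq).1 (inr (Some j)))%:~R * x (inr (Some j)) =
   \sum_j (dcoef pq j)%:~R * x (inr (Some j)) by apply: eq_bigr => j _; rewrite ffunE.
rewrite rmorphN /= mulNr rmorph_sum /= mulr_suml -sumrN -big_split /=.
have -> : \sum_j (- ((dcoef pq j)%:~R * x (inr None)) + (dcoef pq j)%:~R * x (inr (Some j))) =
  \sum_j (pq.1.1 j)%:R * dehom (x \o inr) j - \sum_j (pq.2.1 j)%:R * dehom (x \o inr) j.
  rewrite -sumrB; apply: eq_bigr => j _; rewrite /dcoef /dehom rmorphB /= -!pmulrn; ring.
by split; lra.
Qed.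

(** Elimination of [p] only takes nonnegative combinations of the inequalities [p i <= x i],
    [x k <= p k] and of homogeneous inequalities in [p]: this gives the signs and the zero sum. *)
Lemma hull_rows k : act k -> exists G : seq ({ffun I -> int} * R),
  (forall r, r \in G -> [/\ \sum_i r.1 i = 0, (forall i, ~~ act i -> r.1 i = 0) & forall i, i != k -> r.1 i <= 0]) /\
  forall x, (forall r, r \in G -> sat r x) <->
    exists p, [/\ inP th (dehom p), forall i, act i -> p i <= x i & p k = x k].
Proof.
move=> ak.
pose L := [seq rowA pq | pq <- th] ++ [seq rowD (inr i) (inl i) | i <- enum {: I} & act i] ++ [:: rowD (inl k) (inr k)].
have [L' [H1 H2 H3]] := eliminate L [seq (inr i : V) | i <- enum {: I}].
have inr_in i : (inr i : V) \in [seq (inr i : V) | i <- enum {: I}] by apply: map_f; rewrite mem_enum.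
have inl_in i : (inl i : V) \notin [seq (inr i : V) | i <- enum {: I}] by apply/mapP => -[].
pose Q (r : {ffun V -> int} * R) := [/\ \sum_v r.1 v = 0, (forall i, ~~ act i -> r.1 (inl i) = 0 /\ r.1 (inr i) = 0)
   & forall i, i != k -> r.1 (inl i) <= 0].
have QL' r : r \in L' -> Q r.
  apply: H2 => [a b r1 r2 [E1 F1 N1] [E2 F2 N2]|{}r].
    split.
    - under eq_bigr do rewrite ffunE; rewrite big_split /= !sumrMnl E1 E2 !mul0rn //.
    - by move=> i ia; rewrite !ffunE (F1 i ia).1 (F1 i ia).2 (F2 i ia).1 (F2 i ia).2 !mul0rn.
    - by move=> i ik; rewrite ffunE; have := N1 i ik; have := N2 i ik => h1 h2; rewrite -oppr_ge0 opprD addr_ge0 // oppr_ge0 mulrn_wle0.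
  rewrite !mem_cat => /orP[/mapP[pq pqt ->]|/orP[/mapP[i]|]].
  - split.
    + rewrite big_sumType /= big1 ?add0r; last by move=> i _; rewrite ffunE.
      by rewrite big_opt /= ffunE; under [X in _ + X]eq_bigr do rewrite ffunE; rewrite addNr.
    + move=> [j|] //= ja; rewrite !ffunE; split=> //.
      by have [h1 h2] := thJ pqt ja; rewrite /dcoef h1 h2.
    + by move=> i _; rewrite ffunE.
  - rewrite mem_filter => /andP[ia _] ->; split.
    + under eq_bigr do rewrite ffunE; rewrite sumrB /dlt.
      by rewrite !sum_dlt1 subrr.
    + move=> i' i'a; rewrite !ffunE /dlt /= !(inj_eq (@inr_inj _ _)) !(inj_eq (@inl_inj _ _)).
      by case: eqP => [E|]; [rewrite E ia in i'a|].
    + by move=> i' _; rewrite ffunE /dlt /= sub0r oppr_le0 ler0n.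
  - rewrite mem_seq1 => /eqP ->; split.
    + under eq_bigr do rewrite ffunE; rewrite sumrB /dlt.
      by rewrite !sum_dlt1 subrr.
    + move=> i' i'a; rewrite !ffunE /dlt /= !(inj_eq (@inr_inj _ _)) !(inj_eq (@inl_inj _ _)).
      by case: eqP => [E|]; [rewrite E ak in i'a|].
    + by move=> i' /negPf i'k; rewrite ffunE /dlt /= (inj_eq (@inl_inj _ _)) i'k subr0.
exists [seq ([ffun i => r.1 (inl i)], r.2) | r : {ffun V -> int} * R <- L']; split.
  move=> r /mapP[r' r'L ->] /=; have [E F N] := QL' r' r'L; split.
  - move: E; rewrite big_sumType /= [X in _ + X]big1 ?addr0; last by move=> i _; apply: H1.
    by move=> E; rewrite -[RHS]E; apply: eq_bigr => i _; rewrite ffunE.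
  - by move=> i /F[h _]; rewrite ffunE.
  - by move=> i /N h; rewrite ffunE.
move=> x; pose z (v : V) : R := match v with inl i => x i | inr _ => 0 end.
have satE r : r \in L' -> sat ([ffun i => r.1 (inl i)], r.2) x <-> sat r z.
  move=> rL; rewrite /sat big_sumType /= [X in _ <-> _ + X <= _]big1 ?addr0; last first.
    by move=> i _; rewrite mulr0.
  by under eq_bigr do rewrite ffunE.
have -> : (forall r, r \in [seq ([ffun i => r.1 (inl i)], r.2) | r : {ffun V -> int} * R <- L'] -> sat r x) <->
   forall r, r \in L' -> sat r z.
  split=> [h r rL|h r /mapP[r' rL ->]]; last by apply/satE/h.
  by apply/satE => //; apply: h; apply/mapP; exists r.
rewrite H3; split=> [[y [E h]]|[p [hp hl hk]]].
  exists (y \o inr); split.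
  - by move=> pq pqt; apply/sat_rowA; apply: h; rewrite mem_cat map_f.
  - move=> i ia; rewrite /= -[x i]/(z (inl i)) -E //; apply/sat_rowD; apply: h.
    by rewrite !mem_cat; apply/orP; right; apply/orP; left; apply/mapP; exists i => //; rewrite mem_filter ia mem_enum.
  - rewrite -[RHS]/(z (inl k)) -E //; apply/le_anti/andP; split; apply/sat_rowD; apply: h.
      by rewrite !mem_cat; apply/orP; right; apply/orP; left; apply/mapP; exists k => //; rewrite mem_filter ak mem_enum.
    by rewrite !mem_cat mem_seq1 eqxx !orbT.
exists (fun v => match v with inl i => x i | inr i => p i end); split.
  by move=> [i _|i]; rewrite ?inr_in.
move=> r; rewrite !mem_cat => /orP[/mapP[pq pqt ->]|/orP[/mapP[i]|]].
- by apply/sat_rowA; apply: hp.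
- by rewrite mem_filter => /andP[ia _] ->; apply/sat_rowD; apply: hl.
- by rewrite mem_seq1 => /eqP ->; apply/sat_rowD; rewrite hk.
Qed.

(** With zero sum and nonpositive coefficients off [k], a row bounds [w x_k] by a sum of [w]
    coordinates and a constant. Adding [2^w - w] copies of [x_k] to both sides makes the number of
    terms a power of two, as the binary tree of 2x2 blocks requires. Indices are listed with
    multiplicity. *)
Lemma hull_geom k : act k -> exists G : seq (seq I * R),
  (forall lc, lc \in G -> all act lc.1 /\ exists q, size lc.1 = (2 ^ q)%N) /\
  forall x, (forall lc, lc \in G -> (size lc.1)%:R * x k <= lc.2 + \sum_(i <- lc.1) x i) <->
    exists p, [/\ inP th (dehom p), forall i, act i -> p i <= x i & p k = x k].
Proof.
move=> ak; have [G [HG HGx]] := hull_rows ak.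
pose lv (r : {ffun I -> int} * R) := flatten [seq nseq `|r.1 i|%N i | i <- enum {: I} & i != k] ++ nseq (2 ^ `|r.1 k| - `|r.1 k|) k.
have lv_sum (W : nmodType) r (F : I -> W) : \sum_(i <- lv r) F i =
   \sum_(i | i != k) F i *+ `|r.1 i| + F k *+ (2 ^ `|r.1 k| - `|r.1 k|).
  rewrite big_cat /= big_nseq iter_addr_0; congr (_ + _).
  rewrite big_flatten /= big_map big_filter big_enum_cond /=.
  by apply: eq_bigr => i _; rewrite big_nseq iter_addr_0.
have rk r : r \in G -> (`|r.1 k|%N = \sum_(i | i != k) `|r.1 i|%N)%N.
  move=> rG; have [E _ N] := HG r rG.
  have Ek : r.1 k = \sum_(i | i != k) `|r.1 i|%:Z.
    move: E; rewrite (bigD1 k) //= => /eqP; rewrite addr_eq0 => /eqP ->; rewrite -sumrN.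
    by apply: eq_bigr => i ik; rewrite lez0_abs // N.
  apply/eqP; rewrite -eqz_nat gez0_abs; last by rewrite Ek sumr_ge0.
  by rewrite Ek -(@rmorph_sum _ _ Posz) //.
have lt2 (r : {ffun I -> int} * R) : (`|r.1 k| <= 2 ^ `|r.1 k|)%N by apply/ltnW/ltn_expl.
have lsz r : r \in G -> size (lv r) = (2 ^ `|r.1 k|)%N.
  move=> rG; have := lv_sum nat r (fun _ => 1%N).
  rewrite sum1_size => ->; rewrite -[RHS](subnKC (lt2 r)) {3}(rk r rG) natn; congr (_ + _)%N.
  by apply: eq_bigr => i _; rewrite natn.
have absk r : r \in G -> (r.1 k)%:~R = `|r.1 k|%N%:R :> R.
  move=> rG; have [E _ N] := HG r rG; rewrite pmulrn gez0_abs //.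
  move: E; rewrite (bigD1 k) //= => /eqP; rewrite addr_eq0 => /eqP ->; rewrite -sumrN sumr_ge0 // => i ik.
  by rewrite oppr_ge0 N.
have absi r i : r \in G -> i != k -> (r.1 i)%:~R = - `|r.1 i|%N%:R :> R.
  by move=> rG ik; have [_ _ N] := HG r rG; rewrite pmulrn lez0_abs ?N // rmorphN opprK.
exists [seq (lv r, r.2) | r <- G]; split.
  move=> lc /mapP[r rG ->] /=; split; last by exists `|r.1 k|%N; apply: lsz.
  rewrite all_cat; apply/andP; split.
    apply/allP => i /flattenP[s /mapP[j _ ->]] /nseqP[->].
    by have [_ F _] := HG r rG; apply: contraLR => /F ->.
  by apply/allP => i /nseqP[->].
move=> x; rewrite -HGx.
have E r : r \in G -> ((size (lv r))%:R * x k <= r.2 + \sum_(i <- lv r) x i) <-> sat r x.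
  move=> rG; have SE : \sum_i (r.1 i)%:~R * x i = x k *+ `|r.1 k| - \sum_(i | i != k) x i *+ `|r.1 i|.
    rewrite (bigD1 k) //= absk // mulr_natl -sumrN; congr (_ + _).
    by apply: eq_bigr => i ik; rewrite absi // mulNr mulr_natl.
  by rewrite lsz // lv_sum /sat SE mulrnBr ?lt2 // mulr_natl; split; lra.
split=> [h r rG|h lc /mapP[r rG ->]].
  by apply/E => //; apply: (h (lv r, r.2)); apply: map_f.
by apply/E => //; apply: h.
Qed.
End Hull.

(** * Lifting tropical cones to nonnegative series *)

Lemma mono_gt0 c l : 0 < c -> 0 < mono c l.
Proof. by move=> c0; apply/kgt0P; exists l; rewrite monoE eqxx; split=> //; apply: vle_mono. Qed.

Lemma mono_le a b : a <= b -> mono 1 a <= mono 1 b.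
Proof.
rewrite le_eqVlt => /orP[/eqP->//|ab]; rewrite -subr_ge0 ltW //; apply/kgt0P; exists b.
rewrite kB !monoE eqxx gt_eqF // subr0; split; first exact: ltr01.
by apply: vleB; [exact: vle_mono|apply: vle_le (@vle_mono 1 a); exact: ltW].
Qed.

Lemma le_val (A B : K) a b : vle A a -> 0 < A a -> vle B b -> A <= B -> a <= b.
Proof.
move=> vA A0 vB; rewrite -subr_ge0; apply: contraTT; rewrite -!ltNge => ba.
rewrite -oppr_gt0 opprB; apply/kgt0P; exists a; rewrite kB vB // subr0; split=> //.
by apply: vleB => //; apply: vle_le vB; exact: ltW.
Qed.

Lemma lc_gt0 (x : K) l : 0 <= x -> hasval x l -> 0 < x l.
Proof.
move=> x0 [xl vl]; rewrite -(kgt0_lc vl xl) lt_def x0 andbT; exact: lead_neq0 xl.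
Qed.

Section Cone.
Variables (n : nat) (J : {set 'I_n}) (th : seq (({ffun 'I_n -> nat} * R) * ({ffun 'I_n -> nat} * R))).
Notation I := (option 'I_n).
Variable G : I -> seq (seq I * R).
Hypothesis Gact : forall k, act J k -> forall lc, lc \in G k -> all (act J) lc.1 /\ exists q, size lc.1 = (2 ^ q)%N.
Hypothesis Gx : forall k, act J k -> forall x,
  (forall lc, lc \in G k -> (size lc.1)%:R * x k <= lc.2 + \sum_(i <- lc.1) x i) <->
  exists p, [/\ inP th (dehom p), forall i, act J i -> p i <= x i & p k = x k].

(** The third condition, where [u] is a slack variable, forces the coordinates in [act J] to be
    all zero or all nonzero. *)
Definition inW (X : I -> K) : Prop :=
  [/\ forall i, 0 <= X i, forall i, ~~ act J i -> X i = 0,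
      forall j l, act J j -> act J l -> exists u, 0 <= u /\ X j ^+ 2 <= X l * u &
      forall k, act J k -> forall lc, lc \in G k -> X k ^+ (size lc.1) <= mono 1 lc.2 * \prod_(i <- lc.1) X i].

Lemma inW0 : inW (fun _ => 0).
Proof.
split=> //; first by move=> j l _ _; exists 0; rewrite expr0n mulr0.
move=> k kJ lc /(Gact kJ)[_ [q sq]]; rewrite expr0n sq expn_eq0 /= mulr_ge0 ?prodr_ge0 //.
by apply/ltW/mono_gt0.
Qed.

(** The slack condition makes all active coordinates nonzero, so each has a valuation. In a power
    inequality the left side is positive with known leading term, and an upper bound for the
    valuation of the right side suffices. *)
Lemma inW_val X : inW X -> (exists j, X j != 0) -> exists x : I -> R,
  (forall i, act J i -> hasval (X i) (x i)) /\
  forall k, act J k -> exists p, [/\ inP th (dehom p), forall i, act J i -> p i <= x i & p k = x k].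
Proof.
move=> [X0 Xoff Xall XG] [j Xj].
have jJ : act J j by apply: contraNT Xj => /Xoff ->.
have Xn l : act J l -> X l != 0.
  move=> lJ; have [u [_ h]] := Xall j l jJ lJ; apply: contra Xj => /eqP Xl.
  by rewrite -sqrf_eq0 eq_le sqr_ge0 andbT -(mul0r u) -Xl.
exists (kval \o X); split=> [i iJ|k kJ]; first by apply/kvalP/Xn.
apply/Gx => // lc lcG.
have hk := kvalP (Xn k kJ); have kp := lc_gt0 (X0 k) hk.
have h := XG k kJ lc lcG.
have vX i : vle (X i) ((kval \o X) i).
  by case: (eqVneq (X i) 0) => [->|/kvalP[]]; first exact: vle0.
have [vB _] := @vle_prod _ lc.1 X (kval \o X) vX.
have vA := @vleX _ _ (size lc.1) hk.2; have vC := vleM (@vle_mono 1 lc.2) vB.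
have A0 : 0 < (X k ^+ size lc.1) (kval (X k) *+ size lc.1) by rewrite lcX ?exprn_gt0 //; exact: hk.2.
by rewrite mulr_natl; exact: le_val vA A0 vC h.
Qed.

(** Only points of the cell itself need a lift, with homogenising coordinate [1]. Such a point is
    its own witness [p] for every [k], and with coefficients [1] tropical inequalities become
    inequalities between monomials. *)
Lemma inW_mono l : inP th l -> inW (fun i => match i with Some j => if j \in J then mono 1 (l j) else 0 | None => mono 1 0 end).
Proof.
move=> lth; set X := (fun i : I => _).
pose x (i : I) : R := if i is Some j then l j else 0.
have XE i : act J i -> X i = mono 1 (x i) by case: i => [j|] //= ->.
have Xp i : act J i -> 0 < X i by move=> /XE ->; apply: mono_gt0.
have Xoff i : ~~ act J i -> X i = 0 by case: i => [j|] //= /negPf ->.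
split=> //.
- by move=> i; case: (boolP (act J i)) => [/Xp/ltW|/Xoff->].
- move=> j i jJ iJ; exists ((X i)^-1 * X j ^+ 2); rewrite mulVKf ?gt_eqF ?Xp //; split=> //.
  by rewrite mulr_ge0 ?invr_ge0 ?sqr_ge0 // ltW // Xp.
move=> k kJ lc lcG.
have H : exists p, [/\ inP th (dehom p), forall i, act J i -> p i <= x i & p k = x k].
  exists x; split=> // pq pqt.
  suff -> : dehom x = l by apply: lth.
  by apply: funext => j; rewrite /dehom subr0.
have {H} := (Gx kJ x).2 H lc lcG; rewrite mulr_natl => H.
have [/allP aG _] := Gact kJ lcG.
rewrite big_seq (eq_bigr (fun i => mono 1 (x i))) -?big_seq; last by move=> i /aG/XE.
by rewrite XE // monoX expr1n mono_prod big1 // monoM mulr1 mono_le.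
Qed.
End Cone.

(** At the largest exponent all coefficients are nonnegative and one is positive, so they cannot
    cancel: nonnegativity turns sums into maxima. *)
Lemma hasval_sum (T : finType) (P : pred T) (Y : T -> K) (y : T -> R) (L : R) (t0 : T) :
  (forall t, 0 <= Y t) -> (forall t, P t -> hasval (Y t) (y t)) -> (forall t, ~~ P t -> Y t = 0) ->
  P t0 -> y t0 = L -> (forall t, P t -> y t <= L) -> hasval (\sum_t Y t) L.
Proof.
move=> Y0 Yv Yn Pt0 <- yL.
have vY t : vle (Y t) (y t0).
  by case: (boolP (P t)) => [Pt|/Yn->]; [apply: vle_le (yL t Pt) (Yv t Pt).2|exact: vle0].
have cY t : 0 <= Y t (y t0).
  case: (boolP (P t)) => [Pt|/Yn->] //; have h := lc_gt0 (Y0 t) (Yv t Pt).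
  case: (ltgtP (y t) (y t0)) (yL t Pt) => [lt _|//|<- _]; last exact: ltW.
  by rewrite (Yv t Pt).2.
split; last exact: vle_sum.
rewrite k_sum (bigD1 t0) //= gt_eqF // ltr_pwDl ?sumr_ge0 //.
exact: lc_gt0 (Y0 t0) (Yv t0 Pt0).
Qed.

Lemma hasvalo_uniq x v w : hasvalo x v -> hasvalo x w -> v = w.
Proof.
case: v w => [l|] [m|] //=.
- by move=> [xl vl] [xm vm]; congr Some; case: (ltgtP l m) => // [/vl|/vm] E; [case/eqP: xm|case/eqP: xl].
- by move=> [xl _] E; rewrite E eqxx in xl.
- by move=> -> []; rewrite eqxx.
Qed.

Lemma max_attained (T : finType) (P : pred T) (y : T -> R) t0 : P t0 ->
  exists t, P t /\ forall t', P t' -> y t' <= y t.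
Proof.
move=> P0; have /seq_max[L [/mapP[t tP ->] HL]] : y t0 \in [seq y t | t <- enum P] by apply: map_f; rewrite mem_enum.
exists t; split; first by rewrite mem_enum in tP.
by move=> t' Pt'; apply: HL; apply: map_f; rewrite mem_enum.
Qed.

(** * The valuation of the sum of the lifted cones *)

Definition inSum m n (J : 'I_m -> {set 'I_n}) (G : 'I_m -> option 'I_n -> seq (seq (option 'I_n) * R)) (X : 'I_n -> K) : Prop :=
  exists Y : 'I_m -> option 'I_n -> K,
   [/\ forall t, inW (J t) (G t) (Y t), \sum_t Y t None = 1 & forall j, \sum_t Y t (Some j) = X j].

Lemma vset_sum n (S : kvec n -> Prop) : semialgebraic S -> kconvex S ->
  exists m (J : 'I_m -> {set 'I_n}) (G : 'I_m -> option 'I_n -> seq (seq (option 'I_n) * R)),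
   (forall t k lc, act (J t) k -> lc \in G t k -> exists q, size lc.1 = (2 ^ q)%N) /\
   forall v, vset S v <-> exists X, inSum J G X /\ forall j, hasvalo (X j) (v j).
Proof.
move=> sS cS; have [T [HT1 HT2]] := pattern_cover sS.
pose dflt : {set 'I_n} * seq (({ffun 'I_n -> nat} * R) * ({ffun 'I_n -> nat} * R)) := (set0, [::]).
pose m := size T.
pose J (t : 'I_m) := (nth dflt T t).1.
pose th (t : 'I_m) := (nth dflt T t).2.
have tT (t : 'I_m) : nth dflt T t \in T by apply: mem_nth.
have /choice[G0 HG] : forall tk : 'I_m * option 'I_n, exists G : seq (seq (option 'I_n) * R), act (J tk.1) tk.2 ->
  (forall lc, lc \in G -> all (act (J tk.1)) lc.1 /\ exists q, size lc.1 = (2 ^ q)%N) /\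
  forall x, (forall lc, lc \in G -> (size lc.1)%:R * x tk.2 <= lc.2 + \sum_(i <- lc.1) x i) <->
    exists p, [/\ inP (th tk.1) (dehom p), forall i, act (J tk.1) i -> p i <= x i & p tk.2 = x tk.2].
  move=> [t k] /=; case: (boolP (act (J t) k)) => [kJ|_]; last by exists [::].
  by have [G H] := hull_geom (HT1 _ (tT t)).1 kJ; exists G.
pose G t k := G0 (t, k).
have G1 t k : act (J t) k -> forall lc, lc \in G t k -> all (act (J t)) lc.1 /\ exists q, size lc.1 = (2 ^ q)%N.
  by move=> kJ; have [] := HG (t, k) kJ.
have G2 t k : act (J t) k -> forall x, (forall lc, lc \in G t k -> (size lc.1)%:R * x k <= lc.2 + \sum_(i <- lc.1) x i) <->
    exists p, [/\ inP (th t) (dehom p), forall i, act (J t) i -> p i <= x i & p k = x k].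
  by move=> kJ; have [] := HG (t, k) kJ.
exists m, J, G; split; first by move=> t k lc kJ /(G1 t k kJ)[].
move=> v; split=> [[x [Sx hx]]|[X [[Y [YW Y1 YX]] hX]]].
  (* One cell containing the point is enough: its summand is the monomial lift, and all other
     summands are zero. *)
  pose A := [set j | v j != None]; pose l j := odflt 0 (v j).
  have [th' [thT lth]] : exists th, (A, th) \in T /\ inP th l.
    apply: HT2; exists x; split=> // i; rewrite inE /l; have := hx i.
    by case: (v i).
  have iT : (index (A, th') T < m)%N by rewrite index_mem.
  pose t0 := Ordinal iT.
  have Et : nth dflt T t0 = (A, th') by rewrite nth_index.
  have Jt : J t0 = A by rewrite /J Et.
  have tht : th t0 = th' by rewrite /th Et.
  pose X0 (i : option 'I_n) := match i with Some j => if j \in J t0 then mono 1 (l j) else 0 | None => mono 1 0 end.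
  exists (fun j => X0 (Some j)); split.
    exists (fun t => if t == t0 then X0 else fun _ => 0); split.
    - move=> t; case: eqP => [->|_].
        by apply: inW_mono (G1 t0) (G2 t0) _ _; rewrite tht.
      exact: inW0 (G1 t).
    - rewrite (bigD1 t0) //= eqxx big1 ?addr0 // => t /negPf->.
      by [].
    - by move=> j; rewrite (bigD1 t0) //= eqxx big1 ?addr0 // => t /negPf->.
  move=> j; rewrite /X0 Jt inE /l; case: (v j) => [a|] //=.
  by split; [rewrite monoE eqxx oner_eq0|exact: vle_mono].
(* A summand with zero homogenising coordinate vanishes altogether by the slack condition, so only
   those in [P] contribute. *)
pose P t := Y t None != 0.
have Y0 t i : 0 <= Y t i by have [] := YW t.
have Yoff t i : ~~ (P t && act (J t) i) -> Y t i = 0.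
  rewrite negb_and; case: (boolP (act (J t) i)) => [iJ|iJ _]; last by have [_ ->] := YW t.
  rewrite orbF negbK => /eqP Y00; have [_ _ H _] := YW t.
  have [u [_]] := H i None iJ isT; rewrite Y00 mul0r => h.
  by apply/eqP; rewrite -sqrf_eq0 eq_le sqr_ge0 andbT.
have /choice[x Hx] : forall t, exists x : option 'I_n -> R, P t -> (forall i, act (J t) i -> hasval (Y t i) (x i)) /\
  forall k, act (J t) k -> exists p, [/\ inP (th t) (dehom p), forall i, act (J t) i -> p i <= x i & p k = x k].
  move=> t; case: (boolP (P t)) => [Pt|_]; last by exists (fun _ => 0).
  by have [x Hx] := inW_val (G2 t) (YW t) (ex_intro _ None Pt); exists x.
have xv t i : P t -> act (J t) i -> hasval (Y t i) (x t i) by move=> Pt; apply: (Hx t Pt).1.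
have /choice[p0 Hp0] : forall tk : 'I_m * option 'I_n, exists p, P tk.1 -> act (J tk.1) tk.2 ->
   [/\ inP (th tk.1) (dehom p), forall i, act (J tk.1) i -> p i <= x tk.1 i & p tk.2 = x tk.1 tk.2].
  move=> [t k] /=; case: (boolP (P t)) => [Pt|_]; last by exists (fun _ => 0).
  case: (boolP (act (J t) k)) => [kJ|_]; last by exists (fun _ => 0).
  by have [p Hp] := (Hx t Pt).2 k kJ; exists p.
have [t1 Pt1] : exists t, P t.
  apply: contrapT => H; have : \sum_t Y t None = 0.
    by apply: big1 => t _; apply: contrapT => /eqP Yt; apply: H; exists t.
  by rewrite Y1 => /eqP; rewrite oner_eq0.
have [t0 [Pt0 Ht0]] := @max_attained _ P (fun t => x t None) t1 Pt1.
(* The coordinates [None] are nonnegative of sum [1], so their largest valuation is [0]. The weights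
   [p0 tk None] are therefore at most [0], as [vset_sup] demands. *)
have x00 : x t0 None = 0.
  have h : hasval (\sum_t Y t None) (x t0 None).
    apply: (@hasval_sum _ P _ (fun t => x t None) _ t0) => //.
    - by move=> t Pt; apply: xv.
    - by move=> t nP; apply: Yoff; rewrite (negPf nP).
  have h1 : hasvalo 1 (Some 0).
    by split; [rewrite -mono1 monoE eqxx oner_eq0|rewrite -mono1; apply: vle_mono].
  have h2 : hasvalo 1 (Some (x t0 None)) by rewrite -Y1.
  by have [] := hasvalo_uniq h2 h1.
have xNone t : P t -> x t None <= 0 by move=> /Ht0; rewrite x00.
have vj j : (match v j return Prop with
  | Some L => (exists t, [/\ P t, j \in J t & x t (Some j) = L]) /\ forall t, P t -> j \in J t -> x t (Some j) <= L
  | None => forall t, P t -> j \notin J t end).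
  have := hX j; rewrite -YX; pose Q t := P t && (j \in J t).
  have Qv t : Q t -> hasval (Y t (Some j)) (x t (Some j)) by move=> /andP[Pt jJ]; apply: xv.
  case: (pselect (exists t, Q t)) => [[t2 Qt2]|nQ].
    have [t3 [Qt3 Ht3]] := @max_attained _ Q (fun t => x t (Some j)) t2 Qt2.
    have h : hasval (\sum_t Y t (Some j)) (x t3 (Some j)).
      by apply: (@hasval_sum _ Q _ (fun t => x t (Some j)) _ t3) => // t nQ; apply: Yoff.
    move=> /(@hasvalo_uniq _ (Some (x t3 (Some j))) _ h) <-; split.
      by exists t3; case/andP: Qt3.
    by move=> t Pt jJ; apply: Ht3; rewrite /Q Pt.
  have -> : \sum_t Y t (Some j) = 0.
    by apply: big1 => t _; apply: Yoff; apply/negP => Qt; apply: nQ; exists t.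
  case: (v j) => [a [/=]|_ t Pt]; first by rewrite eqxx.
  by apply/negP => jJ; apply: nQ; exists t; rewrite /Q Pt.
(* The homogenised point [p0 tk], split into a point of [val S] and the weight to be added to it. *)
pose E (tk : 'I_m * option 'I_n) : ('I_n -> option R) * R :=
  (fun j => if j \in J tk.1 then Some (dehom (p0 tk) j) else None, p0 tk None).
pose good (tk : 'I_m * option 'I_n) := P tk.1 && act (J tk.1) tk.2.
have EV tk : good tk -> vset S (E tk).1.
  move=> /andP[Pt kJ]; have [hp _ _] := Hp0 tk Pt kJ.
  have [z [Sz hz]] := (HT1 _ (tT tk.1)).2 _ hp.
  exists z; split=> // j; have := hz j; rewrite /= -/(J tk.1).
  by case: (j \in J tk.1).
have Eadd tk j : tadd ((E tk).1 j) (E tk).2 = if j \in J tk.1 then Some (p0 tk (Some j)) else None.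
  by rewrite /=; case: ifP => //= _; rewrite /dehom subrK.
have Ele tk j : good tk -> tle (tadd ((E tk).1 j) (E tk).2) (v j).
  move=> /andP[Pt kJ]; rewrite Eadd; case: ifP => // jJ; have [_ hp _] := Hp0 tk Pt kJ.
  have := vj j; case: (v j) => [L [_ H]|/(_ _ Pt)]; last by rewrite jJ.
  by apply: le_trans (hp (Some j) jJ) _; apply: H.
have g0 : good (t0, None) by rewrite /good Pt0.
have p00 : p0 (t0, None) None = 0 by have [_ _ /= ->] := Hp0 (t0, None) Pt0 isT.
(* The base point [(t0, None)] has weight [0]. A finite coordinate [j] of [v] is attained at
   [(t, Some j)], where the summand [t] has the largest valuation at [j]. *)
pose L := [seq E tk | tk <- enum good].
have InL vc : In vc L -> exists tk, good tk /\ vc = E tk.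
  by move=> /in_map_iff[tk [<- /InP]]; rewrite mem_enum => g; exists tk.
apply: (@vset_sup _ S L (E (t0, None)).1 cS (EV _ g0)).
- move=> vc /InL[tk [g ->]]; split; first exact: EV.
  case/andP: g => Pt kJ; have [_ hp _] := Hp0 tk Pt kJ.
  by apply: le_trans (hp None isT) (xNone _ Pt).
- move=> j; have := Ele _ j g0; rewrite [(E (t0, None)).2]/= p00.
  by case: ((E (t0, None)).1 j) => //= a; rewrite addr0.
- by move=> vc /InL[tk [g ->]] j; apply: Ele.
- move=> j; have := vj j; case Ev: (v j) => [a|]; last by constructor 1.
  move=> [[t [Pt jJ xa]] _]; constructor 3; exists (E (t, Some j)); split.
    by apply: in_map; apply/InP; rewrite mem_enum /in_mem /= /good Pt.
  by rewrite Eadd jJ; have [_ _ ->] := Hp0 (t, Some j) Pt jJ; rewrite xa.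
Qed.

(** * Spectrahedral shadows *)

Section Shadow.
Variable F : rcfType.

Definition aform (V : finType) : Type := (F * (V -> F))%type.
Definition feval (V : finType) (f : aform V) (X : V -> F) : F := f.1 + \sum_v f.2 v * X v.
Definition var (V : finType) (v : V) : aform V := (0, fun w => (w == v)%:R).
Definition fsubst (V V' : finType) (h : aform V') (g : V' -> aform V) : aform V :=
  (h.1 + \sum_v' h.2 v' * (g v').1, fun v => \sum_v' h.2 v' * (g v').2 v).
Definition fcomb V (a : F) (f g : aform V) : aform V := (a * f.1 + g.1, fun v => a * f.2 v + g.2 v).
Definition fcst V (a : F) : aform V := (a, fun=> 0).

Lemma feval_var (V : finType) (v : V) X : feval (var v) X = X v.
Proof.
rewrite /feval /= add0r (bigD1 v) //= eqxx mul1r big1 ?addr0 // => w /negPf->; exact: mul0r.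
Qed.
Lemma feval_subst V V' (h : aform V') (g : V' -> aform V) X : feval (fsubst h g) X = feval h (fun v' => feval (g v') X).
Proof.
rewrite /feval /= -addrA; congr (_ + _).
have -> : \sum_v (\sum_v' h.2 v' * (g v').2 v) * X v = \sum_v' \sum_v h.2 v' * ((g v').2 v * X v).
  rewrite exchange_big; apply: eq_bigr => v _; rewrite mulr_suml; apply: eq_bigr => v' _; exact/esym/mulrA.
by rewrite -big_split; apply: eq_bigr => v' _; rewrite /= mulrDr mulr_sumr.
Qed.
Lemma feval_comb V a (f g : aform V) X : feval (fcomb a f g) X = a * feval f X + feval g X.
Proof.
rewrite /feval /= mulrDr mulr_sumr addrACA -big_split /=; congr (_ + _).
by apply: eq_bigr => v _; rewrite mulrDl mulrA.
Qed.
Lemma feval_cst V a X : feval (fcst V a) X = a.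
Proof. by rewrite /feval /= big1 ?addr0 // => v _; rewrite mul0r. Qed.

Definition psd2 (a b d : F) := [/\ 0 <= a, 0 <= d & b ^+ 2 <= a * d].
Definition blk (V : finType) : Type := (aform V * aform V * aform V)%type.
Definition satb (V : finType) (c : blk V) (X : V -> F) := psd2 (feval c.1.1 X) (feval c.1.2 X) (feval c.2 X).
Definition join (V U : Type) (X : V -> F) (Z : U -> F) : V + U -> F :=
  fun w => match w with inl v => X v | inr u => Z u end.

(** A projection of a set cut out by 2x2 blocks. Variables range over arbitrary finite types, so
    auxiliary variables are added by sum types without renumbering. *)
Definition shadow (V : finType) (W : (V -> F) -> Prop) : Prop :=
  exists (I : finType) (cs : seq (blk (V + I)%type)), forall X, W X <->
    exists Z : I -> F, forall c, In c cs -> satb c (join X Z).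

Lemma shadow_ext (V : finType) (W W' : (V -> F) -> Prop) : (forall X, W X <-> W' X) -> shadow W' -> shadow W.
Proof. by move=> E [I [cs H]]; exists I, cs => X; rewrite E. Qed.

Definition bsubst (V V' : finType) (c : blk V') (g : V' -> aform V) : blk V :=
  (fsubst c.1.1 g, fsubst c.1.2 g, fsubst c.2 g).
Lemma sat_subst (V V' : finType) (c : blk V') (g : V' -> aform V) X : satb (bsubst c g) X <-> satb c (fun v' => feval (g v') X).
Proof. by rewrite /satb /bsubst /= !feval_subst. Qed.

Lemma shadow_psd2 (V : finType) (a b d : aform V) : shadow (fun X => psd2 (feval a X) (feval b X) (feval d X)).
Proof.
exists void, [:: bsubst (a, b, d) (fun v => var (inl v : V + void))] => X.
have E Z : satb (bsubst (a, b, d) (fun v => var (inl v : V + void))) (join X Z) <-> psd2 (feval a X) (feval b X) (feval d X).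
  rewrite sat_subst /satb /= (_ : (fun v' => _) = X) //.
  by apply: funext => v; rewrite feval_var.
split=> [h|[Z h]]; last by apply/(E Z)/h; left.
by exists (fun v : void => match v with end) => c [<-|//]; apply/E.
Qed.

Lemma shadow_map (V V' : finType) (W : (V' -> F) -> Prop) (f : V' -> aform V) : shadow W ->
  shadow (fun X => W (fun v' => feval (f v') X)).
Proof.
move=> [I [cs H]].
pose g (w : V' + I) : aform (V + I)%type :=
  match w with inl v' => fsubst (f v') (fun v => var (inl v : V + I)) | inr i => var (inr i : V + I) end.
exists I, [seq bsubst c g | c <- cs] => X; rewrite H.
have E Z : (fun v' => feval (g v') (join X Z)) = join (fun v' => feval (f v') X) Z.
  apply: funext => -[v'|i] /=; last by rewrite feval_var.
  rewrite feval_subst; congr feval; apply: funext => v; by rewrite feval_var.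
split=> -[Z h]; exists Z => c.
  by move=> /in_map_iff[c' [<- c'cs]]; apply/sat_subst; rewrite E; apply: h.
by move=> ccs; rewrite -E; apply/sat_subst/h; exact: (in_map (fun c => bsubst c g)).
Qed.

Lemma shadow_and (V : finType) (W W' : (V -> F) -> Prop) : shadow W -> shadow W' -> shadow (fun X => W X /\ W' X).
Proof.
move=> [I [cs H]] [I' [cs' H']].
pose g (w : V + I) : aform (V + (I + I'))%type :=
  match w with inl v => var (inl v : V + (I + I')) | inr i => var (inr (inl i) : V + (I + I')) end.
pose g' (w : V + I') : aform (V + (I + I'))%type :=
  match w with inl v => var (inl v : V + (I + I')) | inr i => var (inr (inr i) : V + (I + I')) end.
exists (I + I')%type, ([seq bsubst c g | c <- cs] ++ [seq bsubst c g' | c <- cs']) => X; rewrite H H'.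
have E Z : (fun v' => feval (g v') (join X Z)) = join X (Z \o inl).
  by apply: funext => -[v|i] /=; rewrite feval_var.
have E' Z : (fun v' => feval (g' v') (join X Z)) = join X (Z \o inr).
  by apply: funext => -[v|i] /=; rewrite feval_var.
split=> [[[Z h] [Z' h']]|[Z h]].
  exists (join Z Z') => c; rewrite in_app_iff => -[] /in_map_iff[c' [<- c'cs]]; apply/sat_subst.
    by rewrite E; apply: h.
  by rewrite E'; apply: h'.
split.
  by exists (Z \o inl) => c ccs; rewrite -E; apply/sat_subst/h; rewrite in_app_iff; left; exact: (in_map (fun c => bsubst c g)).
by exists (Z \o inr) => c ccs; rewrite -E'; apply/sat_subst/h; rewrite in_app_iff; right; exact: (in_map (fun c => bsubst c g')).
Qed.

Lemma shadow_ex (V U : finType) (W : (V + U -> F) -> Prop) : shadow W ->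
  shadow (fun X => exists Z : U -> F, W (join X Z)).
Proof.
move=> [I [cs H]].
pose g (w : (V + U) + I) : aform (V + (U + I))%type :=
  match w with inl (inl v) => var (inl v : V + (U + I)) | inl (inr u) => var (inr (inl u) : V + (U + I))
   | inr i => var (inr (inr i) : V + (U + I)) end.
exists (U + I)%type, [seq bsubst c g | c <- cs] => X.
have E Z : (fun v' => feval (g v') (join X Z)) = join (join X (Z \o inl)) (Z \o inr).
  by apply: funext => -[[v|u]|i] /=; rewrite feval_var.
split=> [[Z /H[Z' h]]|[Z h]].
  exists (join Z Z') => c /in_map_iff[c' [<- c'cs]]; apply/sat_subst; rewrite E; exact: h.
exists (Z \o inl); apply/H; exists (Z \o inr) => c ccs.
by rewrite -E; apply/sat_subst/h; exact: (in_map (fun c => bsubst c g)).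
Qed.

Lemma shadow_ge0 (V : finType) (f : aform V) : shadow (fun X => 0 <= feval f X).
Proof.
apply: shadow_ext (shadow_psd2 f (fcst V 0) (fcst V 0)) => X.
by rewrite !feval_cst; split=> [h|[]//]; split=> //; rewrite expr0n mulr0.
Qed.
Lemma shadow_true (V : finType) : shadow (fun _ : V -> F => True).
Proof.
by apply: shadow_ext (shadow_ge0 (fcst V 0)) => X; rewrite feval_cst.
Qed.
Lemma shadow_le (V : finType) (f g : aform V) : shadow (fun X => feval f X <= feval g X).
Proof.
apply: shadow_ext (shadow_ge0 (fcomb (-1) f g)) => X.
by rewrite feval_comb mulN1r addrC subr_ge0.
Qed.
Lemma shadow_eq (V : finType) (f g : aform V) : shadow (fun X => feval f X = feval g X).
Proof.
apply: shadow_ext (shadow_and (shadow_le f g) (shadow_le g f)) => X.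
by split=> [->|[h1 h2]]; [rewrite lexx|apply/le_anti; rewrite h1].
Qed.
Lemma shadow_imp (V : finType) (b : bool) (W : (V -> F) -> Prop) : (b -> shadow W) -> shadow (fun X => b -> W X).
Proof.
case: b => [/(_ isT)|_]; first by apply: shadow_ext => X; split=> [/(_ isT)|].
by apply: shadow_ext (shadow_true V) => X.
Qed.
Lemma shadow_all (V : finType) (T : eqType) (s : seq T) (W : T -> (V -> F) -> Prop) :
  (forall t, t \in s -> shadow (W t)) -> shadow (fun X => forall t, t \in s -> W t X).
Proof.
elim: s => [|t s IH] H; first by apply: shadow_ext (shadow_true V) => X; split.
have h1 := H t (mem_head _ _).
have h2 : shadow (fun X => forall t, t \in s -> W t X).
  by apply: IH => t' t's; apply: H; rewrite in_cons t's orbT.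
apply: shadow_ext (shadow_and h1 h2) => X; split=> [h|[h h'] t'].
  by split=> [|t' t's]; apply: h; rewrite in_cons ?eqxx ?t's ?orbT.
by rewrite in_cons => /orP[/eqP->|/h'].
Qed.
Lemma shadow_allT (V : finType) (T : finType) (W : T -> (V -> F) -> Prop) :
  (forall t, shadow (W t)) -> shadow (fun X => forall t, W t X).
Proof.
move=> H; apply: shadow_ext (@shadow_all V T (enum T) W (fun t _ => H t)) => X.
by split=> [h t _|h t]; [exact: h|apply: h; rewrite mem_enum].
Qed.

Lemma root_pow2 (x : F) q : 0 <= x -> exists a, 0 <= a /\ a ^+ (2 ^ q) = x.
Proof.
elim: q x => [|q IH] x x0; first by exists x.
have [a [a0 Ea]] := IH _ (sqrtr_ge0 x); exists a; split=> //.
by rewrite expnSr exprM Ea sqr_sqrtr.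
Qed.

(** A binary tree of conditions [y^2 <= a b]. *)
Lemma shadow_geom (V : finType) q (y : aform V) (ls : seq (aform V)) : size ls = (2 ^ q)%N ->
  shadow (fun X => [/\ 0 <= feval y X, forall l, In l ls -> 0 <= feval l X & feval y X ^+ (2 ^ q) <= \prod_(l <- ls) feval l X]).
Proof.
elim: q V y ls => [|q IH] V y ls sl.
  case: ls sl => [|l [|]] // _.
  apply: shadow_ext (shadow_and (shadow_ge0 y) (shadow_and (shadow_ge0 l) (shadow_le y l))) => X.
  rewrite big_seq1 expr1; split=> [[h1 h2 h3]|[h1 [h2 h3]]]; first by split=> //; split=> //; apply: h2; left.
  by split=> // l' [<-|].
pose up (f : aform V) : aform (V + bool)%type := fsubst f (fun v => var (inl v : V + bool)).
have upE f X Z : feval (up f) (join X Z) = feval f X.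
  by rewrite feval_subst; congr feval; apply: funext => v; rewrite feval_var.
pose ls1 := take (2 ^ q) ls; pose ls2 := drop (2 ^ q) ls.
have s1 : size [seq up l | l <- ls1] = (2 ^ q)%N.
  by rewrite size_map size_take sl expnS ltn_Pmull // expn_gt0.
have s2 : size [seq up l | l <- ls2] = (2 ^ q)%N.
  by rewrite size_map size_drop sl expnS mul2n -addnn addnK.
have lsE : ls = ls1 ++ ls2 by rewrite cat_take_drop.
have inls l : In l ls <-> In l ls1 \/ In l ls2 by rewrite {1}lsE in_app_iff.
pose A := var (inr true : V + bool); pose B := var (inr false : V + bool).
have H := shadow_ex (shadow_and (shadow_psd2 A (up y) B) (shadow_and (shadow_ge0 (up y))
   (shadow_and (IH _ A _ s1) (IH _ B _ s2)))).
apply: shadow_ext H => X.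
have pE Z (l : seq (aform V)) : \prod_(f <- [seq up f | f <- l]) feval f (join X Z) = \prod_(f <- l) feval f X.
  by rewrite big_map; apply: eq_bigr => f _; rewrite upE.
have aE Z (l : seq (aform V)) : (forall f, In f [seq up f | f <- l] -> 0 <= feval f (join X Z)) <-> forall f, In f l -> 0 <= feval f X.
  split=> h f; first by move=> fl; have := h _ (in_map up l f fl); rewrite upE.
  by move=> /in_map_iff[f' [<- f'l]]; rewrite upE; apply: h.
have p0 (l : seq (aform V)) : (forall f, In f l -> 0 <= feval f X) -> 0 <= \prod_(f <- l) feval f X.
  elim: l => [|f l IHl] h; first by rewrite big_nil.
  by rewrite big_cons mulr_ge0 //; [apply: h; left|apply: IHl => f' ?; apply: h; right].
split=> [[y0 l0 le]|[Z [[a0 b0]]]].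
  have l1 : forall l, In l ls1 -> 0 <= feval l X by move=> l ?; apply/l0/inls; left.
  have l2 : forall l, In l ls2 -> 0 <= feval l X by move=> l ?; apply/l0/inls; right.
  (* The auxiliary values are the roots of order [2^q] of the two half products; [y^2 <= a b] is
     then checked after raising to the power [2^q]. *)
  have [a [a0 Ea]] := root_pow2 q (p0 _ l1).
  have [b [b0 Eb]] := root_pow2 q (p0 _ l2).
  exists (fun c => if c then a else b).
  rewrite !pE !upE !feval_var /=; split; last first.
    by split=> //; split; split=> //; rewrite ?Ea ?Eb //; apply/aE.
  split=> //; rewrite -(@ler_pXn2r _ (2 ^ q)) ?expn_gt0 // ?nnegrE ?sqr_ge0 ?mulr_ge0 //.
  by rewrite (exprMn _ a b) Ea Eb -exprM -expnS -big_cat -lsE.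
rewrite upE; move: a0 b0; rewrite !feval_var /= => a0 b0 yab [y0 [[_ /aE l1 h1] [_ /aE l2 h2]]].
rewrite !pE in h1 h2.
split=> //; first by move=> l /inls[/l1|/l2].
rewrite expnS exprM lsE big_cat /=.
apply: le_trans (ler_pM _ _ h1 h2); rewrite ?exprn_ge0 // -exprMn.
by rewrite ler_pXn2r ?expn_gt0 ?nnegrE ?sqr_ge0 ?mulr_ge0.
Qed.
End Shadow.

Lemma shadow_inW n (J : {set 'I_n}) (G : option 'I_n -> seq (seq (option 'I_n) * R)) :
  (forall k lc, act J k -> lc \in G k -> exists q, size lc.1 = (2 ^ q)%N) ->
  shadow (fun X : option 'I_n -> K => inW J G X).
Proof.
move=> HG.
have S1 : shadow (fun X : option 'I_n -> K => forall i, 0 <= X i).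
  apply: shadow_allT => i; apply: shadow_ext (shadow_ge0 (var K i)) => X; by rewrite feval_var.
have S2 : shadow (fun X : option 'I_n -> K => forall i, ~~ act J i -> X i = 0).
  apply: shadow_allT => i; apply: shadow_imp => _.
  apply: shadow_ext (shadow_eq (var K i) (fcst _ 0)) => X; by rewrite feval_var feval_cst.
(* A block for [X j ^+ 2 <= X l * u] also asserts [0 <= X l]. The extra conjunct is supplied by the
   first condition of [inW] at the end. *)
have S3 : shadow (fun X : option 'I_n -> K => forall j l, act J j -> act J l -> exists u, 0 <= u /\ X j ^+ 2 <= X l * u /\ 0 <= X l).
  apply: shadow_allT => j; apply: shadow_allT => l; apply: shadow_imp => _; apply: shadow_imp => _.
  have H := shadow_ex (shadow_psd2 (var K (inl l : option 'I_n + unit)) (var K (inl j : option 'I_n + unit)) (var K (inr tt : option 'I_n + unit))).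
  apply: shadow_ext H => X; split=> [[u [u0 [h Xl]]]|[Z [a0 d0]]].
    by exists (fun _ => u); split; rewrite !feval_var.
  by rewrite !feval_var in a0 d0 * => h; exists (Z tt).
have S4 : shadow (fun X : option 'I_n -> K => forall k, act J k -> forall lc, lc \in G k ->
   [/\ 0 <= X k, forall i, i \in lc.1 -> 0 <= X i & X k ^+ (size lc.1) <= mono 1 lc.2 * \prod_(i <- lc.1) X i]).
  apply: shadow_allT => k; apply: shadow_imp => kJ; apply: shadow_all => -[l c] lcG.
  have [q /= sq] := HG k _ kJ lcG.
  case: l sq lcG => [|i l] sq _; first by have := expn_gt0 2 q; rewrite -sq.
  have m0 : 0 < mono 1 c by apply: mono_gt0.
  (* The monomial factor is absorbed into the first form of the list, which is nonempty because its
     size is a power of two. *)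
  pose ls := fcomb (mono 1 c) (var K i) (fcst _ 0) :: [seq var K j | j <- l].
  have sls : size ls = (2 ^ q)%N by rewrite -sq /= size_map.
  apply: shadow_ext (shadow_geom (var K k) sls) => X.
  have lE : \prod_(f <- ls) feval f X = mono 1 c * \prod_(j <- i :: l) X j.
    rewrite !big_cons feval_comb feval_var feval_cst addr0 mulrA big_map; congr (_ * _).
    by apply: eq_bigr => j _; rewrite feval_var.
  rewrite lE sq feval_var.
  split=> -[h1 h2 h3]; split=> // f.
    case=> [<-|/in_map_iff[j [<- /InP jl]]]; last by rewrite feval_var; apply: h2; rewrite in_cons jl orbT.
    by rewrite feval_comb feval_var feval_cst addr0 mulr_ge0 ?(ltW m0) //; apply: h2; rewrite mem_head.
  rewrite in_cons => /orP[/eqP->|fl].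
    have := h2 _ (or_introl erefl); rewrite feval_comb feval_var feval_cst addr0 pmulr_rge0 //.
  by have := h2 (var K f); rewrite feval_var; apply; right; apply: in_map; apply/InP.
apply: shadow_ext (shadow_and (shadow_and S1 S2) (shadow_and S3 S4)) => X.
split=> [[h1 h2 h3 h4]|[[h1 h2] [h3 h4]]]; split=> //.
- split=> [j l jJ lJ|k kJ lc lcG]; last by split=> //; apply: h4.
  by have [u [u0 h]] := h3 j l jJ lJ; exists u.
- by move=> j l jJ lJ; have [u [u0 [h _]]] := h3 j l jJ lJ; exists u.
- by move=> k kJ lc lcG; have [] := h4 k kJ lc lcG.
Qed.

Lemma feval_sum (F : rcfType) (V T : finType) (f : T -> V) :
  exists g : aform F V, forall X, feval g X = \sum_t X (f t).
Proof.
suff H (s : seq T) : exists g : aform F V, forall X, feval g X = \sum_(t <- s) X (f t).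
  by have [g Hg] := H (enum T); exists g => X'; rewrite Hg big_enum.
elim: s => [|t s [g Hg]]; first by exists (fcst V 0) => X'; rewrite feval_cst big_nil.
by exists (fcomb 1 (var F (f t)) g) => X'; rewrite feval_comb feval_var mul1r Hg big_cons.
Qed.

Lemma shadow_inSum m n (J : 'I_m -> {set 'I_n}) (G : 'I_m -> option 'I_n -> seq (seq (option 'I_n) * R)) :
  (forall t k lc, act (J t) k -> lc \in G t k -> exists q, size lc.1 = (2 ^ q)%N) ->
  shadow (fun X : 'I_n -> K => inSum J G X).
Proof.
move=> HG; pose U : finType := ('I_m * option 'I_n)%type.
have S1 : shadow (fun XZ : 'I_n + U -> K => forall t, inW (J t) (G t) (fun i => XZ (inr (t, i)))).
  apply: shadow_allT => t; have H := shadow_map (fun i => var K (inr (t, i) : 'I_n + U)) (shadow_inW (HG t)).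
  apply: shadow_ext H => X; suff -> : (fun v' => feval (var K (inr (t, v') : 'I_n + U)) X) = (fun i => X (inr (t, i))) by [].
  by apply: funext => i; rewrite feval_var.
have S2 : shadow (fun XZ : 'I_n + U -> K => \sum_t XZ (inr (t, None)) = 1).
  have [g Hg] := @feval_sum K _ _ (fun t : 'I_m => inr (t, None) : 'I_n + U).
  by apply: shadow_ext (shadow_eq g (fcst _ 1)) => X; rewrite Hg feval_cst.
have S3 : shadow (fun XZ : 'I_n + U -> K => forall j, \sum_t XZ (inr (t, Some j)) = XZ (inl j)).
  apply: shadow_allT => j; have [g Hg] := @feval_sum K _ _ (fun t : 'I_m => inr (t, Some j) : 'I_n + U).
  by apply: shadow_ext (shadow_eq g (var K (inl j : 'I_n + U))) => X; rewrite Hg feval_var.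
apply: shadow_ext (shadow_ex (shadow_and S1 (shadow_and S2 S3))) => X.
split=> [[Y [h1 h2 h3]]|[Z [h1 [h2 h3]]]].
  by exists (fun ti : U => Y ti.1 ti.2).
by exists (fun t i => Z (t, i)).
Qed.

(** * Assembling the blocks into one linear matrix inequality *)

Lemma ford_F1 n : ford (Fin.F1 : Fin.t n.+1) = ord0.
Proof. by apply: val_inj. Qed.
Lemma ford_FS n (i : Fin.t n) : ford (Fin.FS i) = lift ord0 (ford i).
Proof. by apply: val_inj; rewrite /= /bump /=; case: (Fin.to_nat i). Qed.
Lemma ford_L n n' (i : Fin.t n) : ford (Fin.L n' i) = lshift n' (ford i).
Proof. by apply: val_inj; rewrite /= Fin.L_sanity. Qed.

Lemma fsum_sum m (F : 'I_m -> K) : fsum m (fun i => kf (F (ford i))) = kf (\sum_i F i).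
Proof.
elim: m F => [|m IH] F; first by rewrite big_ord0.
rewrite big_ord_recl /= ford_F1 (_ : (fun i => _) = fun i => kf ((F \o lift ord0) (ford i))) ?IH //.
by apply: funext => i; rewrite ford_FS.
Qed.

Lemma psd2P (F : realFieldType) (a b d : F) :
  [/\ 0 <= a, 0 <= d & b ^+ 2 <= a * d] <-> forall x y, 0 <= a * x ^+ 2 + 2 * b * x * y + d * y ^+ 2.
Proof.
split=> [[a0 d0 h] x y|H].
  case: (eqVneq a 0) h => [->|an0] h.
    have b0 : b = 0 by apply/eqP; rewrite -sqrf_eq0 eq_le sqr_ge0 andbT; rewrite mul0r in h.
    by rewrite b0; have := mulr_ge0 d0 (sqr_ge0 y); lra.
  have ap : 0 < a by rewrite lt_def an0.
  rewrite -(pmulr_rge0 _ ap).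
  have := mulr_ge0 (_ : 0 <= a * d - b ^+ 2) (sqr_ge0 y); rewrite subr_ge0 => /(_ h).
  have := sqr_ge0 (a * x + b * y); lra.
have a0 : 0 <= a by have := H 1 0; lra.
have d0 : 0 <= d by have := H 0 1; lra.
split=> //; case: (eqVneq a 0) => [aE|an0].
  (* With [a = 0] the form takes the value [- (d + 2) b^2] at this vector, which forces [b = 0]. *)
  have h := H (- (d + 1)) b; rewrite aE in h *.
  have e : 0 <= - ((d + 2) * b ^+ 2) by lra.
  by rewrite mul0r; move: e; rewrite oppr_ge0 pmulr_rle0 //; lra.
have ap : 0 < a by rewrite lt_def an0.
(* At [(- b, a)] the form equals [a (a d - b^2)]. *)
by rewrite -subr_ge0 -(pmulr_rge0 _ ap); have := H (- b) a; lra.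
Qed.

Definition bent (F : Type) (c : F * F * F) (s t : bool) : F := if s == t then (if s then c.1.1 else c.2) else c.1.2.

(** The form of a block-diagonal matrix is the sum of the forms of its blocks, and a vector
    supported on one block isolates it. *)
Lemma block_psd (F : realFieldType) k (c : 'I_k -> F * F * F) :
  (forall v : 'I_k * bool -> F, 0 <= \sum_s \sum_t v s * ((if s.1 == t.1 then bent (c s.1) s.2 t.2 else 0) * v t)) <->
  forall i, [/\ 0 <= (c i).1.1, 0 <= (c i).2 & (c i).1.2 ^+ 2 <= (c i).1.1 * (c i).2].
Proof.
have E v : \sum_s \sum_t v s * ((if s.1 == t.1 then bent (c s.1) s.2 t.2 else 0) * v t) =
  \sum_i ((c i).1.1 * v (i, true) ^+ 2 + 2 * (c i).1.2 * v (i, true) * v (i, false) + (c i).2 * v (i, false) ^+ 2).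
  have pairs (g : 'I_k * bool -> F) : \sum_p g p = \sum_i \sum_b g (i, b).
    by rewrite (pair_bigA _ (fun i b => g (i, b))); apply: eq_bigr => -[].
  rewrite pairs; apply: eq_bigr => i _.
  have E b : \sum_t v (i, b) * ((if i == t.1 then bent (c i) b t.2 else 0) * v t) =
     \sum_b' v (i, b) * (bent (c i) b b' * v (i, b')).
    rewrite pairs (bigD1 i) //= [X in _ + X]big1 ?addr0 => [|j ji]; first by rewrite eqxx.
    by rewrite eq_sym (negPf ji) big1 // => b' _; rewrite mul0r mulr0.
  rewrite !big_bool /= !E !big_bool /bent /=; ring.
split=> [H i|H v]; last by rewrite E sumr_ge0 // => i _; exact: (psd2P _ _ _).1 (H i) _ _.
apply/psd2P => x y; have := H (fun s => if s.1 == i then (if s.2 then x else y) else 0).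
rewrite E (bigD1 i) //= eqxx big1 ?addr0 // => j /negPf->; ring.
Qed.

Lemma In_nth (T : Type) (x0 : T) (s : seq T) x : In x s <-> exists i : 'I_(size s), nth x0 s i = x.
Proof.
elim: s => [|y s IH] /=; first by split=> // -[[]].
split=> [[->|/IH[i Ei]]|[[[|i] Hi] /= E]].
- by exists ord0.
- by exists (lift ord0 i).
- by left.
- by right; apply/IH; exists (Ordinal (Hi : (i < size s)%N)).
Qed.

Lemma shadow_spectrahedron n (W : ('I_n -> K) -> Prop) : shadow W ->
  exists n' (S' : kvec (n + n') -> Prop), spectrahedron S' /\
    forall x : kvec n, proj_first n n' S' x <-> exists X, W X /\ x = toK X.
Proof.
move=> [I [cs H]]; pose n' := #|I|.
(* The original coordinates come first and the auxiliary ones after them, so that [proj_first]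
   forgets exactly the auxiliary variables. *)
pose e (k : 'I_(n + n')) : 'I_n + I := match split k with inl j => inl j | inr i => inr (enum_val i) end.
pose e' (v : 'I_n + I) : 'I_(n + n') := match v with inl j => lshift n' j | inr i => rshift n (enum_rank i) end.
have eK : cancel e e'.
  move=> k; rewrite /e; case: splitP => j kj; apply: val_inj => //=.
  by rewrite enum_valK.
have e'K : cancel e' e.
  move=> [j|i]; rewrite /e /e'.
    by rewrite -[lshift _ _]/(unsplit (inl j)) unsplitK.
  by rewrite -[rshift _ _]/(unsplit (inr (enum_rank i))) unsplitK enum_rankK.
pose T : finType := ('I_(size cs) * bool)%type.
pose m := #|T|.
pose phi (i : Fin.t m) : T := enum_val (ford i).
pose c0 : blk K ('I_n + I)%type := (fcst _ 0, fcst _ 0, fcst _ 0).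
pose E (s t : T) : aform K ('I_n + I)%type := if s.1 == t.1 then bent (nth c0 cs s.1) s.2 t.2 else fcst _ 0.
have Esym s t : E s t = E t s.
  rewrite /E eq_sym; case: eqP => // ->; rewrite /bent eq_sym; case: eqP => [->//|//].
pose Q0 : kmat m := fun i j => kf (E (phi i) (phi j)).1.
pose Q (k : Fin.t (n + n')) : kmat m := fun i j => kf ((E (phi i) (phi j)).2 (e (ford k))).
pose S' (y : kvec (n + n')) := is_kvec y /\
   kpsd (fun i j => kadd (Q0 i j) (fsum (n + n') (fun k => kmul (y k) (Q k i j)))).
exists n', S'; split.
  exists m, Q0, Q; split; first by move=> i j; apply: kfP.
  split; first by move=> k i j; apply: kfP.
  split; first by move=> i j; rewrite /Q0 Esym.
  by split=> // k i j; rewrite /Q Esym.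
have SE (x : 'I_n + I -> K) : S' (toK (x \o e)) <-> forall c, In c cs -> satb c x.
  have ME i j : kadd (Q0 i j) (fsum (n + n') (fun k => kmul (toK (x \o e) k) (Q k i j))) = kf (feval (E (phi i) (phi j)) x).
    rewrite /Q0 /feval (reindex e) /=; last by exists e' => v _; [apply: eK|apply: e'K].
    rewrite -[RHS]/(kadd _ _) -fsum_sum; congr (kadd _ (fsum _ _)); apply: funext => k.
    by rewrite /toK /Q -!kmE mulrC.
  have QE (v : T -> K) :
     fsum m (fun i => fsum m (fun j => kmul (kf (v (phi i))) (kmul (kadd (Q0 i j) (fsum (n + n') (fun k => kmul (toK (x \o e) k) (Q k i j)))) (kf (v (phi j)))))) =
     kf (\sum_s \sum_t v s * (feval (E s t) x * v t)).
    have red (g : T -> K) : fsum m (fun i => kf (g (phi i))) = kf (\sum_s g s).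
      rewrite (@reindex _ _ _ _ _ (@enum_val T T)) /=; last by exists enum_rank => s _; rewrite ?enum_valK ?enum_rankK.
      by rewrite -fsum_sum.
    rewrite -red; congr fsum; apply: funext => i; rewrite -red; congr fsum; apply: funext => j.
    by rewrite ME.
  have BE s t : feval (E s t) x = if s.1 == t.1 then bent (feval (nth c0 cs s.1).1.1 x, feval (nth c0 cs s.1).1.2 x, feval (nth c0 cs s.1).2 x) s.2 t.2 else 0.
    by rewrite /E /bent; case: eqP => _; [case: eqP => _ //=; case: (s.2)|rewrite feval_cst].
  have main := @block_psd K (size cs) (fun i => (feval (nth c0 cs i).1.1 x, feval (nth c0 cs i).1.2 x, feval (nth c0 cs i).2 x)).
  transitivity (forall v : T -> K, 0 <= \sum_s \sum_t v s * (feval (E s t) x * v t)).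
    split=> [[_ h] v|h].
      have := h (fun i => kf (v (phi i))) (fun i => kfP _).
      by rewrite QE knonnegP.
    split; first exact: toK_kvec.
    move=> w /kvec_toK[w' ->]; have := h (fun s => w' (enum_rank s)).
    rewrite -knonnegP -QE; congr knonneg; congr fsum; apply: funext => i; congr fsum; apply: funext => j.
    by rewrite /toK /phi !enum_valK.
  split=> [h c /(In_nth c0)[i <-]|h v].
    have /main hh : forall v : T -> K, 0 <= \sum_s \sum_t v s * ((if s.1 == t.1 then bent (feval (nth c0 cs s.1).1.1 x, feval (nth c0 cs s.1).1.2 x, feval (nth c0 cs s.1).2 x) s.2 t.2 else 0) * v t).
      by move=> v; have := h v; under eq_bigr do under eq_bigr do rewrite BE.
    exact: (hh i).
  under eq_bigr do under eq_bigr do rewrite BE.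
  apply: main.2 v => i; apply: h; apply/(In_nth c0); by exists i.
move=> x; split=> [[y [yS' xy]]|[X [/H[Z h] ->]]].
  have [y' yE] := kvec_toK yS'.1.
  exists (fun j => y' (lshift n' j)); split; last first.
    by apply: funext => i; rewrite xy yE /toK ford_L.
  apply/H; exists (fun i => y' (e' (inr i))); apply/SE.
  rewrite (_ : _ \o e = y') -?yE //; apply: funext => k; rewrite /= -[in RHS](eK k).
  by case: (e k).
exists (toK (join X Z \o e)); split; first exact/SE.
by move=> i; rewrite /toK /= ford_L -[lshift _ _]/(e' (inl (ford i))) e'K.
Qed.

Lemma val_imageE n (A : kvec n -> Prop) v : (forall x, A x -> is_kvec x) ->
  val_image A v <-> vset A (fun j => v (fint j)).
Proof.
move=> HA; split=> [[x [Ax hx]]|[X [AX hX]]].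
  have [X xE] := kvec_toK (HA x Ax); rewrite xE in Ax hx; exists X; split=> // j.
  by have /has_valE := hx (fint j); rewrite /toK fintK.
by exists (toK X); split=> // i; apply/has_valE; have := hX (ford i); rewrite fordK.
Qed.

Lemma semialg_kvec n (S : kvec n -> Prop) x : semialgebraic S -> S x -> is_kvec x.
Proof.
move=> [L [HL HS]] /HS[B [BL Bx]].
have [ps [qs [_ [_ HB]]]] := (Forall_forall _ L).1 HL B BL.
by have [] := (HB x).1 Bx.
Qed.

Lemma val_shadow n (S : kvec n -> Prop) : semialgebraic S -> kconvex S ->
  exists n' (S' : kvec (n + n') -> Prop), spectrahedron S' /\
    forall v, val_image S v <-> val_image (proj_first n n' S') v.
Proof.
move=> sS cS; have [m [J [G [HG Hv]]]] := vset_sum sS cS.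
have [n' [S' [spS' HS']]] := shadow_spectrahedron (shadow_inSum HG).
exists n', S'; split=> // v.
rewrite val_imageE => [|x]; last exact: semialg_kvec.
rewrite val_imageE => [|x /HS'[X [_ ->]]]; last exact: toK_kvec.
rewrite Hv; split=> [[X [XW hX]]|[X [/HS'[X' [X'W E]] hX]]].
  by exists X; split=> //; apply/HS'; exists X.
exists X'; split=> // j; suff <- : X j = X' j by [].
by apply: K_ext => t; have := congr1 (fun f : kvec n => f (fint j) t) E; rewrite /toK fintK.
Qed.

End TropicalHeltonNie.

Theorem theorem1 :
  forall (n : nat), (1 <= n)%nat ->
  forall (S : kvec n -> Prop), semialgebraic S -> kconvex S ->
  exists (n' : nat) (S' : kvec (n + n') -> Prop),
    spectrahedron S' /\
    forall v, val_image S v <-> val_image (proj_first n n' S') v.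
Proof. intros n _ S sS cS; exact (TropicalHeltonNie.val_shadow sS cS). Qed.
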